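(* Let $\mathbb{F}$ be a field and let $K$ be a finite simplicial complex with $m$ vertices. The following statements are equivalent: (a) $K$ is weakly taut over $\mathbb{F}$. (b) Each full subcomplex $K|_J$ ($J\subseteq V(K)$) of $K$ is homotopy equivalent either to a point or to a sphere, and the number of full subcomplexes of $K$ (i.e. of subsets $J\subseteq V(K)$) that are homotopy equivalent to a sphere is $2^{m-\mathrm{mdim}(K)-1}$. (c) The (total) reduced homology with coefficients in $\mathbb{F}$ of any full subcomplex of $K$ is either trivial or has rank $1$, and the number of full subcomplexes of $K$ (i.e. of subsets $J\subseteq V(K)$) with rank $1$ reduced homology equals $2^{m-\mathrm{mdim}(K)-1}$.
   Context: A finite simplicial complex $K$ with vertex set $V(K)=[m]=\{v_1,\dots,v_m\}$ ($m\ge 0$) contains $\varnothing$ and every singleton $\{v_i\}$ as a face; for $m=0$, $K=\{\varnothing\}$. For $J\subseteq V(K)$, the full subcomplex $K|_J$ consists of all faces of $K$ contained in $J$. The irrelevant complex $\{\varnothing\}=K|_{\varnothing}$ is counted among the full subcomplexes; it is regarded as the sphere $S^{-1}$, and its only nonzero reduced homology group is $\widetilde{H}_{-1}(\{\varnothing\};\mathbb{F})=\mathbb{F}$. Homotopy equivalence refers to geometric realizations. The dimension of a face $\sigma$ is $|\sigma|-1$, and $\mathrm{mdim}(K)$ is the minimal dimension of the maximal simplices of $K$ (so $\mathrm{mdim}(\{\varnothing\})=-1$). For a field $\mathbb{F}$, $\mathbb{F}[K]=\mathbb{F}[v_1,\dots,v_m]/\mathcal{I}_K$ is the Stanley-Reisner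 ring and $\widetilde{D}(K;\mathbb{F})=\dim_{\mathbb{F}}\mathrm{Tor}_{\mathbb{F}[v_1,\dots,v_m]}(\mathbb{F}[K],\mathbb{F})$; equivalently (Hochster's formula) $\widetilde{D}(K;\mathbb{F})=\sum_{J\subseteq[m]}\sum_{i\ge -1}\dim_{\mathbb{F}}\widetilde{H}_i(K|_J;\mathbb{F})$. $K$ is weakly taut over $\mathbb{F}$ if $\widetilde{D}(K;\mathbb{F})=2^{m-\mathrm{mdim}(K)-1}$. *)

(* Defs.v *)
From HB Require Import structures.
From mathcomp Require Import all_boot all_order all_algebra.
From mathcomp Require Import all_classical all_reals all_analysis.
From mathcomp.multinomials Require mpoly.
Import (canonicals, coercions) mpoly.

Set Implicit Arguments.
Unset Strict Implicit.
Unset Printing Implicit Defensive.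

Import Order.TTheory GRing.Theory Num.Theory.
Import numFieldNormedType.Exports.
Local Open Scope set_scope.
Local Open Scope ring_scope.

Record scomplex (m : nat) := SComplex {
  faces :> {set {set 'I_m}};
  face_set0 : finset.set0 \in faces;
  face_vertex : forall v : 'I_m, [set v]%SET \in faces;
  face_sub : forall s t : {set 'I_m}, s \in faces -> t \subset s -> t \in faces
}.

(* The faces of K|_J.  This is a bare family of faces, and not an [scomplex m],
   because the vertices outside J are not faces of it. *)
Definition full_sub m (K : scomplex m) (J : {set 'I_m}) : {set {set 'I_m}} :=
  [set s in (K : {set {set 'I_m}}) | s \subset J].

(* A face s has dimension #|s| - 1.  All facets have at most m vertices, so the
   default value m of the minimum is harmless. *)
Definition mdim m (K : scomplex m) : int :=
  (\big[minn/m]_(s : {set 'I_m} | maxset (fun t => t \in faces K) s) #|s|%N)%:Z - 1.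

(* m - mdim K - 1 is never negative, since a facet has at most m vertices. *)
Definition taut_number m (K : scomplex m) : nat :=
  (2 ^ absz (m%:Z - mdim K - 1)%R)%N.

Section Homology.
Variables (F : fieldType) (m : nat) (L : {set {set 'I_m}}).

Definition faces_card (k : nat) : {set {set 'I_m}} := [set s in L | #|s| == k].

Definition face_of k (a : 'I_#|faces_card k|) : {set 'I_m} := enum_val a.

(* Matrix, acting on row vectors, of the boundary map from (k-1)-chains to
   (k-2)-chains: the simplex {v_0 < ... < v_(k-1)} goes to the sum of
   (-1)^i {v_0, ..., v_(k-1)} \ {v_i}.  For k = 0 the sum defining the entries
   is empty, so this is the zero map out of the chains spanned by the empty
   face. *)
Definition boundary (k : nat) : 'M[F]_(#|faces_card k|, #|faces_card k.-1|) :=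
  \matrix_(a, b)
    \sum_(v in face_of a | face_of a :\ v == face_of b)
      (-1) ^+ #|[set w in face_of a | (w < v)%N]|.

(* dimension of the reduced homology in degree k - 1 *)
Definition rhomology_dim (k : nat) : nat :=
  (\rank (kermx (boundary k)) - \rank (boundary k.+1))%N.

Definition rhomology_rank : nat := (\sum_(k < m.+1) rhomology_dim k)%N.

End Homology.

(* A resolution of the S-module S/I by free modules of finite rank.  Maps of
   free modules are matrices acting on row vectors; the augmentation S^n -> S/I
   is given by representatives in S of the images of the basis vectors. *)
Record free_resolution (S : comNzRingType) (I : S -> Prop) := FreeResolution {
  res_rank : nat -> nat;
  res_aug : 'cV[S]_(res_rank 0);
  res_d : forall i, 'M[S]_(res_rank i.+1, res_rank i);
  res_surj : forall s : S,
    exists u : 'rV[S]_(res_rank 0), I ((u *m res_aug) 0 0 - s);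
  res_exact0 : forall u : 'rV[S]_(res_rank 0),
    I ((u *m res_aug) 0 0) <-> exists w, u = w *m res_d 0;
  res_exactS : forall i (u : 'rV[S]_(res_rank i.+1)),
    u *m res_d i = 0 <-> exists w, u = w *m res_d i.+1
}.

Section Tor.
Variables (F : fieldType) (m : nat).
Local Notation S := (mpoly.mpoly m F).

(* the action of S on the module F = S/(v_1, ..., v_m) *)
Definition eval0 : S -> F := mpoly.meval (fun _ : 'I_m => 0).

Definition face_monomial (s : {set 'I_m}) : S :=
  \prod_(i in s) mpoly.mpolyX F (mpoly.mnm1 i).

(* The Stanley-Reisner ideal I_K, generated by the monomials of the non-faces;
   the Stanley-Reisner ring F[K] is S/I_K. *)
Definition SR_ideal (K : scomplex m) (p : S) : Prop :=
  exists q : {set 'I_m} -> S,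
    p = \sum_(s | s \notin faces K) q s * face_monomial s.

(* dim Tor_i(S/I, F): homology in degree i of the resolution tensored with F *)
Definition Tor_dim (I : S -> Prop) (P : free_resolution I) (i : nat) : nat :=
  let d j := map_mx eval0 (res_d P j) in
  (match i with
   | 0 => res_rank P 0
   | j.+1 => \rank (kermx (d j))
   end - \rank (d i))%N.

(* The total dimension of Tor(F[K], F) is D.  The numbers [Tor_dim P i] do not
   depend on the resolution P. *)
Definition Dtilde_is (K : scomplex m) (D : nat) : Prop :=
  exists (P : free_resolution (SR_ideal K)) (N : nat),
    (forall i, (N <= i)%N -> Tor_dim P i = 0%N) /\
    (\sum_(i < N) Tor_dim P i)%N = D.

Definition weakly_taut (K : scomplex m) : Prop :=
  Dtilde_is K (taut_number K).

End Tor.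

Section Homotopy.
Local Open Scope classical_set_scope.
Variable R : realType.

Definition realization m (L : {set {set 'I_m}}) : set 'rV[R]_m :=
  [set x : 'rV[R]_m | [/\ forall i, 0 <= x 0 i, \sum_i x 0 i = 1
             & [set i | x 0 i != 0]%SET \in L]].

(* the sphere S^(n-1) in R^n; it is empty for n = 0 *)
Definition sphere n : set 'rV[R]_n := [set x : 'rV[R]_n | \sum_i x 0 i ^+ 2 = 1].

Definition homotopic (X Y : topologicalType) (A : set X) (B : set Y)
    (f g : X -> Y) : Prop :=
  exists H : R * X -> Y,
    [/\ {within `[0, 1] `*` A, continuous H},
        forall (t : R) (x : X), `[0, 1] t -> A x -> B (H (t, x)),
        forall x, A x -> H (0, x) = f x
      & forall x, A x -> H (1, x) = g x].

(* Maps between the subspaces A and B are represented by functions on the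
   ambient spaces, of which only the restrictions matter. *)
Definition homotopy_equiv (X Y : topologicalType) (A : set X) (B : set Y)
    : Prop :=
  exists (f : X -> Y) (g : Y -> X),
    [/\ {within A, continuous f} /\ (forall x, A x -> B (f x)),
        {within B, continuous g} /\ (forall y, B y -> A (g y)),
        homotopic A A (g \o f) id
      & homotopic B B (f \o g) id].

Definition htpy_point m (L : {set {set 'I_m}}) : Prop :=
  homotopy_equiv (realization L) [set (0 : R)].

(* includes S^(-1), the empty space *)
Definition htpy_sphere m (L : {set {set 'I_m}}) : Prop :=
  exists n : nat, homotopy_equiv (realization L) (@sphere n).

End Homotopy.

(* Main.v *)
(* Let sigma be a facet of minimal size d, so that the number of spheres in the
   statement is 2^(m - d), the number of sets J of vertices outside sigma.

   For each such J and each field, some K|_(J u t) with t in sigma has nonzero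
   reduced homology: otherwise one builds chains c_t of K|_(J u t) with
   d c_t = t - sum_v (+-) c_(t - v), and for t = sigma this forces a face
   properly containing sigma.  In the same way not all the K|_(J u t) are
   contractible: otherwise the identity of sigma extends to a map of a simplex
   on sigma and one vertex w of J which, after collapsing J to w, becomes a
   face-preserving map of that simplex to its boundary, contradicting Sperner's
   lemma.  In both arguments the chains, or the maps, can be prescribed on a
   face t0 of sigma with w u t0 in K.

   Hence if at most 2^(m - d) full subcomplexes are non-acyclic (or
   non-contractible), there is exactly one for each J.  As minimal non-faces
   span spheres, this leaves one minimal non-face w u T_w, with T_w in sigma,
   for each w outside sigma, and no other.  Conversely, for such a K, if U is
   the union of the minimal non-faces inside J, then K|_J is a cone when U <> J
   and a homotopy sphere of dimension |J n sigma| - 1 when U = J, and by a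
   count of Taylor symbols its total Betti number is 0, resp. 1.

   The link with Tor is Hochster's formula, read off from an explicit free
   resolution of F[K] that becomes the sum over J of the cochain complexes of
   K|_J when tensored with F. *)
Require Import Defs.
From mathcomp Require Import all_boot all_order all_algebra.
From mathcomp Require Import all_classical all_reals all_analysis.
From mathcomp Require Import zify ring lra.
From mathcomp.multinomials Require mpoly.
Import (canonicals, coercions) mpoly.

Set Implicit Arguments.
Unset Strict Implicit.
Unset Printing Implicit Defensive.

Import Order.TTheory GRing.Theory Num.Theory.
Import numFieldNormedType.Exports.
Local Open Scope set_scope.
Local Open Scope ring_scope.

(** * Barycentric subdivision and Sperner's lemma *)

(** Homotopy type and homology are never compared directly: that a contractible subcomplex is
    acyclic is not part of the argument. The two notions of non-triviality meet only in an abstract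
    predicate [N] on vertex sets, from which the sets [T w] are extracted by one counting argument;
    conditions (b) and (c) are then read off from [T], and so (b), which does not mention the field,
    yields (a). On the topological side everything rests on one fact: a face-preserving continuous
    map of a simplex into itself attains full support somewhere. Mod 2 cochains on sequences of
    points suffice for it. The same fact shows that a sphere is not contractible, without which the
    spheres could not be counted exactly. On the algebraic side no homology group is formed. The
    total Betti number of a family of faces plus twice the rank of its whole differential is the
    number of faces, so that exact sequences become inequalities between matrix ranks, parity gives
    non-vanishing, and Hochster's formula only has to be checked on totals. *)

Section Subdivision.
Variables (X : eqType) (b : seq X -> X).
Implicit Types (g h : seq X -> bool) (s t xs ys : seq X).

(* The mod 2 coboundary [g |-> \sum_i g (s without its i-th entry)], by
   recursion on [s]. *)
Fixpoint cobd g s : bool :=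
  if s is x :: s' then g s' (+) cobd (fun t => g (x :: t)) s' else false.

Lemma eq_cobd g h s :
  (forall t, subseq t s -> (exists z, perm_eq s (z :: t)) -> g t = h t) ->
  cobd g s = cobd h s.
Proof.
elim: s g h => //= x s IH g h gh; congr (_ (+) _).
  by apply: gh; [exact: subseq_cons | exists x].
apply: IH => t ts [z zt]; apply: gh; first by rewrite /= eqxx.
by exists z; rewrite -(perm_cons x) in zt; rewrite (perm_trans zt) // (perm_catCA [:: x] [:: z] t).
Qed.

Lemma cobdD g h s : cobd (fun t => g t (+) h t) s = cobd g s (+) cobd h s.
Proof. by elim: s g h => //= x s IH g h; rewrite IH addbACA. Qed.

Lemma cobd0 s : cobd (fun=> false) s = false.
Proof. by elim: s => //= x s ->. Qed.

Lemma cobd_cobd g s : cobd (cobd g) s = false.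
Proof.
elim: s g => //= x s IH g.
by rewrite (cobdD g (cobd (fun t => g (x :: t)))) addbA addbb IH.
Qed.

(* The transpose of barycentric subdivision: the subdivision of a simplex is
   the cone, with the barycentre as apex, over the subdivision of its
   boundary. *)
Fixpoint subd_rec n g xs : bool :=
  if n is n'.+1 then cobd (subd_rec n' (fun ys => g (b xs :: ys))) xs
  else g [::].

Definition subd g xs := subd_rec (size xs) g xs.

Lemma eq_subd_rec n g h xs : g =1 h -> subd_rec n g xs = subd_rec n h xs.
Proof.
elim: n g h xs => [|n IH] g h xs gh /=; first exact: gh.
by apply: eq_cobd => t _ _; apply: IH => ys; exact: gh.
Qed.

Lemma subd_recD n g h xs :
  subd_rec n (fun t => g t (+) h t) xs = subd_rec n g xs (+) subd_rec n h xs.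
Proof.
elim: n g h xs => [|n IH] g h xs //=; rewrite -cobdD.
by apply: eq_cobd => t _ _; rewrite IH.
Qed.

Lemma subd_rec0 n xs : subd_rec n (fun=> false) xs = false.
Proof.
elim: n xs => //= n IH xs; rewrite -[RHS](cobd0 xs).
by apply: eq_cobd => t _ _; exact: IH.
Qed.

Lemma size_del s t : (exists z, perm_eq s (z :: t)) -> size t = (size s).-1.
Proof. by case=> z /perm_size ->. Qed.

(** The coboundary on a cone splits into base and cone: [cobd g (b xs :: ys)] is [g ys] plus a
    coboundary in [ys]. By induction the second part turns into a double coboundary and vanishes. *)
Lemma subd_rec_cobd n g xs :
  size xs = n -> subd_rec n (cobd g) xs = cobd (subd_rec n.-1 g) xs.
Proof.
elim: n g xs => [|n IH] g xs sn /=; first by case: xs sn.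
rewrite (eq_cobd (h := fun t => subd_rec n g t (+)
  subd_rec n (cobd (fun ys => g (b xs :: ys))) t)); last first.
  by move=> t _ _; rewrite -subd_recD; exact: eq_subd_rec.
rewrite cobdD; set A := (A in _ (+) A); suff -> : A = false by rewrite addbF.
rewrite -[RHS](cobd_cobd (subd_rec n.-1 (fun ys => g (b xs :: ys))) xs).
by apply: eq_cobd => t _ /size_del; rewrite sn => /IH.
Qed.

Lemma subd_cobd g xs : subd (cobd g) xs = cobd (subd g) xs.
Proof.
rewrite /subd subd_rec_cobd //.
by apply: eq_cobd => t _ /size_del st; rewrite /subd st.
Qed.

Lemma eq_subd g h xs : g =1 h -> subd g xs = subd h xs.
Proof. exact: eq_subd_rec. Qed.

Lemma iter_subd_cobd N g xs :
  iter N subd (cobd g) xs = cobd (iter N subd g) xs.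
Proof.
elim: N g xs => //= N IH g xs; rewrite (eq_subd _ (IH g)).
by rewrite subd_cobd.
Qed.

Lemma iter_subd0 N xs : iter N subd (fun=> false) xs = false.
Proof.
elim: N xs => //= N IH xs; rewrite (eq_subd (h := fun=> false)) //.
exact: subd_rec0.
Qed.

End Subdivision.

Lemma cobd_map (X Y : eqType) (f : X -> Y) (g : seq Y -> bool) s :
  cobd (fun t => g (map f t)) s = cobd g (map f s).
Proof.
by elim: s g => //= x s IH g; rewrite (IH (fun u => g (f x :: u))).
Qed.

(* The parity step of Sperner's lemma: each side counts mod 2 the facets of the
   simplex s whose labels are exactly u. *)
Lemma cobd_perm_eq (T : eqType) (v : T) (s u : seq T) :
  uniq (v :: u) -> {subset s <= v :: u} ->
  cobd (fun t => perm_eq t u) s = perm_eq s (v :: u).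
Proof.
elim: s v u => [|x s IH] v u /= /andP[vu uu] su.
  by rewrite perm_sym; case: perm_nilP.
have sv y : y \in s -> y \in v :: u by move=> ys; apply: su; rewrite inE ys orbT.
(* If [x] is not in [u] it equals [v], and only the facet omitting this entry can carry the labels
   [u]. *)
have [xu|xu] := boolP (x \in u); last first.
  have xv : x = v.
    by have := su x (mem_head _ _); rewrite inE (negPf xu) orbF => /eqP.
  rewrite (eq_cobd (h := fun=> false)) ?cobd0 ?addbF; last first.
    move=> t _ _; apply/negbTE/negP => /perm_mem /(_ x).
    by rewrite mem_head (negPf xu).
  by rewrite xv perm_cons.
have pu := perm_to_rem xu; set u' := rem x u in pu *.
have E t : perm_eq (x :: t) u = perm_eq t u'.
  by rewrite (permPr pu) perm_cons.
have xu' : x \notin u'.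
  by have := uu; rewrite (perm_uniq pu) /= => /andP[].
have uu' : uniq u' by have := uu; rewrite (perm_uniq pu) /= => /andP[].
have vu' : v \notin u' by apply: contra vu => /mem_rem.
have xv : x != v by apply: contraNneq vu => <-.
rewrite (eq_cobd (h := fun t => perm_eq t u')); last by move=> t _ _; exact: E.
have -> : perm_eq (x :: s) (v :: u) = perm_eq s (v :: u').
  have : perm_eq (v :: u) (x :: v :: u').
    by rewrite -(perm_cons v) in pu; rewrite (perm_trans pu) // (perm_catCA [:: v] [:: x] u').
  by move=> /permPr ->; rewrite perm_cons.
have [xs|xs] := boolP (x \in s); last first.
  have -> : perm_eq s u = false.
    by apply/negbTE/negP => /perm_mem /(_ x); rewrite xu (negPf xs).
  rewrite (IH v u') /= ?vu' ?uu' // => y ys.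
  have := sv y ys; rewrite !inE (perm_mem pu) inE.
  by case: (eqVneq y x) => [yx|_ //]; move: ys; rewrite yx (negPf xs).
have -> : perm_eq s (v :: u') = false.
  apply/negbTE/negP => /perm_mem /(_ x).
  by rewrite xs inE (negPf xv) (negPf xu').
(* Here the label [x] is repeated. If [v] also occurs in [s], deleting one entry cannot remove both
   [x] and [v], which [u'] lacks. Otherwise the facets omitting one or the other copy of [x] cancel
   mod 2. *)
have [vs|vs] := boolP (v \in s).
  have -> : perm_eq s u = false.
    by apply/negbTE/negP => /perm_mem /(_ v); rewrite vs (negPf vu).
  rewrite (eq_cobd (h := fun=> false)) ?cobd0 // => t _ [z /perm_mem zt].
  apply/negbTE/negP => /perm_mem tu.
  have := zt x; have := zt v; rewrite vs xs !inE !tu (negPf vu') (negPf xu') !orbF.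
  by move=> /esym/eqP <- /esym/eqP ev; rewrite ev eqxx in xv.
rewrite (IH x) /= ?xu' //; first by rewrite (permPr pu) addbb.
move=> y ys; have := sv y ys; rewrite !inE (perm_mem pu) inE.
by case: (eqVneq y v) => [yv|_ //]; move: ys; rewrite yv (negPf vs).
Qed.

Section Mesh.
Variables (R : realType) (m : nat).
Implicit Types (xs ys : seq 'rV[R]_m) (e : R) (g h : seq 'rV[R]_m -> bool).

Definition bary xs : 'rV[R]_m := (size xs)%:R^-1 *: \sum_(x <- xs) x.

Definition close e xs :=
  forall x y, x \in xs -> y \in xs -> forall i, `|x 0 i - y 0 i| <= e.

(** Weaker than lying in the convex hull of [xs], but all that mesh estimates in the supremum norm
    require. *)
Definition in_box xs (y : 'rV[R]_m) :=
  forall i c r, (forall x, x \in xs -> `|x 0 i - c| <= r) -> `|y 0 i - c| <= r.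

Lemma baryE xs i : bary xs 0 i = (size xs)%:R^-1 * \sum_(x <- xs) x 0 i.
Proof. by rewrite /bary mxE summxE. Qed.

Lemma dist_bary xs i c : xs != [::] ->
  bary xs 0 i - c = (size xs)%:R^-1 * \sum_(x <- xs) (x 0 i - c).
Proof.
move=> xs0; rewrite baryE sumrB big_const_seq count_predT iter_addr_0.
rewrite mulrBr -[c *+ _]mulr_natl mulKf // pnatr_eq0.
by case: xs xs0.
Qed.

Lemma bary_box xs : xs != [::] -> in_box xs (bary xs).
Proof.
move=> xs0 i c r xr; have sp : 0 < (size xs)%:R :> R.
  by rewrite ltr0n; case: xs xs0 {xr}.
rewrite dist_bary // normrM ger0_norm ?invr_ge0 ?ler0n // ler_pdivrMl //.
apply: le_trans (ler_norm_sum _ _ _) _.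
apply: (@le_trans _ _ (\sum_(x <- xs) r)).
  by rewrite big_seq [leRHS]big_seq; apply: ler_sum.
by rewrite big_const_seq count_predT iter_addr_0 mulr_natl.
Qed.

Lemma sub_in_box xs ys y :
  (forall x, x \in xs -> in_box ys x) -> in_box xs y -> in_box ys y.
Proof. by move=> xy yx i c r H; apply: yx => x /xy; apply. Qed.

(** The term of [x] itself drops out of the mean, so only n of the n + 1 terms count; this is the
    contraction factor of a subdivision. *)
Lemma bary_close n e xs x i : size xs = n.+1 -> close e xs -> x \in xs ->
  `|x 0 i - bary xs 0 i| <= n%:R / n.+1%:R * e.
Proof.
move=> sn cl xxs; rewrite distrC dist_bary; last by case: xs sn {cl xxs}.
rewrite normrM ger0_norm ?invr_ge0 ?ler0n // sn ler_pdivrMl ?ltr0n //.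
have -> : n.+1%:R * (n%:R / n.+1%:R * e) = n%:R * e.
  by rewrite mulrA mulrCA divff ?mulr1 // pnatr_eq0.
rewrite (big_rem x xxs) /= subrr add0r.
apply: le_trans (ler_norm_sum _ _ _) _.
apply: (@le_trans _ _ (\sum_(y <- rem x xs) e)).
  rewrite big_seq [leRHS]big_seq; apply: ler_sum => y /mem_rem yxs.
  exact: cl.
by rewrite big_const_seq count_predT iter_addr_0 mulr_natl size_rem // sn.
Qed.

Section Agree.
Variable Q : 'rV[R]_m -> Prop.
Hypothesis Q_bary :
  forall xs, xs != [::] -> (forall x, x \in xs -> Q x) -> Q (bary xs).

(** Locality of subdivision: a cochain enters only through its values on the small simplices inside
    [xs], so it may be altered on all others. *)
Lemma subd_rec_local n e g h xs : 0 <= e -> size xs = n.+1 -> close e xs ->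
  (forall x, x \in xs -> Q x) ->
  (forall ys, size ys = n.+1 -> (forall y, y \in ys -> Q y) ->
     (forall y, y \in ys -> in_box xs y) ->
     close (n%:R / n.+1%:R * e) ys -> g ys = h ys) ->
  subd_rec bary n.+1 g xs = subd_rec bary n.+1 h xs.
Proof.
move=> e0; elim: n g h xs => [|n IH] g h xs sn cl xQ gh.
  case: xs sn cl xQ gh => [//|x [|//]] _ cl xQ gh /=; congr (_ (+) _).
  apply: gh => // [y|y|].
  - by rewrite inE => /eqP ->; exact: Q_bary.
  - by rewrite inE => /eqP ->; exact: bary_box.
  move=> y z; rewrite !inE => /eqP -> /eqP -> i.
  by rewrite subrr normr0 mul0r mul0r.
have xs0 : xs != [::] by case: xs sn {cl xQ gh}.
have S f : subd_rec bary n.+2 f xs =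
    cobd (subd_rec bary n.+1 (fun ys => f (bary xs :: ys))) xs by [].
rewrite !S; apply: eq_cobd => zs /mem_subseq zx /size_del.
rewrite sn => szs; apply: IH => // [x y xz yz i|x xz|ys sy yQ ybox ycl].
- by apply: cl; exact: zx.
- by apply: xQ; exact: zx.
have bx y : y \in bary xs :: ys -> in_box xs y.
  rewrite inE => /orP[/eqP ->|/ybox]; first exact: bary_box.
  by apply: sub_in_box => x /zx xin i c r; apply.
apply: gh => //; first by rewrite /= sy.
  by move=> y; rewrite inE => /orP[/eqP ->|/yQ //]; exact: Q_bary.
have bc y i : y \in ys -> `|y 0 i - bary xs 0 i| <= n.+1%:R / n.+2%:R * e.
  move=> /ybox H; apply: H => x /zx xin; exact: bary_close.
(* The facets of [xs] have smaller dimension and contract by a better factor. *)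
have th : n%:R / n.+1%:R * e <= n.+1%:R / n.+2%:R * e.
  apply: ler_wpM2r => //.
  rewrite ler_pdivrMr ?ltr0n // mulrAC ler_pdivlMr ?ltr0n // -!natrM ler_nat.
  by lia.
move=> y z; rewrite !inE => /orP[/eqP ->|yin] /orP[/eqP ->|zin] i.
- by rewrite subrr normr0 mulr_ge0 // divr_ge0.
- by rewrite distrC bc.
- by rewrite bc.
by apply: le_trans th; exact: ycl.
Qed.

Lemma iter_subd_local N n e g h xs : 0 <= e -> size xs = n.+1 -> close e xs ->
  (forall x, x \in xs -> Q x) ->
  (forall ys, size ys = n.+1 -> (forall y, y \in ys -> Q y) ->
     close ((n%:R / n.+1%:R) ^+ N * e) ys -> g ys = h ys) ->
  iter N (subd bary) g xs = iter N (subd bary) h xs.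
Proof.
elim: N e g h xs => [|N IH] e g h xs e0 sn cl xQ gh /=.
  by apply: gh => //; rewrite mul1r.
rewrite /subd sn; apply: (subd_rec_local e0) => // ys sy yQ _ ycl.
apply: IH ycl _ _ => //; first by rewrite mulr_ge0 // divr_ge0.
by move=> zs sz zQ; rewrite mulrA -exprSr => zcl; exact: gh.
Qed.

End Agree.
End Mesh.

(** * Sperner's lemma for labels chosen in the support *)

Section Sperner.
Variables (R : realType) (m : nat).
Implicit Types (D : {set 'I_m}) (x : 'rV[R]_m).

Definition supp x : {set 'I_m} := [set i | x 0 i != 0].

Lemma supp_bary D (xs : seq 'rV[R]_m) :
  (forall x, x \in xs -> supp x \subset D) -> supp (bary xs) \subset D.
Proof.
move=> xD; apply/fintype.subsetP => i; rewrite inE baryE; apply: contraR => iD.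
rewrite big_seq big1 ?mulr0 // => x /xD /fintype.subsetP /(_ i).
by rewrite (negPf iD) inE; case: eqP => // _ /(_ isT).
Qed.

Definition simplex D := realization (powerset D) : set 'rV[R]_m.

Definition vertex (v : 'I_m) : 'rV[R]_m := delta_mx 0 v.

Lemma supp_vertex v : supp (vertex v) = [set v]%SET.
Proof. by apply/setP => i; rewrite !inE mxE eqxx /=; case: (i == v); rewrite ?oner_eq0 ?eqxx. Qed.

Definition in_simplex x := (forall i, 0 <= x 0 i) /\ \sum_i x 0 i = 1.

Lemma in_simplex_bary (xs : seq 'rV[R]_m) :
  xs != [::] -> (forall x, x \in xs -> in_simplex x) -> in_simplex (bary xs).
Proof.
move=> xs0 H; split=> [i|].
  rewrite baryE mulr_ge0 ?invr_ge0 // big_seq sumr_ge0 // => x /H[].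
  by move=> /(_ i).
under eq_bigr do rewrite baryE.
rewrite -mulr_sumr exchange_big /= big_seq (eq_bigr (fun=> 1)) => [|x /H[] //].
rewrite -big_seq big_const_seq count_predT iter_addr_0 mulVf // pnatr_eq0.
by case: xs xs0 {H}.
Qed.

Lemma in_simplex_vertex v : in_simplex (vertex v).
Proof.
split=> [i|]; first by rewrite mxE; case: (_ && _).
rewrite (bigD1 v) //= mxE !eqxx big1 ?addr0 // => i iv.
by rewrite mxE (negPf iv) andbF.
Qed.

Lemma in_simplex_le1 x i : in_simplex x -> x 0 i <= 1.
Proof.
move=> [x0 <-]; rewrite (bigD1 i) //= lerDl sumr_ge0 // => j _.
Qed.

Definition in_face D x := in_simplex x /\ supp x \subset D.

Lemma in_face_bary D (xs : seq 'rV[R]_m) :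
  xs != [::] -> (forall x, x \in xs -> in_face D x) -> in_face D (bary xs).
Proof.
move=> xs0 H; split; last by apply: supp_bary => x /H[].
by apply: in_simplex_bary => // x /H[].
Qed.

Lemma in_face_vertex D v : v \in D -> in_face D (vertex v).
Proof.
by move=> vD; split; [exact: in_simplex_vertex | rewrite supp_vertex finset.sub1set].
Qed.

Lemma close1_in_face D (xs : seq 'rV[R]_m) :
  (forall x, x \in xs -> in_face D x) -> close 1 xs.
Proof.
move=> H x y /H[xs1 _] /H[ys1 _] i; rewrite ler_norml lerBrDr lerBlDr.
have := (xs1.1 i, ys1.1 i, in_simplex_le1 i xs1, in_simplex_le1 i ys1).
by move=> [[[? ?] ?] ?]; apply/andP; split; lra.
Qed.

Section Labelling.
Variable lab : 'rV[R]_m -> 'I_m.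
Hypothesis lab_supp : forall x, in_simplex x -> lab x \in supp x.

(** By [cobd_perm_eq] fully labelled simplices are counted through their facets, and the coboundary
    moves outside the subdivision. There only the face opposite to [v] contributes: any other face
    lacks some vertex [w] of [vs], hence also the label [w]. So the count is 1 mod 2. *)
Lemma iter_subd_label N (vs : seq 'I_m) : uniq vs ->
  iter N (subd (@bary R m)) (fun ys => perm_eq (map lab ys) vs)
    (map vertex vs).
Proof.
elim: vs => [|v vs IH] uvs.
  have -> : iter N (subd (@bary R m)) (fun ys => perm_eq (map lab ys) [::])
            [::] = perm_eq (T := 'I_m) [::] [::] by elim: N.
  by [].
pose D := [set i | i \in v :: vs].
have vQ x : x \in map vertex (v :: vs) -> in_face D x.
  by case/mapP => w wv ->; apply: in_face_vertex; rewrite finset.in_set.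
have cl := close1_in_face vQ.
rewrite (iter_subd_local (n := size vs) (@in_face_bary D) (e := 1) (h := cobd (fun ys => perm_eq (map lab ys) vs))) //.
- rewrite iter_subd_cobd /= IH; last by case/andP: uvs.
  set A := cobd _ _; suff -> : A = false by [].
  rewrite -[RHS](cobd0 (map vertex vs)); apply: eq_cobd => t _ [z zt].
  have [w wvs tw] : exists2 w, w \in vs & vertex w \notin t.
    have zin : z \in map vertex vs by rewrite (perm_mem zt) mem_head.
    case/mapP: zin => w wvs zw; exists w => //.
    have : uniq (z :: t).
      rewrite -(perm_uniq zt) map_inj_uniq; first by case/andP: uvs.
      by move=> a c /(congr1 supp); rewrite !supp_vertex => /set1_inj.
    by rewrite -zw => /andP[].
  pose E := D :\ w.
  have tE x : x \in vertex v :: t -> in_face E x.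
    move=> xt.
    have : x \in map vertex (v :: vs).
      by move: xt; rewrite /= !inE => /orP[->//|xt]; rewrite (perm_mem zt) inE xt !orbT.
    case/mapP=> u uvs' xu; rewrite xu; apply: in_face_vertex.
    rewrite finset.in_setD1 finset.in_set uvs' andbT.
    apply/eqP => uw; move: xt; rewrite xu uw inE (negPf tw) orbF => /eqP.
    move=> /(congr1 supp); rewrite !supp_vertex => /set1_inj wv.
    by move: uvs; rewrite /= -wv wvs.
  have clt := close1_in_face tE.
  rewrite (iter_subd_local (n := size t) (@in_face_bary E) (e := 1) (h := fun=> false)) //.
    exact: iter_subd0.
  move=> ys _ yE _; apply/negbTE/negP => /perm_mem /(_ w).
  rewrite wvs => /mapP[y /yE[ysim /fintype.subsetP yE'] wy].
  by have := yE' _ (lab_supp ysim); rewrite -wy !inE eqxx.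
- by rewrite /= size_map.
move=> ys _ yQ _; rewrite -(cobd_perm_eq uvs).
  by rewrite (cobd_map lab (perm_eq^~ vs)).
move=> i /mapP[y /yQ[ysim /fintype.subsetP yD] ->].
by have := yD _ (lab_supp ysim); rewrite [_ \in D]finset.in_set.
Qed.

Lemma sperner D e : 0 < e -> D != finset.set0 ->
  exists ys : seq 'rV[R]_m,
    [/\ forall y, y \in ys -> in_face D y, close e ys
      & forall v, v \in D -> exists2 y, y \in ys & lab y = v].
Proof.
move=> e0 D0; pose n := #|D|.-1.
have nD : n.+1 = #|D| by rewrite prednK // card_gt0.
(* The mesh is at most 1 at the start and each subdivision multiplies it by a factor below 1. *)
have [N Ne] : exists N, (n%:R / n.+1%:R) ^+ N <= e :> R.
  have : ((fun N => (n%:R / n.+1%:R) ^+ N : R) @ \oo --> (0 : R))%classic.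
    apply: cvg_expr; rewrite ger0_norm ?divr_ge0 // ltr_pdivrMr ?ltr0n //.
    by rewrite mul1r ltr_nat.
  move=> /cvgrPdist_le /(_ e e0) [N _ /(_ N (leqnn N))]; rewrite /= sub0r normrN => H.
  by exists N; apply: le_trans H; exact: ler_norm.
have vQ x : x \in map vertex (enum D) -> in_face D x.
  by case/mapP => w wv ->; apply: in_face_vertex; rewrite -mem_enum.
have cl := close1_in_face vQ.
apply: contrapT => no; have := iter_subd_label N (enum_uniq D).
rewrite (iter_subd_local (n := n) (@in_face_bary D) (e := 1) (h := fun=> false)) ?iter_subd0 //.
  by rewrite size_map -cardE nD.
move=> ys _ yQ; rewrite mulr1 => ycl; apply/negbTE/negP => pe; apply: no.
exists ys; split=> // [x y xy yy i|v vD]; first exact: le_trans (ycl _ _ _ _ _) Ne.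
have : v \in map lab ys by rewrite (perm_mem pe) mem_enum.
by case/mapP => y yy ->; exists y.
Qed.

End Labelling.
End Sperner.

(** * Maps of simplices and contractible subspaces *)

Section ContinuityOnSubsets.
Local Open Scope classical_set_scope.
Variable R : realType.

(** Pointwise form of continuity on a subspace, to which the algebra of limits applies directly. *)
Definition cont_in (X Y : topologicalType) (A : set X) (f : X -> Y) :=
  forall x, A x -> f z @[z --> within A (nbhs x)] --> f x.

Lemma cont_inP (X Y : topologicalType) (A : set X) (f : X -> Y) :
  {within A, continuous f} <-> cont_in A f.
Proof. exact: subspace_continuousP. Qed.

Lemma cont_in_id (X : topologicalType) (A : set X) : cont_in A (@id X).
Proof. by move=> x _; apply: cvg_within_filter. Qed.

Lemma cont_in_cst (X Y : topologicalType) (A : set X) (y : Y) :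
  cont_in A (fun=> y).
Proof. by move=> x _; exact: cvg_cst. Qed.

Lemma cont_in_comp (X Y Z : topologicalType) (A : set X) (B : set Y)
    (f : X -> Y) (g : Y -> Z) :
  cont_in A f -> (forall x, A x -> B (f x)) -> cont_in B g ->
  cont_in A (fun x => g (f x)).
Proof.
move=> cf fAB cg x Ax P /= Pg.
have := cg _ (fAB x Ax) P Pg; rewrite /within /= /nbhs /= => PB.
have := cf x Ax _ PB; rewrite /nbhs /= /within /= /nbhs /=.
by apply: filterS => z H Az; apply: H => //; exact: fAB.
Qed.

Lemma cont_in_sub (X Y : topologicalType) (A B : set X) (f : X -> Y) :
  A `<=` B -> cont_in B f -> cont_in A f.
Proof.
by move=> AB cf; apply: (cont_in_comp (@cont_in_id X A) AB cf).
Qed.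

Lemma eq_cont_in (X Y : topologicalType) (A : set X) (f g : X -> Y) :
  (forall x, A x -> f x = g x) -> cont_in A f -> cont_in A g.
Proof.
move=> fg /cont_inP cf; apply/cont_inP; apply: subspace_eq_continuous cf.
by move=> x /set_mem /fg.
Qed.

Lemma cont_in_setU (X Y : topologicalType) (A B : set X) (f : X -> Y) :
  closed A -> closed B -> cont_in A f -> cont_in B f -> cont_in (A `|` B) f.
Proof.
move=> cA cB /cont_inP fA /cont_inP fB; apply/cont_inP.
exact: withinU_continuous.
Qed.

Lemma cont_in_pair (X Y Z : topologicalType) (A : set X)
    (f : X -> Y) (g : X -> Z) :
  cont_in A f -> cont_in A g -> cont_in A (fun x => (f x, g x)).
Proof. by move=> cf cg x Ax; apply: cvg_pair; [exact: cf | exact: cg]. Qed.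

Lemma continuous_cont_in (X Y : topologicalType) (A : set X) (f : X -> Y) :
  continuous f -> cont_in A f.
Proof. by move=> cf; apply/cont_inP; exact: continuous_subspaceT. Qed.

Section Real.
Variables (X : topologicalType) (A : set X).
Implicit Types f g : X -> R.

Lemma cont_inD f g : cont_in A f -> cont_in A g -> cont_in A (fun x => f x + g x).
Proof. by move=> cf cg x Ax; apply: cvgD; [exact: cf | exact: cg]. Qed.

Lemma cont_inN f : cont_in A f -> cont_in A (fun x => - f x).
Proof. by move=> cf x Ax; apply: cvgN; exact: cf. Qed.

Lemma cont_inB f g : cont_in A f -> cont_in A g -> cont_in A (fun x => f x - g x).
Proof. by move=> cf cg; apply: cont_inD => //; exact: cont_inN. Qed.

Lemma cont_inM f g : cont_in A f -> cont_in A g -> cont_in A (fun x => f x * g x).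
Proof. by move=> cf cg x Ax; apply: cvgM; [exact: cf | exact: cg]. Qed.

Lemma cont_inV f : (forall x, A x -> f x != 0) -> cont_in A f ->
  cont_in A (fun x => (f x)^-1).
Proof. by move=> f0 cf x Ax; apply: cvgV; [exact: f0 | exact: cf]. Qed.

Lemma cont_in_max f g : cont_in A f -> cont_in A g ->
  cont_in A (fun x => Num.max (f x) (g x)).
Proof.
move=> cf cg; apply: (@eq_cont_in _ _ _ (fun x => (f x + g x + `|f x - g x|) * 2^-1)).
  by move=> x _; rewrite maxr_absE.
apply: cont_inM; last exact: cont_in_cst.
apply: cont_inD; first exact: cont_inD.
by move=> x Ax; apply: cvg_norm; apply: cont_inB.
Qed.

Lemma cont_in_min f g : cont_in A f -> cont_in A g ->
  cont_in A (fun x => Num.min (f x) (g x)).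
Proof.
move=> cf cg; apply: (@eq_cont_in _ _ _ (fun x => - Num.max (- f x) (- g x))).
  by move=> x _; rewrite oppr_max !opprK.
by apply/cont_inN/cont_in_max; exact: cont_inN.
Qed.

Lemma cont_in_sqrt f : cont_in A f -> cont_in A (fun x => Num.sqrt (f x)).
Proof. by move=> cf x Ax; exact: (continuous_cvg _ (@sqrt_continuous _ _) (cf x Ax)). Qed.

Lemma cont_in_big (op : R -> R -> R) (idx : R) I (r : seq I) (P : pred I)
    (F : I -> X -> R) :
  (forall f g, cont_in A f -> cont_in A g -> cont_in A (fun x => op (f x) (g x))) ->
  (forall i, P i -> cont_in A (F i)) ->
  cont_in A (fun x => \big[op/idx]_(i <- r | P i) F i x).
Proof.
move=> cop cF; elim: r => [|i r IH].
  by apply: (eq_cont_in _ (@cont_in_cst _ _ A idx)) => x _; rewrite big_nil.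
case Pi: (P i).
  apply: (eq_cont_in _ (cop _ _ (cF i Pi) IH)) => x _.
  by rewrite big_cons Pi.
by apply: (eq_cont_in _ IH) => x _; rewrite big_cons Pi.
Qed.

Lemma cont_in_coord m (f : X -> 'rV[R]_m) i :
  cont_in A f -> cont_in A (fun x => f x 0 i).
Proof.
by move=> cf x Ax; exact: (continuous_cvg _ (@coord_continuous _ _ _ _ _ _) (cf x Ax)).
Qed.

Lemma cont_in_rV m (f : X -> 'rV[R]_m) :
  (forall i, cont_in A (fun x => f x 0 i)) -> cont_in A f.
Proof.
move=> cf x Ax; apply/cvg_ballP => e e0.
have : \forall z \near within A (nbhs x), forall i, ball (f x 0 i) e (f z 0 i).
  apply: filter_forall => i.
  by have /cvg_ballP := cf i x Ax; apply.
by apply: filterS => z H; split=> // i j; rewrite ord1.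
Qed.

End Real.
End ContinuityOnSubsets.

(** * Closed and compact realizations; face-preserving maps of a simplex *)

Section Realization.
Variables (R : realType) (m : nat).
Implicit Types (D s t : {set 'I_m}) (L : {set {set 'I_m}}) (x y : 'rV[R]_m).

Definition down_closed L := forall s t, s \in L -> t \subset s -> t \in L.

Lemma realizationE L x : realization L x <-> in_simplex x /\ supp x \in L.
Proof. by split=> [[]|[[]]]. Qed.

Lemma simplexE D x : simplex D x <-> in_simplex x /\ supp x \subset D.
Proof. by rewrite /simplex realizationE powersetE. Qed.

Lemma realizationS L1 L2 : L1 \subset L2 ->
  (realization L1 `<=` (realization L2 : set 'rV[R]_m))%classic.
Proof. by move=> /fintype.subsetP H x /realizationE[? /H ?]; apply/realizationE. Qed.

Lemma in_supp x i : (i \in supp x) = (x 0 i != 0).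
Proof. by rewrite inE. Qed.

Lemma supp_gt0 x i : in_simplex x -> (i \in supp x) = (0 < x 0 i).
Proof. by move=> [x0 _]; rewrite in_supp lt0r x0 andbT. Qed.

Lemma in_simplex_large x : in_simplex x -> exists i, m%:R^-1 <= x 0 i.
Proof.
move=> [x0 x1]; apply: contrapT => no.
have : \sum_i x 0 i < \sum_(i < m) m%:R^-1.
  have [i0] : exists i0 : 'I_m, true.
    apply: contrapT => em; move: x1; rewrite big1 => [/esym/eqP|i].
      by rewrite oner_eq0.
    by exfalso; apply: em; exists i.
  move=> _; rewrite (bigD1 i0) // [ltRHS](bigD1 i0) //=; apply: ltr_leD.
    by rewrite ltNge; apply/negP => H; apply: no; exists i0.
  apply: ler_sum => i _; rewrite leNgt; apply/negP => H; apply: no; exists i.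
  exact: ltW.
rewrite x1 sumr_const card_ord -[_ *+ _]mulr_natl.
have [->|m0] := eqVneq m 0%N; first by rewrite mul0r ltr10.
by rewrite divff ?pnatr_eq0 // ltxx.
Qed.

Lemma supp_neq0 x : in_simplex x -> supp x != finset.set0.
Proof.
move=> xs; apply/finset.set0Pn; have [i xi] := in_simplex_large xs; exists i.
rewrite supp_gt0 //; apply: lt_le_trans xi; rewrite invr_gt0 ltr0n.
exact: leq_ltn_trans (leq0n i) (ltn_ord i).
Qed.

Lemma closed_le_fun (X : topologicalType) (f : X -> R) c :
  cont_in setT f -> closed [set z | f z <= c]%classic.
Proof.
move=> cf; apply: (@preimage_closed _ _ f [set r | r <= c]%classic).
  by move=> z _; have := cf z I; rewrite withinET; apply.
exact: closed_le.
Qed.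

Lemma closed_eq_fun (X : topologicalType) (f : X -> R) c :
  cont_in setT f -> closed [set z | f z = c]%classic.
Proof.
move=> cf; apply: (@preimage_closed _ _ f [set r | r = c]%classic).
  by move=> z _; have := cf z I; rewrite withinET; apply.
exact: closed_eq.
Qed.

Lemma cont_coord (A : set 'rV[R]_m) i : cont_in A (fun x : 'rV[R]_m => x 0 i).
Proof. by apply: cont_in_coord; exact: cont_in_id. Qed.

Lemma closed_realization L :
  down_closed L -> closed (realization L : set 'rV[R]_m).
Proof.
move=> dL.
(* As [L] is down-closed, the support lies in [L] exactly when, for every [s] outside [L], the
   product of the coordinates in [s] vanishes. All conditions become closed ones. *)
have -> : realization L =
    (\bigcap_(i in setT) [set x : 'rV[R]_m | - x 0 i <= 0] `&`
     ([set x : 'rV[R]_m | \sum_i x 0 i = 1] `&`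
     \bigcap_(s in [set s | s \notin L])
       [set x : 'rV[R]_m | \prod_(i in s) x 0 i = 0]))%classic.
  apply/seteqP; split=> x.
    move=> [x0 x1 xL]; split; [|split] => //=.
      by move=> i _ /=; rewrite oppr_le0.
    move=> s /= sL; apply/eqP/prodf_eq0; apply: contrapT => no.
    move/negP: sL; apply; apply: dL xL _; apply/fintype.subsetP => i si.
    by rewrite inE; apply/eqP => xi; apply: no; exists i => //; apply/eqP.
  move=> [x0 [x1 xL]]; split=> // [i|].
    by have := x0 i I; rewrite /= oppr_le0.
  apply: contrapT => /negP sL; have /eqP/prodf_eq0[i] := xL _ sL.
  by rewrite inE => /negPf ->.
apply: closedI; last apply: closedI.
- apply: closed_bigI => i _; apply: closed_le_fun; apply: cont_inN.
  exact: cont_coord.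
- apply: closed_eq_fun; apply: cont_in_big => [f g cf cg|i _].
    exact: cont_inD.
  exact: cont_coord.
apply: closed_bigI => s _; apply: closed_eq_fun.
apply: cont_in_big => [f g cf cg|i _]; first exact: cont_inM.
exact: cont_coord.
Qed.

Lemma down_closed_powerset D : down_closed (powerset D).
Proof. by move=> s t; rewrite !powersetE => sD ts; exact: fintype.subset_trans ts sD. Qed.

Lemma compact_simplex D : compact (simplex D : set 'rV[R]_m).
Proof.
apply: bounded_closed_compact; last first.
  by apply: closed_realization; exact: down_closed_powerset.
exists 1; split=> // M M1 x /simplexE[xs _].
rewrite /Num.norm /= mx_normrE; apply: bigmax_le => [|[i j] _ /=].
  by apply/ltW; apply: lt_trans M1.
rewrite ord1 ger0_norm ?xs.1 //.
by apply: le_trans (in_simplex_le1 j xs) (ltW M1).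
Qed.

Lemma unif_cont_simplex D n (f : 'rV[R]_m -> 'rV[R]_n) (e : R) :
  0 < e ->
  cont_in (simplex D) f ->
  exists2 d, 0 < d & forall x y, simplex D x -> simplex D y ->
    (forall i, `|x 0 i - y 0 i| <= d) -> forall j, `|f x 0 j - f y 0 j| < e.
Proof.
move=> e0 cf; have e20 : 0 < e / 2 by rewrite divr_gt0.
pose P (d : R) x := simplex D x -> forall y, simplex D y ->
  (forall i, `|x 0 i - y 0 i| <= d) -> forall j, `|f x 0 j - f y 0 j| < e.
have /compact_near_coveringP/(_ R (0^'+)%classic P _) := @compact_simplex D.
case=> [x xD|d /= d0 H].
  have /cvg_ballP/(_ _ e20) nb := cf x xD.
  have /nbhs_ballP[r /= r0 rH] :
    nbhs x (fun z => simplex D z -> ball (f x) (e / 2) (f z)) by exact: nb.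
  have r20 : 0 < r / 2 by rewrite divr_gt0.
  exists (ball x (r / 2), [set d | d < r / 2]%classic) => /=.
    split; first exact: nbhsx_ballx.
    by exists (r / 2) => //= d; rewrite /= sub0r normrN => H d0; apply: le_lt_trans H; exact: ler_norm.
  move=> [x' d] /= [xx' dr] x'D y yD yd j.
  have fx' : ball (f x) (e / 2) (f x').
    by apply: rH => //; apply: le_ball xx'; rewrite ler_pdivrMr //; nra.
  have fy : ball (f x) (e / 2) (f y).
    apply: rH => //; rewrite (splitr r); apply: ball_triangle xx' _.
    split=> // i k; rewrite ord1 /ball /=.
    exact: le_lt_trans (yd k) dr.
  have := (fx'.2 0 j, fy.2 0 j); rewrite /ball /= => -[h1 h2].
  have -> : f x' 0 j - f y 0 j = (f x 0 j - f y 0 j) - (f x 0 j - f x' 0 j).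
    by ring.
  apply: le_lt_trans (ler_normB _ _) _; rewrite [e]splitr.
  exact: ltrD.
exists (d / 2); first by rewrite divr_gt0.
move=> x y xD yD xy; apply: (H (d / 2) _ _ x) => //=.
- by rewrite sub0r normrN ger0_norm ?divr_ge0 ?(ltW d0) // ltr_pdivrMr //; nra.
- by rewrite divr_gt0.
Qed.

(* Otherwise label x by the largest coordinate of f x: nearby points with all
   labels would give a point f y of full support. *)
Lemma no_simplex_retraction D (f : 'rV[R]_m -> 'rV[R]_m) :
  D != finset.set0 -> cont_in (simplex D) f ->
  (forall x, simplex D x -> [/\ in_simplex (f x), supp (f x) \subset supp x
                              & supp (f x) != D]) -> False.
Proof.
move=> D0 cf fD; have [i0 iD] := finset.set0Pn _ D0.
have m0 : 0 < m%:R^-1 :> R.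
  by rewrite invr_gt0 ltr0n; exact: leq_ltn_trans (leq0n i0) (ltn_ord i0).
(* [sperner] asks for labels in the support on the whole standard simplex, hence the extension by
   the identity; continuity is used on [D] only. *)
pose F x := if `[< simplex D x >] then f x else x.
have Fs x : in_simplex x -> in_simplex (F x) /\ supp (F x) \subset supp x.
  by rewrite /F; case: asboolP => [/fD[]|].
(* Any coordinate of at least 1/m serves as label. The same 1/m is the tolerance in the uniform
   continuity, so a label of a nearby point stays in the support of [f y]. *)
pose lab x := xget i0 [set i | m%:R^-1 <= F x 0 i]%classic.
have labE x : in_simplex x -> m%:R^-1 <= F x 0 (lab x).
  move=> /Fs[Fx _]; rewrite /lab; case: xgetP => // no.
  by have [i Hi] := in_simplex_large Fx; case: (no i).
have lab_supp x : in_simplex x -> lab x \in supp x.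
  move=> xs; have [Fx /fintype.subsetP] := Fs _ xs; apply.
  by rewrite supp_gt0 //; exact: lt_le_trans (labE x xs).
have [d d0 fd] := unif_cont_simplex m0 cf.
have [ys [ysD ycl yv]] := sperner lab_supp d0 D0.
have [y yys _] := yv _ iD.
have yD : simplex D y by apply/simplexE; exact: ysD.
have [fys fyy] := fD y yD; case/negP.
rewrite finset.eqEsubset; apply/andP; split.
  by apply: fintype.subset_trans fyy _; have [_] := ysD y yys.
apply/fintype.subsetP => v /yv[z zys zv]; rewrite supp_gt0 //.
have zD : simplex D z by apply/simplexE; exact: ysD.
have := fd z y zD yD (ycl _ _ zys yys) v.
have [zs _] := ysD z zys; have := labE z zs.
rewrite zv /F; case: asboolP => // _ h /ltr_normlP[_ h2]; lra.
Qed.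

End Realization.

(** * Extension of maps over a simplex with values in a contractible set *)

Section Extension.
Variables (R : realType).

(** The witness [p] excludes the empty set. The homotopy runs from the constant map to the identity
    and need not keep [p] fixed. *)
Definition contractible (Y : topologicalType) (B : set Y) :=
  exists (p : Y) (H : R * Y -> Y),
    [/\ cont_in (X := (R * Y)%type) (`[0, 1] `*` B)%classic H,
        forall (t : R) y, `[0, 1]%classic t -> B y -> B (H (t, y)),
        B p, forall y, B y -> H (0, y) = p & forall y, B y -> H (1, y) = y].

Lemma htpy_point_contractible m (L : {set {set 'I_m}}) :
  htpy_point R L -> contractible (realization L : set 'rV[R]_m).
Proof.
move=> [f [g [[_ f0] [_ gL] [H [/cont_inP cH HL H0 H1]] _]]].
exists (g 0), H; split=> //; first exact: gL.
by move=> y yL; rewrite H0 //= (f0 y yL).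
Qed.

Variable m : nat.
Implicit Types (D s t : {set 'I_m}) (L : {set {set 'I_m}}) (x y : 'rV[R]_m).

Section Push.
Variable s : {set 'I_m}.
Hypothesis s0 : s != finset.set0.

(** The default 1 is harmless, as no coordinate exceeds it. On the simplex, [c] below is 0 on the
    boundary and 1 at the barycentre. *)
Let mn x := \big[Num.min/1]_(i in s) x 0 i.
Let c x := #|s|%:R * mn x.
(* central projection of the simplex on s, minus its barycentre, onto its
   boundary *)
Let push x : 'rV[R]_m := \row_i ((x 0 i - (i \in s)%:R * mn x) / (1 - c x)).

Let mn_le x i : i \in s -> mn x <= x 0 i.
Proof. by move=> si; apply: bigmin_le_cond. Qed.

Let mn_ge0 x : in_simplex x -> 0 <= mn x.
Proof. by move=> [x0 _]; apply/bigmin_geP; split. Qed.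

Let mn_arg x : in_simplex x -> exists2 i, i \in s & x 0 i = mn x.
Proof.
move=> xs; have [i si] := finset.set0Pn _ s0.
have [ge1|lt1] := leP 1 (mn x).
  exists i => //; apply/eqP; rewrite eq_le mn_le // andbT.
  exact: le_trans (in_simplex_le1 i xs) ge1.
apply: contrapT => no; have : mn x < mn x.
  apply/bigmin_gtP; split=> // j sj; rewrite lt_neqAle mn_le // andbT.
  by apply/eqP => e; apply: no; exists j.
by rewrite ltxx.
Qed.

Let sum_s x : simplex s x -> \sum_(i in s) x 0 i = 1.
Proof.
move=> /simplexE[[x0 <-] /fintype.subsetP xs]; rewrite big_mkcond.
apply: eq_bigr => i _; case: ifP => // /negbT si; apply/esym/eqP.
by move: si; apply: contraR => xi; apply: xs; rewrite in_supp.
Qed.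

Let c_sum x : c x = \sum_(i in s) mn x.
Proof. by rewrite sumr_const /c mulr_natl. Qed.

Let push_simplex x : simplex s x -> c x <= 2^-1 ->
  in_simplex (push x) /\ supp (push x) \proper s.
Proof.
move=> xs c2; have c1 : 0 < 1 - c x by lra.
have /simplexE[xi /fintype.subsetP xsupp] := xs.
have out i : i \notin s -> x 0 i = 0.
  by move=> si; apply/eqP; apply: contraR si => xi0; apply: xsupp; rewrite in_supp.
split; first split=> [i|].
- rewrite mxE divr_ge0 // ?(ltW c1) // subr_ge0.
  by case si: (i \in s); rewrite ?mul1r ?mn_le // mul0r xi.1.
- under eq_bigr do rewrite mxE.
  rewrite -mulr_suml sumrB xi.2 (_ : \sum_i _ = c x) ?divff ?gt_eqF //.
  by rewrite c_sum [RHS]big_mkcond; apply: eq_bigr => i _; case: ifP; rewrite ?mul1r ?mul0r.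
rewrite fintype.properE; apply/andP; split.
  apply/fintype.subsetP => i; rewrite in_supp mxE; apply: contraR => si.
  by rewrite (negPf si) mul0r subr0 out // mul0r.
have [i si xi0] := mn_arg xi.
apply/fintype.subsetPn; exists i => //.
by rewrite in_supp mxE si mul1r xi0 subrr mul0r eqxx.
Qed.

Let c_face x : in_simplex x -> supp x \proper s -> c x = 0.
Proof.
move=> xi; rewrite fintype.properE => /andP[_ /fintype.subsetPn[i si]].
rewrite in_supp negbK => /eqP x0; rewrite /c (_ : mn x = 0) ?mulr0 //.
by apply/eqP; rewrite eq_le mn_ge0 // andbT -x0 mn_le.
Qed.

Let push_face x : in_simplex x -> supp x \proper s -> push x = x.
Proof.
move=> xi xs; have c0 := c_face xi xs; apply/rowP => i; rewrite mxE c0.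
have : mn x = 0.
  apply/eqP; move/eqP: c0; rewrite mulf_eq0 pnatr_eq0 cards_eq0.
  by rewrite (negPf s0).
by move=> ->; rewrite mulr0 !subr0 divr1.
Qed.

Let cont_mn A : cont_in A mn.
Proof.
apply: cont_in_big => [f g|i _]; [exact: cont_in_min | exact: cont_coord].
Qed.

Let cont_c A : cont_in A c.
Proof. by apply: cont_inM; [exact: cont_in_cst | exact: cont_mn]. Qed.

Lemma extend_simplex L (Y : topologicalType) (B : set Y) (f : 'rV[R]_m -> Y) :
  down_closed L -> s \notin L -> (forall t, t \proper s -> t \in L) ->
  contractible B -> cont_in (realization L) f ->
  (forall x, realization L x -> supp x \subset s -> B (f x)) ->
  exists g : 'rV[R]_m -> Y,
    [/\ cont_in (realization (s |: L)) g,
        forall x, realization L x -> g x = f x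
      & forall x, simplex s x -> B (g x)].
Proof.
move=> dL sL ts [p [H [cH HB Bp H0 H1]]] cf fB.
(* A collar: as [c] grows to 1/2 the value at the projected point is contracted to [p], and the rest
   of the simplex goes to [p]. Stopping at 1/2 keeps the denominator of [push] away from 0. *)
pose g x := if `[< realization L x >] then f x else
  if c x <= 2^-1 then H (1 - 2 * c x, f (push x)) else p.
pose A1 := (simplex s `&` [set x | c x <= 2^-1])%classic.
pose A2 := (simplex s `&` [set x | - c x <= - 2^-1])%classic.
have face x : realization L x -> simplex s x -> supp x \proper s.
  move=> /realizationE[xi xL] /simplexE[_ xs]; rewrite finset.properEneq xs andbT.
  by apply: contraNneq sL => <-.
have pushL x : A1 x -> realization L (push x).
  move=> [xs c2]; have [pi pp] := push_simplex xs c2.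
  by apply/realizationE; split=> //; exact: ts.
have pushB x : A1 x -> B (f (push x)).
  move=> A1x; apply: fB; first exact: pushL.
  have [xs c2] := A1x; have [_] := push_simplex xs c2.
  exact: fintype.proper_sub.
have I01 x : A1 x -> `[0, 1]%classic (1 - 2 * c x).
  move=> [/simplexE[xi _] /= c2]; rewrite /= in_itv /=.
  have : 0 <= c x by rewrite mulr_ge0 // mn_ge0.
  by move=> c0; apply/andP; split; lra.
have gA1 x : A1 x -> g x = H (1 - 2 * c x, f (push x)).
  move=> A1x; rewrite /g; case: asboolP => [xL|_]; last by case: A1x => _ /= ->.
  have [xs _] := A1x; have pr := face x xL xs; have /simplexE[xi xss] := xs.
  by rewrite push_face // c_face // mulr0 subr0 H1 //; exact: fB.
have gA2 x : A2 x -> g x = p.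
  move=> [xs /= c2]; have /simplexE[xi xss] := xs.
  rewrite /g; case: asboolP => [xL|_].
    by have := c_face xi (face x xL xs); move=> c0; exfalso; lra.
  case: ifP => // c2'; have c2E : c x = 2^-1 by lra.
  by rewrite c2E divff ?pnatr_eq0 // subrr H0 //; apply: pushB.
have cont_push : cont_in A1 push.
  apply: cont_in_rV => i.
  apply: (@eq_cont_in _ _ _ (fun x : 'rV[R]_m => (x 0 i - (i \in s)%:R * mn x) / (1 - c x))).
    by move=> x _; rewrite mxE.
  apply: cont_inM.
    apply: cont_inB; first exact: cont_coord.
    by apply: cont_inM; [exact: cont_in_cst | exact: cont_mn].
  apply: cont_inV.
    by move=> x [_ /= c2]; rewrite gt_eqF //; lra.
  by apply: cont_inB; [exact: cont_in_cst | exact: cont_c].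
exists g; split=> [|x xL|x xs].
- apply: (@cont_in_sub _ _ _ (realization L `|` (A1 `|` A2))%classic).
    move=> x /realizationE[xi]; rewrite !inE => /orP[/eqP xs|xL]; last first.
      by left; apply/realizationE.
    right; have xss : simplex s x by apply/simplexE; rewrite xs.
    by have [c2|c2] := leP (c x) 2^-1; [left|right]; split=> //=; lra.
  have csx : closed (simplex s : set 'rV[R]_m).
    by apply: closed_realization; exact: down_closed_powerset.
  have cA1 : closed A1.
    by apply: closedI csx _; apply: closed_le_fun; exact: cont_c.
  have cA2 : closed A2.
    by apply: closedI csx _; apply: closed_le_fun; apply: cont_inN; exact: cont_c.
  apply: cont_in_setU; [exact: closed_realization|exact: closedU| |].
    by apply: eq_cont_in cf => x xL; rewrite /g; case: asboolP.
  apply: cont_in_setU => //; last first.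
    by apply: (eq_cont_in _ (@cont_in_cst _ _ _ p)) => x /gA2 ->.
  apply: (eq_cont_in (f := fun x => H (1 - 2 * c x, f (push x)))).
    by move=> x /gA1 ->.
  apply: (cont_in_comp (Y := (R * Y)%type) (B := (`[0, 1] `*` B)%classic) (f := fun x => (1 - 2 * c x, f (push x)))) => //.
    apply: cont_in_pair.
      apply: cont_inB; first exact: cont_in_cst.
      by apply: cont_inM; [exact: cont_in_cst | exact: cont_c].
    exact: (cont_in_comp (B := realization L) cont_push pushL).
  by move=> x A1x; split; [exact: I01 | exact: pushB].
- by rewrite /g; case: asboolP.
have [c2|c2] := leP (c x) 2^-1.
  by rewrite gA1 //; apply: HB; [exact: I01 | exact: pushB].
by rewrite gA2 //; split=> //=; lra.
Qed.

End Push.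

(** With a contraction the identity of the boundary would extend over the simplex, against
    [no_simplex_retraction]. *)
Lemma proper_family_not_contractible D : D != finset.set0 ->
  ~ contractible (realization [set s : {set 'I_m} | s \proper D]%SET : set 'rV[R]_m).
Proof.
set L := [set s | _]%SET => D0 cL.
have dL : down_closed L.
  by move=> s t; rewrite !finset.in_set => sD ts; exact: fintype.sub_proper_trans ts sD.
have DL : D \notin L by rewrite finset.in_set fintype.properxx.
have tL t : t \proper D -> t \in L by rewrite finset.in_set.
have [//|g [cg gid gB]] := extend_simplex D0 dL DL tL cL (@cont_in_id _ _).
apply: (no_simplex_retraction (f := g) D0).
  apply: cont_in_sub cg => x /simplexE[xi xD]; apply/realizationE; split=> //.
  rewrite finset.in_setU1 finset.in_set finset.properEneq xD andbT.
  exact: orbN.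
move=> x xD; have /realizationE[gi] := gB x xD; rewrite finset.in_set => gp.
have /simplexE[xi xDs] := xD; split=> //; last by rewrite finset.proper_neq.
have [xE|xN] := eqVneq (supp x) D; first by rewrite xE fintype.proper_sub.
rewrite gid //; apply/realizationE; split=> //.
by rewrite finset.in_set finset.properEneq xN.
Qed.

End Extension.

(** * Non-contractible full subcomplexes over a facet *)

Section TopologicalObstruction.
Variables (R : realType) (m : nat) (K : scomplex m).
Implicit Types (J s t : {set 'I_m}).

Lemma in_full_sub J s : (s \in full_sub K J) = (s \in faces K) && (s \subset J).
Proof. by rewrite finset.in_set. Qed.

Lemma full_subS J1 J2 : J1 \subset J2 -> full_sub K J1 \subset full_sub K J2.
Proof.
move=> J12; apply/fintype.subsetP => s; rewrite !in_full_sub => /andP[-> /=].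
by move=> sJ; exact: fintype.subset_trans sJ J12.
Qed.

Variables (sg J t0 : {set 'I_m}) (w0 : 'I_m).
Hypothesis sgK : sg \in faces K.
Hypothesis sg_facet : forall t, t \in faces K -> sg \subset t -> t = sg.
Hypothesis Jsg : [disjoint J & sg].
Hypothesis w0J : w0 \in J.
Hypothesis t0sg : t0 \subset sg.
Hypothesis w0t0 : w0 |: t0 \in faces K.

Let B s : set 'rV[R]_m := realization (full_sub K (J :|: (s :&: sg))).
Let D := w0 |: sg.
Let L0 := powerset sg :|: powerset (w0 |: t0).

(** A simplex [s] within [D] and outside [L0] has a trace on [sg] not contained in [t0], so [B s] is
    contractible and [extend_simplex] applies. The start is the identity on [L0], whose members are
    faces of [K]. *)
Let extension (L : {set {set 'I_m}}) :
  (forall t, t \subset sg -> ~~ (t \subset t0) ->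
     contractible R (realization (full_sub K (J :|: t)) : set 'rV[R]_m)) ->
  L0 \subset L -> L \subset powerset D -> down_closed L ->
  exists f : 'rV[R]_m -> 'rV[R]_m,
    [/\ cont_in (realization L) f,
        forall x, realization L x -> B (supp x) (f x)
      & forall x, simplex sg x -> f x = x].
Proof.
move=> H; have [n] := ubnP #|L :\: L0|; elim: n L => // n IH L nL L0L LD dL.
have BS s t : s \subset t -> (B s `<=` B t)%classic.
  by move=> st; apply/realizationS/full_subS/finset.setUS/finset.setSI.
have dL0 : down_closed L0.
  move=> s t; rewrite !finset.in_setU !powersetE => /orP[] sX ts; apply/orP;
    by [left; exact: fintype.subset_trans ts sX
       |right; exact: fintype.subset_trans ts sX].
have [LL0|] := eqVneq (L :\: L0) finset.set0.
  have {}LL0 : L \subset L0 by rewrite -finset.setD_eq0 LL0.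
  exists id; split=> // [|x /realizationE[xi xL]]; first exact: cont_in_id.
  apply/realizationE; split=> //; rewrite in_full_sub.
  have xD : supp x \subset D by rewrite -powersetE (fintype.subsetP LD).
  have := fintype.subsetP LL0 _ xL.
  rewrite finset.in_setU !powersetE => xL0; apply/andP; split.
    by case/orP: xL0 => /face_sub; [apply; exact: sgK | apply; exact: w0t0].
  apply/fintype.subsetP => i ix; have := fintype.subsetP xD _ ix.
  rewrite finset.in_setU1 finset.in_setU finset.in_setI ix.
  case/orP=> [/eqP ->|->]; first by rewrite w0J.
  by rewrite orbT.
case/finset.set0Pn => s1 s1L.
(* A member of largest size can be removed from [L] without spoiling downward closure. *)
case: (@arg_maxnP _ s1 (fun s => s \in L :\: L0) (fun s : {set 'I_m} => #|s|) s1L).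
move=> s sL smax; have /finset.setDP[sL1 sL0] := sL.
have L0Ls : L0 \subset L :\ s.
  by rewrite finset.subsetD1 L0L.
have dLs : down_closed (L :\ s).
  move=> t u; rewrite !finset.in_setD1 => /andP[ts tL] ut.
  rewrite (dL _ _ tL ut) andbT; apply: contraNneq sL0 => us; subst u.
  apply: contraT => sL0; have tL0 : t \notin L0 by apply: contra sL0 => /dL0; apply.
  have := smax t; rewrite finset.in_setD tL tL0 => /(_ isT) ts_le.
  have : (#|s| < #|t|)%N by apply: proper_card; rewrite finset.properEneq ut eq_sym ts.
  by rewrite ltnNge; move: ts_le => /= ->.
have [||f [cf fB fid]] := IH (L :\ s) _ L0Ls _ dLs.
- rewrite ltnS in nL; apply: leq_trans nL.
  apply: proper_card; apply/properP; split.
    by apply/finset.setSD/finset.subD1set.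
  by exists s => //; rewrite !finset.inE eqxx !andbF.
- exact: fintype.subset_trans (finset.subD1set _ _) LD.
have sD : s \subset D by rewrite -powersetE (fintype.subsetP LD).
have cB : contractible R (B s).
  apply: H; first exact: finset.subsetIr.
  apply: contra sL0 => st0; rewrite finset.in_setU !powersetE; apply/orP; right.
  apply/fintype.subsetP => i si; have := fintype.subsetP sD _ si.
  rewrite !finset.in_setU1 => /orP[->//|isg].
  by rewrite (fintype.subsetP st0) ?orbT // finset.in_setI si.
have s0 : s != finset.set0.
  apply: contraNneq sL0 => ->.
  by rewrite finset.in_setU powersetE finset.sub0set.
have [|||g [cg gf gB]] := extend_simplex s0 dLs _ _ cB cf _.
- by rewrite finset.setD11.
- move=> t; rewrite finset.properEneq finset.in_setD1 => /andP[-> ts].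
  exact: dL sL1 ts.
- by move=> x xL xs; apply: (BS _ _ xs); exact: fB.
exists g; split=> [|x /realizationE[xi xL]|x /simplexE[xi xs]].
- by rewrite finset.setD1K in cg.
- have [xsE|xsN] := eqVneq (supp x) s.
    by rewrite xsE; apply: gB; apply/simplexE; rewrite xsE.
  have xL' : realization (L :\ s) x.
    by apply/realizationE; rewrite finset.in_setD1 xsN.
  by rewrite gf //; exact: fB.
rewrite gf; first by apply: fid; apply/simplexE.
apply/realizationE; split=> //; apply: (fintype.subsetP L0Ls).
by rewrite finset.in_setU powersetE xs.
Qed.

(* Were all these subcomplexes contractible, the identity of
   [sg :|: (w0 |: t0)] would extend to the simplex on [w0 |: sg], each
   [w0 |: t] going to the subcomplex on [J :|: t]; collapsing J to w0 would
   then give a face-preserving map of a simplex to its boundary. *)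
Lemma exists_not_contractible :
  exists t, [/\ t \subset sg, ~~ (t \subset t0)
    & ~ contractible R (realization (full_sub K (J :|: t)) : set 'rV[R]_m)].
Proof.
apply: contrapT => no.
have H t : t \subset sg -> ~~ (t \subset t0) ->
    contractible R (realization (full_sub K (J :|: t)) : set 'rV[R]_m).
  by move=> tsg tt0; apply: contrapT => nc; apply: no; exists t.
have [|//||f [cf fB fid]] := extension H (L := powerset D).
- apply/fintype.subsetP => s; rewrite finset.in_setU !powersetE => /orP[] sX.
    exact: fintype.subset_trans sX (finset.subsetUr _ _).
  by apply: fintype.subset_trans sX _; apply: finset.setUS.
- exact: down_closed_powerset.
have w0sg : w0 \notin sg by rewrite (disjointFr Jsg).
pose rho (y : 'rV[R]_m) : 'rV[R]_m :=
  \row_i (if i == w0 then \sum_(w in J) y 0 w else (i \in sg)%:R * y 0 i).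
have D0 : D != finset.set0 by apply/finset.set0Pn; exists w0; rewrite finset.setU11.
have fK x : simplex D x -> realization (full_sub K (J :|: (supp x :&: sg))) (f x).
  by move=> xD; exact: fB.
apply: (no_simplex_retraction (f := fun x => rho (f x)) D0).
  apply: cont_in_rV => i.
  have [iw|iw] := eqVneq i w0.
    apply: (eq_cont_in (f := fun x => \sum_(w in J) f x 0 w)).
      by move=> x _; rewrite mxE iw eqxx.
    apply: cont_in_big => [g h|w _]; first exact: cont_inD.
    exact: cont_in_coord.
  apply: (eq_cont_in (f := fun x => (i \in sg)%:R * f x 0 i)).
    by move=> x _; rewrite mxE (negPf iw).
  by apply: cont_inM; [exact: cont_in_cst | exact: cont_in_coord].
move=> x xD; have /realizationE[[y0 y1]] := fK x xD; set y := f x in y0 y1 *.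
rewrite in_full_sub => /andP[yK yJ].
have out i : i \notin J -> i \notin sg -> y 0 i = 0.
  move=> iJ isg; apply/eqP; apply: contraT => yi.
  have := fintype.subsetP yJ i; rewrite in_supp yi => /(_ isT).
  by rewrite !finset.inE (negPf iJ) (negPf isg) andbF.
have /simplexE[xi xDs] := xD.
have rho_supp i : i \in supp (rho y) -> i != w0 -> i \in sg /\ i \in supp y.
  rewrite in_supp mxE => + iw; rewrite (negPf iw).
  by case isg: (i \in sg); rewrite ?mul0r ?eqxx // mul1r => yi; split; rewrite ?in_supp.
split.
- split=> [i|].
    rewrite mxE; case: ifP => _; first by apply: sumr_ge0.
    by rewrite mulr_ge0.
  under eq_bigr do rewrite mxE.
  rewrite (bigD1 w0) //= eqxx.
  rewrite [X in _ + X](eq_bigr (fun i => (i \in sg)%:R * y 0 i)); last first.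
    by move=> i iw; rewrite (negPf iw).
  have -> : \sum_(i | i != w0) (i \in sg)%:R * y 0 i = \sum_(i in sg) y 0 i.
    rewrite big_mkcond [RHS]big_mkcond; apply: eq_bigr => i _.
    have [->|_] := eqVneq i w0; first by rewrite (negPf w0sg).
    by case: ifP; rewrite ?mul1r ?mul0r.
  rewrite -[RHS]y1 [in RHS](bigID (fun i => i \in J)) /=; congr (_ + _).
  rewrite big_mkcond [RHS]big_mkcond; apply: eq_bigr => i _.
  case iJ: (i \in J) => /=; first by rewrite (disjointFr Jsg).
  by case isg: (i \in sg) => //; rewrite out ?iJ ?isg.
(* Without [w0] in its support, [x] lies on [sg], where [f] is the identity and no mass sits on
   [J]. *)
- have [w0x|w0x] := boolP (w0 \in supp x); last first.
    have xsg : supp x \subset sg.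
      apply/fintype.subsetP => i ix; have := fintype.subsetP xDs _ ix.
      by rewrite finset.in_setU1 => /orP[/eqP iw|//]; rewrite iw (negPf w0x) in ix.
    have yx : y = x by apply: fid; apply/simplexE.
    apply/fintype.subsetP => i ir.
    have [iw|iw] := eqVneq i w0; last by have [_] := rho_supp i ir iw; rewrite yx.
    move: ir; rewrite in_supp mxE iw eqxx big1 ?eqxx // => w wJ.
    apply/eqP; apply: contraT => yw; have : w \in sg.
      by apply: (fintype.subsetP xsg); rewrite -yx in_supp.
    by rewrite (disjointFr Jsg).
  apply/fintype.subsetP => i ir.
  have [-> //|iw] := eqVneq i w0.
  have [isg iy] := rho_supp i ir iw.
  have := fintype.subsetP yJ _ iy.
  by rewrite !finset.inE (disjointFl Jsg) //= => /andP[].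
(* Full support would make the support of [y] a face containing [sg], hence equal to [sg], which
   leaves no mass on [J] for the vertex [w0]. *)
apply/eqP => rD.
have sgy : sg \subset supp y.
  apply/fintype.subsetP => i isg.
  have iw : i != w0 by apply: contraNneq w0sg => <-.
  by case: (rho_supp i _ iw); rewrite // rD finset.in_setU1 isg orbT.
have ysg := sg_facet yK sgy.
have : w0 \in supp (rho y) by rewrite rD finset.setU11.
rewrite in_supp mxE eqxx big1 ?eqxx // => w wJ.
apply/eqP; apply: contraT => yw; have : w \in sg by rewrite -ysg in_supp.
by rewrite (disjointFr Jsg).
Qed.

End TopologicalObstruction.

(** * Homotopy equivalences with spheres *)

Section Homotopies.
Variable R : realType.
Local Open Scope classical_set_scope.

Let I01 : set R := `[0, 1].

Lemma homotopicP (X Y : topologicalType) (A : set X) (B : set Y) (f g : X -> Y) :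
  homotopic R A B f g <-> exists H : R * X -> Y,
    [/\ cont_in (X := (R * X)%type) (I01 `*` A) H,
        forall (t : R) x, I01 t -> A x -> B (H (t, x)),
        forall x, A x -> H (0, x) = f x & forall x, A x -> H (1, x) = g x].
Proof.
by split=> -[H [cH HB H0 H1]]; exists H; split=> //; apply/cont_inP.
Qed.

Lemma homotopic_trans (X Y : topologicalType) (A : set X) (B : set Y)
    (f g h : X -> Y) :
  homotopic R A B f g -> homotopic R A B g h -> homotopic R A B f h.
Proof.
move=> /homotopicP[H [cH HB H0 H1]] /homotopicP[G [cG GB G0 G1]].
apply/homotopicP.
pose W (z : R * X) := if z.1 <= 2^-1 then H (2 * z.1, z.2) else G (2 * z.1 - 1, z.2).
have cfst (S : set (R * X)) : cont_in S (fst : R * X -> R).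
  by apply: continuous_cont_in => x; exact: cvg_fst.
have csnd (S : set (R * X)) : cont_in S (snd : R * X -> X).
  by apply: continuous_cont_in => x; exact: cvg_snd.
pose A1 : set (R * X) := [set z | z.1 <= 2^-1].
pose A2 : set (R * X) := [set z | - z.1 <= - 2^-1].
have W2 (z : R * X) : 0 <= z.1 <= 1 -> A z.2 -> - z.1 <= - 2^-1 -> W z = G (2 * z.1 - 1, z.2).
  case: z => t x /= t01 Ax t2; rewrite /W /=; case: ifP => // t2'.
  have -> : t = 2^-1 by lra.
  by rewrite divff ?pnatr_eq0 // subrr H1 // G0.
exists W; split=> [|t x t01 Ax|x Ax|x Ax].
- pose C1 := (I01 `*` A) `&` A1; pose C2 := (I01 `*` A) `&` A2.
  have c1 : cont_in (C1 : set (R * X)%type) W.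
    apply: (eq_cont_in (X := (R * X)%type) (f := fun z : R * X => H (2 * z.1, z.2))).
      by move=> [t x] [_ /= t2]; rewrite /W /= t2.
    apply: (cont_in_comp (Y := (R * X)%type) (B := I01 `*` A)
      (f := fun z : R * X => (2 * z.1, z.2)) (g := H)) => //.
      apply: cont_in_pair; last exact: csnd.
      by apply: cont_inM; [exact: cont_in_cst | exact: cfst].
    move=> [t x] [[/= t01 Ax] t2]; split=> //.
    by move: t01 t2; rewrite /I01 /A1 /= !in_itv /= => /andP[? ?] ?; apply/andP; split; lra.
  have c2 : cont_in (C2 : set (R * X)%type) W.
    apply: (eq_cont_in (X := (R * X)%type) (f := fun z : R * X => G (2 * z.1 - 1, z.2))).
      move=> [t x] [[/= t01 Ax] t2]; rewrite W2 //.
    apply: (cont_in_comp (Y := (R * X)%type) (B := I01 `*` A)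
      (f := fun z : R * X => (2 * z.1 - 1, z.2)) (g := G)) => //.
      apply: cont_in_pair; last exact: csnd.
      apply: cont_inB; last exact: cont_in_cst.
      by apply: cont_inM; [exact: cont_in_cst | exact: cfst].
    move=> [t x] [[/= t01 Ax] t2]; split=> //.
    by move: t01 t2; rewrite /I01 /A2 /= !in_itv /= => /andP[? ?] ?; apply/andP; split; lra.
  move=> z zA P WP.
  have cl1 : closed A1 by apply: closed_le_fun; exact: cfst.
  have cl2 : closed A2 by apply: closed_le_fun; apply: cont_inN; exact: cfst.
  (* [A] need not be closed, so [cont_in_setU] does not apply; the gluing is local, only the two
     bounds on the time being closed conditions. *)
  have ext (C : set (R * X)) : closed C -> cont_in ((I01 `*` A) `&` C) W ->
      nbhs z [set y | (I01 `*` A) y -> C y -> P (W y)].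
    move=> clC cC; have [Cz|nCz] := EM (C z).
      have := cC z (conj zA Cz) P WP; rewrite /nbhs /= /within /=.
      by apply: filterS => y Hy yA Cy; apply: Hy.
    have : nbhs z (~` C) by apply: open_nbhs_nbhs; split => //; exact: closed_openC.
    by apply: filterS => y nCy _ /nCy.
  have h1 := ext _ cl1 c1; have h2 := ext _ cl2 c2.
  rewrite /nbhs /= /within /=; apply: filterS2 h1 h2 => y y1 y2 yA /=.
  have [t2|t2] := leP y.1 2^-1; [exact: y1|apply: y2 => //].
  by rewrite /A2 /=; lra.
- move: t01; rewrite /I01 /W /= in_itv /= => /andP[t0 t1].
  by case: ifP => t2; [apply: HB|apply: GB] => //; rewrite /I01 /= in_itv /=; apply/andP; split; lra.
- by rewrite /W /= invr_ge0 ler0n mulr0 H0.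
rewrite W2 //= ?ler01 ?lexx //; last by lra.
by rewrite mulr1 (_ : 2 - 1 = 1) ?G1 //; ring.
Qed.

Lemma homotopic_comp (X Y Z W : topologicalType) (A : set X) (B : set Y)
    (C : set Z) (D : set W) (f : X -> Y) (h k : Y -> Z) (g : Z -> W) :
  cont_in A f -> (forall x, A x -> B (f x)) ->
  cont_in C g -> (forall z, C z -> D (g z)) ->
  homotopic R B C h k -> homotopic R A D (g \o h \o f) (g \o k \o f).
Proof.
move=> cf fB cg gD /homotopicP[H [cH HB H0 H1]]; apply/homotopicP.
exists (fun z => g (H (z.1, f z.2))); split=> [|t x t01 Ax|x Ax|x Ax].
- apply: (cont_in_comp (B := C) (f := fun z : R * X => H (z.1, f z.2)) _ _ cg).
    apply: (cont_in_comp (Y := (R * Y)%type) (B := I01 `*` B)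
      (f := fun z : R * X => (z.1, f z.2)) (g := H)) => //.
      apply: cont_in_pair.
        by apply: continuous_cont_in => x; exact: cvg_fst.
      apply: (cont_in_comp (B := A) (f := snd) (g := f)) => // [|z [_ //]].
      by apply: continuous_cont_in => x; exact: cvg_snd.
    by move=> [t x] [/= t01 Ax]; split=> //; exact: fB.
  by move=> [t x] [/= t01 Ax]; apply: HB => //; exact: fB.
- by apply: gD; apply: HB => //; exact: fB.
- by rewrite /= H0 //; exact: fB.
by rewrite /= H1 //; exact: fB.
Qed.

Lemma homotopy_equiv_sym (X Y : topologicalType) (A : set X) (B : set Y) :
  homotopy_equiv R A B -> homotopy_equiv R B A.
Proof. by move=> [f [g [? ? ? ?]]]; exists g, f; split. Qed.

Lemma homotopy_equiv_trans (X Y Z : topologicalType) (A : set X) (B : set Y)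
    (C : set Z) :
  homotopy_equiv R A B -> homotopy_equiv R B C -> homotopy_equiv R A C.
Proof.
move=> [f [g [[/cont_inP cf fB] [/cont_inP cg gA] gf fg]]].
move=> [h [k [[/cont_inP ch hC] [/cont_inP ck kB] kh hk]]].
exists (h \o f), (g \o k); split.
- split=> [|x /fB /hC //]; apply/cont_inP; exact: (cont_in_comp cf fB ch).
- split=> [|x /kB /gA //]; apply/cont_inP; exact: (cont_in_comp ck kB cg).
- exact: homotopic_trans (homotopic_comp cf fB cg gA kh) gf.
exact: homotopic_trans (homotopic_comp ck kB ch hC fg) hk.
Qed.

End Homotopies.

Section Contiguity.
Variables (R : realType) (m : nat) (L : {set {set 'I_m}}).
Hypothesis dL : down_closed L.

(** Along the segment from [f x] to [g x] the supports stay inside the union of the two supports,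
    which is a member of [L]. *)
Lemma homotopic_contiguous (X : topologicalType) (A : set X)
    (f g : X -> 'rV[R]_m) :
  cont_in A f -> cont_in A g ->
  (forall x, A x -> in_simplex (f x)) -> (forall x, A x -> in_simplex (g x)) ->
  (forall x, A x -> supp (f x) :|: supp (g x) \in L) ->
  homotopic R A (realization L) f g.
Proof.
move=> cf cg fs gs fgL; apply/homotopicP.
have csnd (S : set (R * X)) : cont_in S (snd : R * X -> X).
  by apply: continuous_cont_in => x; exact: cvg_snd.
have cfst (S : set (R * X)) : cont_in S (fst : R * X -> R).
  by apply: continuous_cont_in => x; exact: cvg_fst.
exists (fun z => (1 - z.1) *: f z.2 + z.1 *: g z.2); split=> [|t x|x Ax|x Ax].
- apply: cont_in_rV => i.
  apply: (eq_cont_in (X := (R * X)%type) (f := fun z : R * X => (1 - z.1) * f z.2 0 i + z.1 * g z.2 0 i)).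
    by move=> z _; rewrite !mxE.
  apply: cont_inD; apply: cont_inM => //.
  + by apply: cont_inB => //; exact: cont_in_cst.
  + by apply: (cont_in_comp (B := A) (f := snd) (g := fun x => f x 0 i)) => // [z []//|]; exact: cont_in_coord.
  by apply: (cont_in_comp (B := A) (f := snd) (g := fun x => g x 0 i)) => // [z []//|]; exact: cont_in_coord.
- rewrite /= in_itv /= => /andP[t0 t1] Ax.
  have [[f0 f1] [g0 g1]] := (fs x Ax, gs x Ax).
  apply/realizationE; split; first split=> [i|].
  + by rewrite !mxE addr_ge0 // mulr_ge0 // subr_ge0.
  + under eq_bigr do rewrite !mxE.
    by rewrite big_split /= -!mulr_sumr f1 g1 !mulr1 subrK.
  apply: dL (fgL x Ax) _; apply/fintype.subsetP => i.
  rewrite finset.in_setU !in_supp !mxE; apply: contraR.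
  by rewrite negb_or !negbK => /andP[/eqP -> /eqP ->]; rewrite !mulr0 addr0.
- by rewrite /= subr0 scale1r scale0r addr0.
by rewrite /= subrr scale0r scale1r add0r.
Qed.

Lemma cone_htpy_point v : finset.set0 \in L ->
  (forall s, s \in L -> v |: s \in L) -> htpy_point R L.
Proof.
move=> L0 Lv; exists (fun=> 0), (fun=> vertex R v).
have vL : realization L (vertex R v).
  apply/realizationE; split; first exact: in_simplex_vertex.
  by rewrite supp_vertex -[X in X \in L]finset.setU0; exact: Lv.
split.
- by split=> //; apply/cont_inP; exact: cont_in_cst.
- by split=> //; apply/cont_inP; exact: cont_in_cst.
- apply: homotopic_contiguous => [|||x [] //|x xL].
  + exact: cont_in_cst.
  + exact: cont_in_id.
  + by move=> x _; exact: in_simplex_vertex.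
  by rewrite /= supp_vertex; apply: Lv; case: xL.
exists (fun=> 0); split=> //.
by apply/cont_inP; exact: cont_in_cst.
Qed.

End Contiguity.

(** * Homotopy spheres with one minimal non-face for each vertex of J *)

Section Sphere.
Variables (R : realType) (m : nat) (tau J : {set 'I_m}).
Variables (T : 'I_m -> {set 'I_m}) (L : {set {set 'I_m}}).
Hypothesis tauJ : [disjoint tau & J].
Hypothesis T_tau : forall w, w \in J -> T w \subset tau.
Hypothesis T_cover : forall v, v \in tau -> exists2 w, w \in J & v \in T w.
Hypothesis LP : forall s, s \in L <->
  s \subset tau :|: J /\ forall w, w \in J -> w \in s -> ~~ (T w \subset s).

Let n := #|tau|.
Implicit Types (x : 'rV[R]_m) (u z : 'rV[R]_n) (y : 'I_m -> R) (r : R).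

Lemma sphere_family_down_closed : down_closed L.
Proof.
move=> s t /LP[sX sT] ts; apply/LP; split.
  exact: fintype.subset_trans ts sX.
move=> w wJ wt; apply: contra (sT w wJ (fintype.subsetP ts _ wt)) => H.
exact: fintype.subset_trans H ts.
Qed.

(** Small enough that coordinates of at most [eps] add up to at most 1/2, and that [eps] is below
    1/m, so that truncation at [eps] never kills a whole point. *)
Let eps : R := (2 * m.+1%:R)^-1.

Let eps_gt0 : 0 < eps.
Proof. by rewrite invr_gt0 mulr_gt0 ?ltr0n. Qed.

Let eps_mul : eps * m.+1%:R = 2^-1.
Proof. by rewrite /eps invfM mulfVK // pnatr_eq0. Qed.

Let mass x := \sum_i x 0 i.
Let normal x := (mass x)^-1 *: x.

Let mass_gt0 x i : (forall j, 0 <= x 0 j) -> 0 < x 0 i -> 0 < mass x.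
Proof.
move=> x0 xi; rewrite /mass (bigD1 i) //=; apply: ltr_wpDr => //.
by apply: sumr_ge0.
Qed.

Let normal_simplex x : (forall j, 0 <= x 0 j) -> 0 < mass x ->
  in_simplex (normal x) /\ supp (normal x) = supp x.
Proof.
move=> x0 mx; split; first split=> [i|].
- by rewrite mxE mulr_ge0 // invr_ge0 ltW.
- under eq_bigr do rewrite mxE.
  by rewrite -mulr_sumr mulVf // gt_eqF.
apply/setP => i; rewrite !in_supp mxE mulf_eq0 invr_eq0 [mass x == 0]gt_eqF //.
Qed.

Let cont_normal (X : topologicalType) (A : set X) (f : X -> 'rV[R]_m) :
  cont_in A f -> (forall a, A a -> 0 < mass (f a)) ->
  cont_in A (fun a => normal (f a)).
Proof.
move=> cf f0; apply: cont_in_rV => i.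
apply: (eq_cont_in (f := fun a => (mass (f a))^-1 * f a 0 i)).
  by move=> a _; rewrite mxE.
apply: cont_inM; last exact: cont_in_coord.
apply: cont_inV; first by move=> a Aa; rewrite gt_eqF //; exact: f0.
by apply: cont_in_big => [g h|j _]; [exact: cont_inD | exact: cont_in_coord].
Qed.

(* [wt y w > 0] only if some y v, v in T w, is below eps, so that truncating
   y at eps makes room for the vertex w *)
Let wt y w := \big[Num.max/0]_(v in T w) (eps - y v).
Let shr y r : 'rV[R]_m := \row_i
  if i \in tau then Num.max 0 (y i - eps) else
  if i \in J then r * wt y i else 0.

Let wt_ge0 y w : 0 <= wt y w.
Proof. exact: bigmax_ge_id. Qed.

Let shr_ge0 y r i : 0 <= r -> 0 <= shr y r 0 i.
Proof.
move=> r0; rewrite mxE; case: ifP => _; first by rewrite le_max lexx.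
by case: ifP => _ //; rewrite mulr_ge0.
Qed.

(** On [tau] the union contains only vertices of coordinate above [eps]. A vertex [w] of [B] misses
    some vertex of [T w] in [B], and a vertex [w] of positive weight has one of coordinate below
    [eps] in [T w]; in both cases [T w] is not inside the union. *)
Let shr_face y r B : B \in L ->
  (forall v, v \in tau -> (v \in B) = (eps < y v)) ->
  supp (shr y r) :|: B \in L.
Proof.
move=> /LP[BX BT] By.
have shr_tau v : v \in tau -> v \in supp (shr y r) :|: B -> eps < y v.
  move=> vt; rewrite finset.in_setU in_supp mxE vt => /orP[|]; last by rewrite By.
  by apply: contraR; rewrite -leNgt => H; rewrite max_l // subr_le0.
apply/LP; split.
  rewrite finset.subUset BX andbT; apply/fintype.subsetP => i.
  rewrite in_supp mxE finset.in_setU.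
  by case: ifP => // _; case: ifP => // _; rewrite eqxx.
move=> w wJ; rewrite finset.in_setU => wX; apply/negP => Tw.
case/orP: wX => [|wB]; last first.
  have /fintype.subsetPn[v vT vB] := BT w wJ wB.
  have vt := fintype.subsetP (T_tau wJ) _ vT.
  have := shr_tau v vt (fintype.subsetP Tw _ vT).
  by rewrite -By // (negPf vB).
rewrite in_supp mxE (disjointFl tauJ wJ) wJ mulf_eq0 negb_or => /andP[_].
have [[v vT yv]|no] := EM (exists2 v, v \in T w & y v < eps).
  have vt := fintype.subsetP (T_tau wJ) _ vT.
  by have := shr_tau v vt (fintype.subsetP Tw _ vT); rewrite ltNge (ltW yv).
move/eqP; apply; apply/eqP; rewrite eq_le wt_ge0 andbT; apply: bigmax_le => // v vT.
by rewrite subr_le0 leNgt; apply/negP => H; apply: no; exists v.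
Qed.

Let cont_shr (X : topologicalType) (A : set X) (y : X -> 'I_m -> R) (r : X -> R) :
  (forall i, cont_in A (fun a => y a i)) -> cont_in A r ->
  cont_in A (fun a => shr (y a) (r a)).
Proof.
move=> cy cr; apply: cont_in_rV => i.
have E a : shr (y a) (r a) 0 i = if i \in tau then Num.max 0 (y a i - eps) else
    if i \in J then r a * wt (y a) i else 0 by rewrite mxE.
apply: (eq_cont_in (f := fun a => if i \in tau then Num.max 0 (y a i - eps) else
  if i \in J then r a * wt (y a) i else 0)) => //.
case: (i \in tau).
  apply: cont_in_max; first exact: cont_in_cst.
  by apply: cont_inB; [exact: cy | exact: cont_in_cst].
case: (i \in J); last exact: cont_in_cst.
apply: cont_inM => //; apply: cont_in_big => [f g|v _]; first exact: cont_in_max.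
by apply: cont_inB; [exact: cont_in_cst | exact: cy].
Qed.

(* barycentric coordinates of a point of the boundary of the simplex on tau and
   one more vertex, of coordinate r *)
Let adm y r := [/\ forall i, i \in tau -> 0 <= y i, 0 <= r,
  \sum_(i in tau) y i + r = 1 & r = 0 \/ exists2 v, v \in tau & y v = 0].

Let shr_mass y r : adm y r -> 0 < mass (shr y r).
Proof.
move=> [y0 r0 yr adm0].
have sh0 j : 0 <= shr y r 0 j by exact: shr_ge0.
have [[v vt yv]|no] := EM (exists2 v, v \in tau & eps < y v).
  by apply: (@mass_gt0 _ v) => //; rewrite mxE vt lt_max subr_gt0 yv orbT.
have : \sum_(i in tau) y i <= 2^-1.
  apply: (@le_trans _ _ (\sum_(i in tau) eps)).
    apply: ler_sum => i it; rewrite leNgt; apply/negP => H; apply: no.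
    by exists i.
  rewrite sumr_const -eps_mul -[eps *+ _]mulr_natr ler_wpM2l ?(ltW eps_gt0) //.
  rewrite ler_nat; apply: leq_trans (max_card _) _.
  by rewrite card_ord.
move=> ysum; have r_gt0 : 0 < r by lra.
case: adm0 => [r00|[v vt yv]]; first by rewrite r00 ltxx in r_gt0.
have [w wJ vT] := T_cover vt.
apply: (@mass_gt0 _ w) => //; rewrite mxE (disjointFl tauJ wJ) wJ mulr_gt0 //.
apply: lt_le_trans (le_bigmax_cond _ _ vT).
by rewrite yv subr0.
Qed.

Let shr_L y r : adm y r -> realization L (normal (shr y r)).
Proof.
move=> ad; have [y0 r0 yr adm0] := ad.
have [ns nsupp] := normal_simplex (fun j => shr_ge0 y j r0) (shr_mass ad).
apply/realizationE; split=> //; rewrite nsupp.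
pose B := [set v in tau | eps < y v].
have BL : B \in L.
  apply/LP; split.
    apply/fintype.subsetP => v; rewrite finset.in_set => /andP[vt _].
    by rewrite finset.in_setU vt.
  by move=> w wJ; rewrite finset.in_set (disjointFl tauJ wJ).
have := @shr_face y r B BL; have -> : supp (shr y r) :|: B = supp (shr y r).
  apply/finset.setUidPl/fintype.subsetP => v; rewrite finset.in_set => /andP[vt yv].
  by rewrite in_supp mxE vt gt_eqF // lt_max subr_gt0 yv orbT.
by apply=> v vt; rewrite finset.in_set vt.
Qed.

Let sumJ x := \sum_(w in J) x 0 w.

Let adm_L x : realization L x -> adm (fun i => x 0 i) (sumJ x).
Proof.
move=> /realizationE[[x0 x1] /LP[xX xT]]; split=> //.
- by apply: sumr_ge0.
- rewrite -x1 [RHS](bigID (fun i => i \in tau)) /=; congr (_ + _).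
  rewrite [LHS]big_mkcond [RHS]big_mkcond; apply: eq_bigr => i _.
  case iJ: (i \in J); first by rewrite (disjointFl tauJ iJ).
  case it: (i \in tau) => //=; apply/esym/eqP; apply: contraT => xi.
  by have := fintype.subsetP xX i; rewrite in_supp xi finset.in_setU iJ it => /(_ isT).
have [|r0] := eqVneq (sumJ x) 0; [by left | right].
have [w wJ xw] : exists2 w, w \in J & x 0 w != 0.
  apply: contrapT => no; move/eqP: r0; apply; apply: big1 => w wJ.
  by apply/eqP; apply: contraT => xw; case: no; exists w.
have := xT w wJ; rewrite in_supp xw => /(_ isT)/fintype.subsetPn[v vT].
rewrite in_supp negbK => /eqP xv; exists v => //.
exact: fintype.subsetP (T_tau wJ) _ vT.
Qed.

Let nrm2 z := \sum_k z 0 k ^+ 2.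
Let unit z := (Num.sqrt (nrm2 z))^-1 *: z.

Let nrm2_gt0 z : (exists k, z 0 k != 0) -> 0 < nrm2 z.
Proof.
case=> k zk; rewrite /nrm2 (bigD1 k) //=; apply: ltr_wpDr.
  by apply: sumr_ge0 => i _; exact: sqr_ge0.
by rewrite lt0r sqrf_eq0 zk sqr_ge0.
Qed.

Let unit_sphere z : (exists k, z 0 k != 0) -> sphere (unit z).
Proof.
move=> /nrm2_gt0 z0; rewrite /sphere /=.
under eq_bigr do rewrite mxE exprMn.
by rewrite -mulr_sumr exprVn sqr_sqrtr ?(ltW z0) // mulVf // gt_eqF.
Qed.

Let unit_id u : sphere u -> unit u = u.
Proof. by rewrite /sphere /= /unit /nrm2 => ->; rewrite sqrtr1 invr1 scale1r. Qed.

Let cont_unit (X : topologicalType) (A : set X) (f : X -> 'rV[R]_n) :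
  cont_in A f -> (forall a, A a -> exists k, f a 0 k != 0) ->
  cont_in A (fun a => unit (f a)).
Proof.
move=> cf f0; apply: cont_in_rV => k.
apply: (eq_cont_in (f := fun a => (Num.sqrt (nrm2 (f a)))^-1 * f a 0 k)).
  by move=> a _; rewrite mxE.
apply: cont_inM; last exact: cont_in_coord.
apply: cont_inV.
  by move=> a /f0/nrm2_gt0 H; rewrite gt_eqF // sqrtr_gt0.
apply: cont_in_sqrt; apply: cont_in_big => [g h|j _]; first exact: cont_inD.
by apply: cont_inM; exact: cont_in_coord.
Qed.

(** Collapsing [J] to one vertex sends the realization to the boundary of the simplex on [tau] and
    that vertex. Subtracting the coordinate of the new vertex from the others identifies this
    boundary, up to scale, with the sphere. *)
Let zf x : 'rV[R]_n := \row_k (x 0 (enum_val k) - sumJ x).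

Let tau_val v : v \in tau -> exists k : 'I_n, v = enum_val k.
Proof. by move=> vt; exists (enum_rank_in vt v); rewrite enum_rankK_in. Qed.

Let diff_neq0 (a : 'I_m -> R) (b : R) :
  0 < \sum_(i in tau) a i + b -> b = 0 \/ (exists2 v, v \in tau & a v = 0) ->
  exists k : 'I_n, a (enum_val k) - b != 0.
Proof.
move=> ab0 adm0; apply: contrapT => no.
have ab v : v \in tau -> a v = b.
  case/tau_val => k ->; apply/eqP; rewrite -subr_eq0; apply: contraT => H.
  by case: no; exists k.
have b0 : b = 0 by case: adm0 => // -[v vt av]; rewrite -(ab v vt).
move: ab0; rewrite big1 ?b0 ?addr0 ?ltxx // => v vt.
by rewrite ab.
Qed.

Let zf_neq0 x : realization L x -> exists k, zf x 0 k != 0.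
Proof.
move=> /adm_L[y0 r0 yr adm0].
have [|k Hk] := diff_neq0 (a := fun i => x 0 i) (b := sumJ x) _ adm0.
  by rewrite yr ltr01.
by exists k; rewrite mxE.
Qed.

(** Subtracting [mnu u] from 0 and from all coordinates of [u] makes them non-negative with at least
    one equal to 0: up to scale, the boundary point in direction [u]. The default 0 is the
    coordinate of the vertex to which [J] collapses. *)
Let mnu u := \big[Num.min/0]_k u 0 k.
Let yv u i := \sum_(k | enum_val k == i) (u 0 k - mnu u).
Let tot u := \sum_(i in tau) yv u i - mnu u.

Let yvE u (k : 'I_n) : yv u (enum_val k) = u 0 k - mnu u.
Proof. by rewrite /yv (big_pred1 k) // => j /=; rewrite (inj_eq enum_val_inj). Qed.

Let mnu_le0 u : mnu u <= 0.
Proof. exact: bigmin_le_id. Qed.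

Let yv_ge0 u i : 0 <= yv u i.
Proof.
apply: sumr_ge0 => k _; rewrite subr_ge0; exact: bigmin_le.
Qed.

Let mnu_arg u : mnu u = 0 \/ exists k : 'I_n, u 0 k = mnu u.
Proof.
have [ge0|lt0] := leP 0 (mnu u).
  by left; apply/eqP; rewrite eq_le mnu_le0.
right; apply: contrapT => no; have : mnu u < mnu u.
  apply/bigmin_gtP; split=> // k _; rewrite lt_neqAle bigmin_le // andbT.
  by apply/eqP => e; apply: no; exists k.
by rewrite ltxx.
Qed.

Let tot_gt0 u : sphere u -> 0 < tot u.
Proof.
move=> us; rewrite /tot; have := mnu_le0 u; rewrite le_eqVlt => /orP[/eqP m0|m0].
  rewrite m0 subr0; have [k uk] : exists k, u 0 k != 0.
    apply: contrapT => no; move: us; rewrite /sphere /= big1 => [/esym/eqP|k _].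
      by rewrite oner_eq0.
    apply/eqP; rewrite sqrf_eq0; apply: contraT => uk; case: no; by exists k.
  rewrite (bigD1 (enum_val k)) ?enum_valP //=; apply: ltr_wpDr.
    by apply: sumr_ge0.
  by rewrite yvE m0 subr0 lt0r uk -m0 bigmin_le.
by rewrite ltr_wpDl ?oppr_gt0 // sumr_ge0.
Qed.

Let yn u i := yv u i / tot u.
Let rn u := - mnu u / tot u.
Let G u := normal (shr (yn u) (rn u)).

Let adm_sphere u : sphere u -> adm (yn u) (rn u).
Proof.
move=> us; have t0 := tot_gt0 us; split=> [i _||| ].
- by rewrite divr_ge0 // ltW.
- by rewrite divr_ge0 ?(ltW t0) // oppr_ge0.
- by rewrite -mulr_suml -mulrDl divff // gt_eqF.
have [m0|[k uk]] := mnu_arg u; first by left; rewrite /rn m0 oppr0 mul0r.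
right; exists (enum_val k); first exact: enum_valP.
by rewrite /yn yvE uk subrr mul0r.
Qed.

Let cont_mnu (A : set 'rV[R]_n) : cont_in A mnu.
Proof.
apply: cont_in_big => [f g|k _]; [exact: cont_in_min | exact: cont_coord].
Qed.

Let cont_yv (A : set 'rV[R]_n) i : cont_in A (fun u => yv u i).
Proof.
apply: cont_in_big => [f g|k _]; first exact: cont_inD.
by apply: cont_inB; [exact: cont_coord | exact: cont_mnu].
Qed.

Let cont_G : cont_in (@sphere R n) G.
Proof.
have cV : cont_in (@sphere R n) (fun u => (tot u)^-1).
  apply: cont_inV; first by move=> u /tot_gt0 H; rewrite gt_eqF.
  apply: cont_inB; last exact: cont_mnu.
  by apply: cont_in_big => [f g|k _]; [exact: cont_inD | exact: cont_yv].
apply: cont_normal; last by move=> u /adm_sphere/shr_mass.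
apply: cont_shr => [i|]; apply: cont_inM => //.
by apply: cont_inN; exact: cont_mnu.
Qed.

Let cont_sumJ (X : topologicalType) (A : set X) (f : X -> 'rV[R]_m) :
  cont_in A f -> cont_in A (fun a => sumJ (f a)).
Proof.
move=> cf; apply: cont_in_big => [g h|w _]; [exact: cont_inD | exact: cont_in_coord].
Qed.

Let cont_zf (X : topologicalType) (A : set X) (f : X -> 'rV[R]_m) :
  cont_in A f -> cont_in A (fun a => zf (f a)).
Proof.
move=> cf; apply: cont_in_rV => k.
apply: (eq_cont_in (f := fun a => f a 0 (enum_val k) - sumJ (f a))).
  by move=> a _; rewrite mxE.
by apply: cont_inB; [exact: cont_in_coord | exact: cont_sumJ].
Qed.

Let GF x : realization L x -> G (unit (zf x)) = normal (shr (fun i => x 0 i) (sumJ x)).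
Proof.
move=> xL; have [y0 r0 yr adm0] := adm_L xL.
set u := unit (zf x); set la := (Num.sqrt (nrm2 (zf x)))^-1.
have la0 : 0 < la by rewrite invr_gt0 sqrtr_gt0; apply/nrm2_gt0/zf_neq0.
have uE k : u 0 k = la * (x 0 (enum_val k) - sumJ x) by rewrite !mxE.
have mE : mnu u = - (la * sumJ x).
  apply/eqP; rewrite eq_le; apply/andP; split.
    case: adm0 => [r00|[v vt xv]]; first by rewrite r00 mulr0 oppr0.
    have [k vk] := tau_val vt; apply: le_trans (bigmin_le _ k _) _.
    by rewrite uE -vk xv sub0r mulrN.
  apply/bigmin_geP; split=> [|k _]; first by rewrite oppr_le0 mulr_ge0 // ltW.
  rewrite uE -mulrN ler_pM2l // lerBrDr addNr; apply: y0; exact: enum_valP.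
have yE i : i \in tau -> yv u i = la * x 0 i.
  by case/tau_val => k ->; rewrite yvE uE mE; ring.
have tE : tot u = la.
  rewrite /tot mE opprK (eq_bigr (fun i => la * x 0 i)) => [|i /yE //].
  by rewrite -mulr_sumr -mulrDr yr mulr1.
have rE : rn u = sumJ x.
  by rewrite /rn mE opprK tE mulrAC divff ?mul1r // gt_eqF.
rewrite /G; congr (normal _); apply/rowP => i; rewrite !mxE rE.
have ynE v : v \in tau -> yn u v = x 0 v.
  by move=> vt; rewrite /yn yE // tE mulrAC divff ?mul1r // gt_eqF.
case: ifP => it; first by rewrite ynE.
case: ifP => iJ //; congr (_ * _); apply: eq_bigr => v vT; rewrite ynE //.
exact: fintype.subsetP (T_tau iJ) _ vT.
Qed.

(** The composite map of the realization to itself and the identity need not be contiguous. This map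
    is contiguous to both: it truncates [tau] as [shr] does, and its support is inside that of
    [x]. *)
Let mid x : 'rV[R]_m := \row_i if i \in tau then Num.max 0 (x 0 i - eps) else x 0 i.

Let mid_ge0 x i : in_simplex x -> 0 <= mid x 0 i.
Proof. by move=> [x0 _]; rewrite mxE; case: ifP; rewrite ?le_max ?lexx. Qed.

Let mid_mass x : in_simplex x -> 0 < mass (mid x).
Proof.
move=> xs; have [i xi] := in_simplex_large xs.
have e_lt : eps < m%:R^-1.
  have m0 : (0 < m)%N by exact: leq_ltn_trans (leq0n i) (ltn_ord i).
  rewrite /eps ltf_pV2 ?posrE ?mulr_gt0 ?ltr0n // -natrM ltr_nat.
  by lia.
apply: (@mass_gt0 _ i) => [j|]; first exact: mid_ge0.
rewrite mxE; case: ifP => _; last by apply: lt_trans eps_gt0 _; exact: lt_le_trans xi.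
by rewrite lt_max subr_gt0 (lt_le_trans e_lt xi) orbT.
Qed.

Let mid_supp x : in_simplex x -> supp (mid x) \subset supp x.
Proof.
move=> [x0 _]; apply/fintype.subsetP => i; rewrite !in_supp mxE; case: ifP => // _.
by apply: contra => /eqP ->; rewrite sub0r max_l // oppr_le0 ltW.
Qed.

Lemma family_htpy_sphere :
  homotopy_equiv R (realization L : set 'rV[R]_m) (@sphere R n).
Proof.
have dL := sphere_family_down_closed.
have Ls (x : 'rV[R]_m) : realization L x -> in_simplex x by case/realizationE.
have cidL : cont_in (realization L : set 'rV[R]_m) id by exact: cont_in_id.
have cF : cont_in (realization L) (fun x => unit (zf x)).
  apply: cont_unit; [exact: (cont_zf cidL)|exact: zf_neq0].
have FS x : realization L x -> sphere (unit (zf x)).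
  by move=> xL; apply: unit_sphere; exact: zf_neq0.
have GL u : sphere u -> realization L (G u) by move=> us; exact/shr_L/adm_sphere.
exists (fun x => unit (zf x)), G; split.
- by split=> //; apply/cont_inP.
- by split=> //; apply/cont_inP; exact: cont_G.
- have c_mid : cont_in (realization L : set 'rV[R]_m) (fun x => normal (mid x)).
    apply: cont_normal; last by move=> x /Ls; exact: mid_mass.
    apply: cont_in_rV => i.
    apply: (eq_cont_in (f := fun x : 'rV[R]_m =>
      if i \in tau then Num.max 0 (x 0 i - eps) else x 0 i)).
      by move=> x _; rewrite mxE.
    case: (i \in tau); last exact: cont_coord.
    apply: cont_in_max; first exact: cont_in_cst.
    by apply: cont_inB; [exact: cont_coord | exact: cont_in_cst].
  apply: (homotopic_trans (g := fun x => normal (mid x))); last first.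
    apply: (homotopic_contiguous dL) => // x xL.
      by have [] := normal_simplex (fun j => mid_ge0 j (Ls _ xL)) (mid_mass (Ls _ xL)).
    have [_ ->] := normal_simplex (fun j => mid_ge0 j (Ls _ xL)) (mid_mass (Ls _ xL)).
    rewrite /= (finset.setUidPr (mid_supp (Ls _ xL))).
    by case/realizationE: xL.
  apply: (homotopic_contiguous dL) => //.
  + exact: (cont_in_comp cF FS cont_G).
  + by move=> x /FS/GL/Ls.
  + move=> x xL.
    by have [] := normal_simplex (fun j => mid_ge0 j (Ls _ xL)) (mid_mass (Ls _ xL)).
  move=> x xL; rewrite /= GF //.
  have [_ ->] := normal_simplex (fun j => mid_ge0 j (Ls _ xL)) (mid_mass (Ls _ xL)).
  have ad := adm_L xL; have [_ r0 _ _] := ad.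
  have [_ ->] := normal_simplex (fun j => shr_ge0 _ j r0) (shr_mass ad).
  apply: shr_face => [|v vt].
    by apply: dL (mid_supp (Ls _ xL)); case/realizationE: xL.
  rewrite in_supp mxE vt; case: ltP => ve; first by rewrite gt_eqF // lt_max subr_gt0 ve orbT.
  by rewrite max_l ?eqxx // subr_le0.
apply/homotopicP.
have csnd (S : set (R * 'rV[R]_n)) : cont_in S (snd : R * 'rV[R]_n -> 'rV[R]_n).
  by apply: continuous_cont_in => x; exact: cvg_snd.
have cfst (S : set (R * 'rV[R]_n)) : cont_in S (fst : R * 'rV[R]_n -> R).
  by apply: continuous_cont_in => x; exact: cvg_fst.
pose W (z : R * 'rV[R]_n) := (1 - z.1) *: zf (G z.2) + z.1 *: z.2.
have W0 t u : 0 <= t <= 1 -> sphere u -> exists k, W (t, u) 0 k != 0.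
  move=> /andP[t0 t1] us; have t_gt := tot_gt0 us.
  have ad := adm_sphere us; have [y0 r0 yr adm0] := ad.
  have sm := shr_mass ad; set x := shr _ _ in sm.
  have GE i : G u 0 i = x 0 i / mass x by rewrite mxE mulrC.
  pose a i := (1 - t) * G u 0 i + t * tot u * yn u i.
  pose b := (1 - t) * sumJ (G u) + t * tot u * rn u.
  have WE k : W (t, u) 0 k = a (enum_val k) - b.
    have uk : u 0 k = tot u * yn u (enum_val k) - tot u * rn u.
      have e1 : tot u * yn u (enum_val k) = u 0 k - mnu u.
        by rewrite /yn yvE mulrC divfK // gt_eqF.
      have e2 : tot u * rn u = - mnu u by rewrite /rn mulrC divfK // gt_eqF.
      by rewrite e1 e2 opprK subrK.
    have -> : W (t, u) 0 k = (1 - t) * zf (G u) 0 k + t * u 0 k.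
      by rewrite /W /=; move: (zf (G u)) => q; rewrite !mxE.
    have -> : zf (G u) 0 k = G u 0 (enum_val k) - sumJ (G u).
      by move: (G u) => q; rewrite mxE.
    by rewrite /a /b uk; ring.
  have [y0' r0' yr' adm0'] := adm_L (GL u us).
  have [k Hk] : exists k : 'I_n, a (enum_val k) - b != 0.
    apply: diff_neq0.
      rewrite /a big_split /= -!mulr_sumr addrACA -!mulrDr yr yr' !mulr1.
      have [t00|t00] := eqVneq t 0; first by rewrite t00 mul0r subr0 addr0.
      apply: ltr_wpDl; first by rewrite subr_ge0.
      by rewrite mulr_gt0 // lt0r t00.
    (* [G] preserves a vanishing coordinate: [rn u = 0] leaves no weight on [J], and truncation
       keeps [yn u v = 0]. So one coordinate vanishes along the whole segment, and [diff_neq0] keeps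
       the segment off the origin. *)
    case: adm0 => [rn0|[v vt yv0]]; [left|right].
      rewrite /b rn0 mulr0 addr0 /sumJ big1 ?mulr0 // => w wJ.
      by rewrite GE mxE (disjointFl tauJ wJ) wJ rn0 !mul0r.
    exists v => //; rewrite /a yv0 mulr0 addr0 GE mxE vt yv0 sub0r.
    by rewrite max_l ?mul0r ?mulr0 // oppr_le0 ltW.
  by exists k; rewrite WE.
exists (fun a => unit (W a)); split=> [|t u|u us|u us].
- apply: cont_unit; last first.
    by move=> [t u] [/= t01 us]; apply: W0 => //; move: t01; rewrite in_itv.
  apply: cont_in_rV => k.
  apply: (eq_cont_in (X := (R * 'rV[R]_n)%type)
    (f := fun z : R * 'rV[R]_n => (1 - z.1) * zf (G z.2) 0 k + z.1 * z.2 0 k)).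
    by move=> [t u] _; rewrite /W /=; move: (zf (G u)) => q; rewrite !mxE.
  apply: cont_inD; apply: cont_inM => //.
  + by apply: cont_inB => //; exact: cont_in_cst.
  + apply: cont_in_coord; apply: cont_zf.
    by apply: (cont_in_comp (B := @sphere R n) (f := snd) (g := G)) => // -[t u] [].
  by apply: cont_in_coord.
- by rewrite /= in_itv /= => t01 us; apply: unit_sphere; exact: W0.
- by rewrite /W /= subr0 scale1r scale0r addr0.
by rewrite /W /= subrr scale0r scale1r add0r unit_id.
Qed.

End Sphere.

(** The boundary of the simplex on n + 1 vertices is the case of [family_htpy_sphere] with a single
    vertex in [J], and it is not contractible. *)
Lemma sphere_not_htpy_point (R : realType) n :
  ~ homotopy_equiv R (@sphere R n) [set (0 : R)]%classic.
Proof.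
move=> sp; pose tau := ~: [set (ord_max : 'I_n.+1)]%SET.
have ct : #|tau| = n by rewrite cardsC1 card_ord.
have := @family_htpy_sphere R n.+1 tau [set ord_max]%SET (fun=> tau)
  [set s : {set 'I_n.+1} | s \proper finset.setT]%SET.
rewrite ct => /(_ _ _ _ _)/homotopy_equiv_trans /(_ sp) H.
apply: (@proper_family_not_contractible R n.+1 finset.setT).
  by apply/finset.set0Pn; exists ord_max.
apply: htpy_point_contractible; apply: H.
- by rewrite disjoint_sym disjoints1 !finset.inE eqxx.
- by move=> w _.
- by move=> v vt; exists ord_max => //; rewrite finset.in_set1.
move=> s; rewrite finset.in_set fintype.properE finset.subsetT /=.
have tsT : tau :|: [set ord_max]%SET = finset.setT by rewrite finset.setUC finset.setUCr.
rewrite tsT finset.subsetT; split=> [sT|[_ H']].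
  split=> // w /set1P -> ws; apply: contra sT => ts; rewrite -tsT finset.subUset ts.
  by rewrite finset.sub1set.
apply/negP => Ts; have := H' ord_max (set11 _) (fintype.subsetP Ts _ (finset.in_setT _)).
by case/negP; apply: fintype.subset_trans Ts; exact: finset.subsetT.
Qed.

(** * Minimal non-faces of weakly taut complexes *)

Section TautStructure.
Variables (m : nat) (K : scomplex m) (sg : {set 'I_m}).
Implicit Types (J M A s t : {set 'I_m}).

Definition facet := maxset (fun t => t \in faces K) sg.

(* the minimal non-faces are the [w |: T w] for w outside sg *)
Definition taut_structure (T : 'I_m -> {set 'I_m}) :=
  (forall w, w \notin sg -> T w \subset sg) /\
  (forall s, s \in faces K <->
     forall w, w \in s -> w \notin sg -> ~~ (T w \subset s)).

Section Counting.
Variable N : pred {set 'I_m}.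
Hypothesis sg_facet : facet.
Hypothesis N0 : N finset.set0.
Hypothesis N_nonface : forall M, M \notin faces K ->
  (forall t, t \proper M -> t \in faces K) -> N M.
Hypothesis N_join : forall J w0 t0, [disjoint J & sg] -> w0 \in J ->
  t0 \subset sg -> w0 |: t0 \in faces K ->
  exists t, [/\ t \subset sg, ~~ (t \subset t0) & N (J :|: t)].

Lemma sg_face : sg \in faces K.
Proof. exact: maxsetp sg_facet. Qed.

Lemma setUD_sg J t : [disjoint J & sg] -> t \subset sg -> (J :|: t) :\: sg = J.
Proof.
move=> Js ts; rewrite finset.setDUl (finset.setDidPl Js).
by have := ts; rewrite -finset.setD_eq0 => /eqP ->; rewrite finset.setU0.
Qed.

Lemma exists_N J : [disjoint J & sg] -> exists2 A, N A & A :\: sg = J.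
Proof.
move=> Js; have [->|/finset.set0Pn[w0 w0J]] := eqVneq J finset.set0.
  by exists finset.set0; rewrite ?finset.set0D.
have [|t [ts _ Nt]] := N_join Js w0J (finset.sub0set sg).
  by rewrite finset.setU0; exact: face_vertex.
by exists (J :|: t); rewrite ?setUD_sg.
Qed.

Let NS := [set A | N A].

Let sub_image : powerset (~: sg) \subset [set A :\: sg | A in NS].
Proof.
apply/fintype.subsetP => J; rewrite powersetE finset.subsets_disjoint finset.setCK => Js.
have [A NA <-] := exists_N Js; apply/imsetP; exists A => //.
by rewrite finset.in_set.
Qed.

Let card_pow : #|powerset (~: sg)| = (2 ^ (m - #|sg|))%N.
Proof. by rewrite card_powerset cardsCs finset.setCK card_ord. Qed.

Lemma card_N_ge : (2 ^ (m - #|sg|) <= #|NS|)%N.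
Proof.
rewrite -card_pow; apply: leq_trans (subset_leq_card sub_image) _.
exact: leq_imset_card.
Qed.

Hypothesis card_N_le : (#|NS| <= 2 ^ (m - #|sg|))%N.

(** Removing [sg] maps the sets in [N] onto all sets disjoint from [sg], and the bound on their
    number leaves no room for two preimages. *)
Lemma N_inj A B : N A -> N B -> A :\: sg = B :\: sg -> A = B.
Proof.
move=> NA NB; have /imset_injP inj : #|[set A :\: sg | A in NS]| == #|NS|.
  rewrite eqn_leq leq_imset_card (leq_trans card_N_le) //.
  by rewrite -card_pow subset_leq_card.
by apply: inj; rewrite finset.in_set.
Qed.

Lemma exists_minimal_nonface s : s \notin faces K ->
  exists M, [/\ M \subset s, M \notin faces K
    & forall t, t \proper M -> t \in faces K].
Proof.
move=> sK; have [M Mmin Ms] := @minset_exists _ (fun t => t \notin faces K) _ sK.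
exists M; split=> //; first exact: minsetp Mmin.
move=> t tM; apply: contraT => tK.
have := minsetinf Mmin tK (fintype.proper_sub tM) => tE.
by rewrite tE fintype.properxx in tM.
Qed.

Lemma taut_structure_exists : exists T, taut_structure T.
Proof.
pose P (w : 'I_m) M := [/\ M \subset w |: sg, M \notin faces K
    & forall t, t \proper M -> t \in faces K].
have exM w : w \notin sg -> exists M, P w M.
  move=> wsg; apply: exists_minimal_nonface; apply: contra wsg => wK.
  rewrite -(maxsetsup sg_facet wK (finset.subsetUr _ _)).
  by rewrite finset.setU11.
pose T w := xget finset.set0 [set M | P w M]%classic :\ w.
have TP w : w \notin sg -> P w (w |: T w).
  move=> wsg; have [M0 PM0] := exM w wsg.
  rewrite /T; case: xgetP => [M _ PM|/(_ M0)/(_ PM0) //]; rewrite finset.setD1K //.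
  have [Msub MK _] := PM; apply: contraNT MK => wM; apply: face_sub sg_face _.
  apply/fintype.subsetP => i iM; have := fintype.subsetP Msub _ iM.
  by rewrite finset.in_setU1 => /orP[/eqP iw|//]; rewrite -iw iM in wM.
have Tsg w : w \notin sg -> T w \subset sg.
  move=> wsg; have [Tsub _ _] := TP w wsg.
  apply/fintype.subsetP => i iT; have := fintype.subsetP Tsub i.
  rewrite !finset.in_setU1 iT orbT => /(_ isT)/orP[/eqP iw|//].
  by move: iT; rewrite /T iw finset.setD11.
exists T; split=> // s; split=> [sK w ws wsg|H].
  apply/negP => Ts; have [_ + _] := TP w wsg; rewrite (face_sub sK) //.
  by rewrite finset.subUset finset.sub1set ws.
apply: contraT => sK; have [M [Ms MK Mmin]] := exists_minimal_nonface sK.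
have NM := N_nonface MK Mmin.
have J0 : M :\: sg != finset.set0.
  rewrite finset.setD_eq0; apply: contra MK => Msg; exact: face_sub sg_face Msg.
have [w wJ] := finset.set0Pn _ J0; have /finset.setDP[wM wsg] := wJ.
(* With a single vertex [w] outside [sg], injectivity identifies [M] with [w |: T w]. *)
have [/eqP/finset.cards1P[v JE]|J1] := eqVneq #|M :\: sg| 1%N.
  have wv : w = v by apply/set1P; rewrite -JE.
  have [_ TK Tmin] := TP w wsg.
  have ME : M = w |: T w.
    apply: N_inj => //; first exact: N_nonface TK Tmin.
    have dw : [disjoint [set w] & sg] by rewrite disjoints1.
    by rewrite JE -wv (setUD_sg dw) ?Tsg.
  have := H w; rewrite (fintype.subsetP Ms) // => /(_ isT wsg) /negP[].
  by apply: fintype.subset_trans Ms; rewrite ME finset.subsetUr.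
have disJ : [disjoint M :\: sg & sg].
  by rewrite -setI_eq0; apply/eqP/setP => i; rewrite !finset.inE; case: (i \in sg); rewrite ?andbF.
(* With several vertices outside [sg], [w] and [M :&: sg] form a proper subset of [M], hence a face.
   [N_join] then gives a set in [N] over [M :\: sg] that differs from [M], as [t] is not inside
   [M :&: sg]. *)
have [||t [tsg tt0 Nt]] := N_join disJ wJ (t0 := M :&: sg).
- exact: finset.subsetIr.
- apply: Mmin; rewrite finset.properEcard finset.subUset finset.sub1set wM finset.subsetIl /=.
  rewrite -(cardsID sg M) addnC; apply: leq_ltn_trans (leq_card_setU _ _) _.
  by rewrite cards1 ltn_add2r ltn_neqAle eq_sym J1 card_gt0.
have ME : M = (M :\: sg) :|: t.
  by apply: N_inj => //; rewrite setUD_sg.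
case/negP: tt0; apply/fintype.subsetP => i it.
by rewrite finset.in_setI (fintype.subsetP tsg) // andbT ME finset.in_setU it orbT.
Qed.

End Counting.

Section Consequences.
Variable T : 'I_m -> {set 'I_m}.
Hypothesis TS : taut_structure T.

(** Equivalently, [J] is the union of the minimal non-faces it contains. Such a [J] is determined by
    its part outside [sg]. *)
Definition taut_full J := J :&: sg == \bigcup_(w in J :\: sg) T w.

Lemma card_taut_full : #|[set J | taut_full J]| = (2 ^ (m - #|sg|))%N.
Proof.
have [Tsg _] := TS.
have Usg A : A \subset ~: sg -> \bigcup_(w in A) T w \subset sg.
  move=> As; apply/bigcupsP => w wA; apply: Tsg.
  by have := fintype.subsetP As _ wA; rewrite finset.in_setC.
have dis A : A \subset ~: sg -> [disjoint A & sg].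
  by rewrite finset.subsets_disjoint finset.setCK.
have -> : [set J | taut_full J] =
    [set A :|: \bigcup_(w in A) T w | A in powerset (~: sg)].
  apply/setP => J; rewrite finset.in_set; apply/eqP/imsetP => [JE|[A]].
    exists (J :\: sg).
      by rewrite powersetE; apply/fintype.subsetP => i; rewrite !inE => /andP[].
    by rewrite -JE finset.setUC -[LHS](finset.setID J sg).
  rewrite powersetE => As ->; rewrite setUD_sg ?dis ?Usg //.
  rewrite finset.setIUl (_ : A :&: sg = finset.set0); last first.
    by apply/eqP; rewrite setI_eq0 dis.
  by rewrite finset.set0U; apply/finset.setIidPl/Usg.
rewrite card_in_imset; first by rewrite card_powerset cardsCs finset.setCK card_ord.
move=> A B; rewrite !powersetE => As Bs AB.
by rewrite -(setUD_sg (dis A As) (Usg A As)) AB setUD_sg ?dis ?Usg.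
Qed.

(** A vertex of [J] that lies in no minimal non-face inside [J] can be added to every face of the
    full subcomplex. *)
Lemma not_full_cone J : ~~ taut_full J ->
  exists v, [/\ v \in J & forall s, s \in full_sub K J -> v |: s \in full_sub K J].
Proof.
have [Tsg TK] := TS.
pose U := \bigcup_(w in J :\: sg | T w \subset J) (w |: T w).
move=> nf; have [v vJ vU] : exists2 v, v \in J & v \notin U.
  apply: contrapT => no; case/negP: nf; rewrite /taut_full finset.eqEsubset.
  have inU v : v \in J -> v \in U.
    by move=> vJ; apply: contraT => vU; case: no; exists v.
  apply/andP; split; apply/fintype.subsetP => v.
    rewrite finset.in_setI => /andP[/inU/finset.bigcupP[w /andP[wJ _]] vw vsg].
    apply/finset.bigcupP; exists w => //; move: vw.
    rewrite finset.in_setU1 => /orP[/eqP vw|//].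
    by move: wJ; rewrite -vw finset.in_setD vsg.
  move=> /finset.bigcupP[w wJ vT]; have := wJ; rewrite finset.in_setD => /andP[wsg wJ'].
  have /finset.bigcupP[w' /andP[]] := inU w wJ'; rewrite finset.in_setD => /andP[w'sg w'J] TJ.
  rewrite finset.in_setU1 => /orP[/eqP ww'|wT]; last first.
    by rewrite (fintype.subsetP (Tsg _ w'sg) _ wT) in wsg.
  by rewrite finset.in_setI ww' in vT *; rewrite (fintype.subsetP TJ) // (fintype.subsetP (Tsg _ w'sg)).
exists v; split=> // s; rewrite !finset.in_set => /andP[sK sJ].
have vsJ : v |: s \subset J by rewrite finset.subUset finset.sub1set vJ.
rewrite vsJ andbT; apply/TK => w wvs wsg; apply/negP => Tvs.
have wJ := fintype.subsetP vsJ _ wvs.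
have vN : v \notin w |: T w.
  apply: contra vU => vw; apply/finset.bigcupP; exists w => //.
  by rewrite finset.in_setD wsg wJ; exact: fintype.subset_trans Tvs vsJ.
move: wvs; rewrite finset.in_setU1 => /orP[/eqP wv|ws].
  by rewrite wv finset.setU11 in vN.
have := (TK s).1 sK w ws wsg; case/negP; apply/fintype.subsetP => i iT.
have := fintype.subsetP Tvs _ iT; rewrite finset.in_setU1 => /orP[/eqP iv|//].
by case/negP: vN; rewrite -iv finset.in_setU1 iT orbT.
Qed.

End Consequences.
End TautStructure.

Lemma mdim_facet m (K : scomplex m) :
  exists2 sg, facet K sg & taut_number K = (2 ^ (m - #|sg|))%N.
Proof.
have [s0 s0max _] := maxset_exists (face_set0 K).
case: (@arg_minnP _ s0 (fun s => maxset (fun t => t \in faces K) s)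
  (fun s : {set 'I_m} => #|s|) s0max) => sg sgmax sgmin.
exists sg => //; rewrite /taut_number; congr (2 ^ _)%N.
rewrite /mdim (_ : \big[minn/m]_(s | _) _ = #|sg|).
  have : (#|sg| <= m)%N by rewrite -[X in (_ <= X)%N]card_ord max_card.
  by lia.
apply/eqP; rewrite eqn_leq; apply/andP; split.
  by rewrite -minEnat -leEnat; apply: bigmin_le_cond.
apply: (big_ind (fun n => #|sg| <= n)%N).
- by rewrite -[X in (_ <= X)%N]card_ord max_card.
- by move=> a b ha hb; rewrite leq_min ha hb.
by move=> s /sgmin.
Qed.

(** * Ranks of boundary matrices *)

Section KernelMatrices.
Variable F : comNzRingType.

(** A matrix given by a kernel on the ambient types: products become sums over sets, and the
    enumerations of faces stay hidden. *)
Definition kmx (X Y : finType) (A : {set X}) (B : {set Y}) (k : X -> Y -> F) :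
  'M[F]_(#|A|, #|B|) := \matrix_(i, j) k (enum_val i) (enum_val j).

Lemma eq_kmx (X Y : finType) (A : {set X}) (B : {set Y}) (k k' : X -> Y -> F) :
  (forall x y, x \in A -> y \in B -> k x y = k' x y) -> kmx A B k = kmx A B k'.
Proof.
by move=> E; apply/matrixP => i j; rewrite !mxE; apply: E; exact: enum_valP.
Qed.

Lemma mul_kmx (X Y Z : finType) (A : {set X}) (B : {set Y}) (C : {set Z})
    (k : X -> Y -> F) (l : Y -> Z -> F) :
  kmx A B k *m kmx B C l = kmx A C (fun x z => \sum_(y in B) k x y * l y z).
Proof.
apply/matrixP => i j; rewrite !mxE [RHS]big_enum_val.
by apply: eq_bigr => b _; rewrite !mxE.
Qed.

Definition kdelta (X : eqType) (x y : X) : F := (x == y)%:R.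

Lemma kmx_delta (X : finType) (A : {set X}) : kmx A A (@kdelta X) = 1%:M.
Proof.
apply/matrixP => i j; rewrite !mxE /kdelta (inj_eq enum_val_inj).
by case: eqP.
Qed.

Lemma sum_deltal (X : finType) (A : {set X}) (f : X -> F) x :
  \sum_(y in A) kdelta x y * f y = if x \in A then f x else 0.
Proof.
case: ifP => xA; last first.
  apply: big1 => y yA; rewrite /kdelta; case: eqP => [e|]; last by rewrite mul0r.
  by rewrite e yA in xA.
rewrite (bigD1 x) //= /kdelta eqxx mul1r big1 ?addr0 // => y /andP[_].
by rewrite eq_sym => /negPf ->; rewrite mul0r.
Qed.

Lemma sum_deltar (X : finType) (A : {set X}) (f : X -> F) x :
  \sum_(y in A) f y * kdelta y x = if x \in A then f x else 0.
Proof.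
rewrite -sum_deltal; apply: eq_bigr => y _.
by rewrite mulrC /kdelta eq_sym.
Qed.

Definition kvec (X : finType) (A : {set X}) (f : X -> F) : 'rV[F]_#|A| :=
  \row_i f (enum_val i).

Lemma mul_kvec (X Y : finType) (A : {set X}) (B : {set Y}) (f : X -> F)
    (k : X -> Y -> F) :
  kvec A f *m kmx A B k = kvec B (fun y => \sum_(x in A) f x * k x y).
Proof.
apply/rowP => j; rewrite !mxE [RHS]big_enum_val.
by apply: eq_bigr => i _; rewrite !mxE.
Qed.

Lemma eq_kvec (X : finType) (A : {set X}) (f g : X -> F) :
  (forall x, x \in A -> f x = g x) <-> kvec A f = kvec A g.
Proof.
split=> [fg|fg x xA]; first by apply/rowP => i; rewrite !mxE fg ?enum_valP.
by have := congr1 (fun u : 'rV_#|A| => u 0 (enum_rank_in xA x)) fg; rewrite !mxE enum_rankK_in.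
Qed.

Lemma kvec_surj (X : finType) (A : {set X}) (u : 'rV[F]_#|A|) :
  exists2 f, forall x, x \notin A -> f x = 0 & u = kvec A f.
Proof.
exists (fun x => \sum_(i | enum_val i == x) u 0 i) => [x xA|].
  apply: big1 => i /eqP ix; move: xA; rewrite -ix.
  by have := enum_valP i => ->.
apply/rowP => i; rewrite mxE (big_pred1 i) // => j.
by rewrite /= (inj_eq enum_val_inj).
Qed.

End KernelMatrices.

Section KernelRanks.
Variable F : fieldType.

Lemma rank_between m n p q (M : 'M[F]_(m, n)) (N : 'M[F]_(p, q)) P Q P' Q' :
  M = P *m N *m Q -> N = P' *m M *m Q' -> \rank M = \rank N.
Proof.
have H a b c d (M1 : 'M[F]_(a, b)) (N1 : 'M[F]_(c, d)) P1 Q1 :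
    M1 = P1 *m N1 *m Q1 -> (\rank M1 <= \rank N1)%N.
  move=> ->; apply: leq_trans (mxrankM_maxl _ _) _; exact: mxrankM_maxr.
by move=> MN NM; apply/eqP; rewrite eqn_leq (H _ _ _ _ _ _ _ _ MN) (H _ _ _ _ _ _ _ _ NM).
Qed.

Definition krestrict (X Y : finType) (A : {set X}) (B : {set Y})
  (k : X -> Y -> F) x y := if (x \in A) && (y \in B) then k x y else 0.

Definition rk (X Y : finType) (k : X -> Y -> F) :=
  \rank (kmx finset.setT finset.setT k).

Lemma eq_rk (X Y : finType) (k k' : X -> Y -> F) :
  (forall x y, k x y = k' x y) -> rk k = rk k'.
Proof. by move=> E; congr (\rank _); apply: eq_kmx. Qed.

Lemma rank_kmx (X Y : finType) (A : {set X}) (B : {set Y}) (k : X -> Y -> F) :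
  \rank (kmx A B k) = rk (krestrict A B k).
Proof.
apply: (rank_between (P := kmx A finset.setT (@kdelta F X))
  (Q := kmx finset.setT B (@kdelta F Y))
  (P' := kmx finset.setT A (@kdelta F X)) (Q' := kmx B finset.setT (@kdelta F Y))).
  rewrite !mul_kmx; apply: eq_kmx => x y xA yB.
  rewrite (eq_bigr (fun y' => krestrict A B k x y' * kdelta F y' y)); last first.
    by move=> y' _; rewrite sum_deltal finset.in_setT.
  by rewrite sum_deltar finset.in_setT /krestrict xA yB.
rewrite !mul_kmx; apply: eq_kmx => x y _ _.
rewrite (eq_bigr (fun y' => (if x \in A then k x y' else 0) * kdelta F y' y)).
  by rewrite sum_deltar /krestrict; case: (x \in A) => //=; case: (y \in B).
by move=> y' _; rewrite sum_deltal.
Qed.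

Lemma rk_tr (X Y : finType) (k : X -> Y -> F) : rk (fun y x => k x y) = rk k.
Proof.
rewrite /rk -mxrank_tr; congr (\rank _).
by apply/matrixP => i j; rewrite !mxE.
Qed.

Lemma rk_inj (X X' : finType) (f : X -> X') (k : X -> X -> F)
    (k' : X' -> X' -> F) (a b : X -> F) : injective f ->
  (forall x, a x != 0) -> (forall x, b x != 0) ->
  (forall x y, k' (f x) (f y) = a x * k x y * b y) ->
  (forall x' y', k' x' y' != 0 -> exists x y, x' = f x /\ y' = f y) ->
  rk k' = rk k.
Proof.
move=> fi a0 b0 E im.
apply: (rank_between
  (P := kmx finset.setT finset.setT (fun x' x => (x' == f x)%:R * a x))
  (Q := kmx finset.setT finset.setT (fun x x' => b x * (x' == f x)%:R))
  (P' := kmx finset.setT finset.setT (fun x x' => (a x)^-1 * (x' == f x)%:R))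
  (Q' := kmx finset.setT finset.setT (fun x' x => (x' == f x)%:R * (b x)^-1))).
  rewrite !mul_kmx; apply: eq_kmx => x' y' _ _.
  have [[x [y [-> ->]]]|no] := EM (exists x y, x' = f x /\ y' = f y).
    rewrite (bigD1 y) //= (bigD1 x) //= !eqxx !mul1r mulr1 big1 => [|x1 /andP[_ x1x]]; last first.
      by rewrite (inj_eq fi) eq_sym (negPf x1x) !mul0r.
    rewrite addr0 big1 ?addr0 ?E // => y1 /andP[_ y1y].
    by rewrite (inj_eq fi) [y == _]eq_sym (negPf y1y) !mulr0.
  have -> : k' x' y' = 0 by apply/eqP; apply: contraT => /im.
  apply/esym/big1 => y _.
  have [yy|_] := eqVneq y' (f y); last by rewrite !mulr0.
  rewrite big1 ?mul0r // => x _.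
  have [xx|_] := eqVneq x' (f x); last by rewrite !mul0r.
  by case: no; exists x, y.
rewrite !mul_kmx; apply: eq_kmx => x y _ _.
rewrite (bigD1 (f y)) //= (bigD1 (f x)) //= !eqxx mulr1 mul1r big1 => [|x1 /andP[_ x1x]]; last first.
  by rewrite (negPf x1x) !(mulr0, mul0r).
rewrite addr0 big1 => [|y1 /andP[_ y1y]]; last first.
  by rewrite (negPf y1y) !(mulr0, mul0r).
by rewrite E addr0 -!mulrA mulKf // divff ?b0 // mulr1.
Qed.

(** Rows with different labels live on disjoint sets of columns, so the row spaces of the blocks
    form a direct sum. *)
Lemma rk_blocks (X Y C : finType) (k : X -> Y -> F) (lab : X -> C)
    (lab' : Y -> C) :
  (forall x y, k x y != 0 -> lab x = lab' y) ->
  rk k = (\sum_c rk (fun x y => if lab x == c then k x y else 0%R))%N.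
Proof.
move=> kl; pose M c := kmx finset.setT finset.setT
  (fun x y => if lab x == c then k x y else 0).
pose E c : 'M[F]_#|[set: Y]| := kmx finset.setT finset.setT
  (fun y y' => (lab' y == c)%:R * kdelta F y y').
have kl0 x y : lab x != lab' y -> k x y = 0.
  by move=> H; apply/eqP; apply: contraNT H => /kl ->.
have ME c d : M c *m E d = if c == d then M c else 0.
  rewrite /M /E mul_kmx; case: (eqVneq c d) => [->|cd].
    apply: eq_kmx => x y _ _.
    rewrite (eq_bigr (fun y' => ((if lab x == d then k x y' else 0) *
      (lab' y' == d)%:R) * kdelta F y' y)) => [|y' _]; last by rewrite mulrA.
    rewrite sum_deltar finset.in_setT; case: (eqVneq (lab x) d) => [xd|]; last by rewrite mul0r.
    by have [|yd] := eqVneq (lab' y) d; rewrite ?mulr1 ?mulr0 // kl0 // xd eq_sym.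
  apply/matrixP => i j; rewrite !mxE; apply: big1 => y _.
  case: (eqVneq (lab _) c) => [xc|]; last by rewrite mul0r.
  have [yd|] := eqVneq (lab' y) d; last by rewrite mul0r mulr0.
  by rewrite kl0 ?mul0r // xc yd.
have sumM : kmx finset.setT finset.setT k = \sum_c M c.
  apply/matrixP => i j; rewrite summxE mxE (bigD1 (lab (enum_val i))) //=.
  rewrite mxE eqxx big1 ?addr0 // => c; rewrite eq_sym => /negPf H.
  by rewrite mxE H.
have dir : mxdirect (\sum_c << M c >>)%MS.
  apply/mxdirect_sumsP => c _; apply/eqP; rewrite -submx0; apply/rV_subP => v.
  rewrite sub_capmx genmxE => /andP[/submxP[w vw] /sub_sumsmxP[u vu]].
  have v1 : v *m E c = v by rewrite vw -mulmxA ME eqxx.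
  rewrite -v1 vu mulmx_suml big1 ?sub0mx // => d /= dc.
  have /submxP[g ->] : (<< M d >> <= M d)%MS by rewrite genmxE.
  by rewrite -!mulmxA ME (negPf dc) !mulmx0.
have eqs : ((\sum_c M c)%R :=: (\sum_c << M c >>)%MS)%MS.
  apply/eqmxP/andP; split.
    by apply: summx_sub => c _; rewrite (sumsmx_sup c) // genmxE.
  apply/sumsmx_subP => c _; rewrite genmxE; apply/submxP.
  exists (kmx finset.setT finset.setT (fun x x' => (lab x == c)%:R * kdelta F x x')).
  rewrite -sumM mul_kmx; apply: eq_kmx => x y _ _.
  under eq_bigr do rewrite -mulrA.
  rewrite -mulr_sumr sum_deltal finset.in_setT.
  by case: ifP; rewrite ?mul1r ?mul0r.
rewrite /rk sumM eqs (mxdirectP dir) /=.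
by apply: eq_bigr => c _; rewrite genmxE.
Qed.

End KernelRanks.

(** * The whole differential of a convex family of faces *)

Section Boundary.
Variables (F : fieldType) (m : nat).
Implicit Types (s t r J M : {set 'I_m}) (u v w : 'I_m) (L A B : {set {set 'I_m}}).

Definition sgn (R : pzRingType) v s : R := (-1) ^+ #|[set w in s | (w < v)%N]|.

Lemma sgn_sq (R : pzRingType) v s : sgn R v s * sgn R v s = 1.
Proof. by rewrite -expr2 sqrr_sign. Qed.

Lemma sgn_neq0 v s : sgn F v s != 0.
Proof. by rewrite signr_eq0. Qed.

Lemma sgnD1 (R : pzRingType) u v s : v \in s ->
  sgn R u (s :\ v) = (-1) ^+ (v < u)%N * sgn R u s.
Proof.
move=> vs; rewrite /sgn [in RHS](cardsD1 v) finset.in_set vs /=.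
have -> : [set w in s | (w < u)%N] :\ v = [set w in s :\ v | (w < u)%N].
  by apply/setP => w; rewrite !finset.inE andbA.
by rewrite exprD mulrA -expr2 sqrr_sign mul1r.
Qed.

Lemma sgn_self (R : pzRingType) v s : v \in s -> sgn R v (s :\ v) = sgn R v s.
Proof. by move=> vs; rewrite sgnD1 // ltnn mul1r. Qed.

Lemma sgn_swap (R : comPzRingType) u v s : u \in s -> v \in s -> u != v ->
  sgn R v s * sgn R u (s :\ v) = - (sgn R u s * sgn R v (s :\ u)).
Proof.
move=> us vs uv; rewrite !sgnD1 //.
have -> : (u < v)%N = ~~ (v < u)%N.
  by rewrite ltnNge leq_eqVlt [(v == u :> nat)]eq_sym (negPf (_ : u != v :> nat)).
by case: (v < u)%N => /=; rewrite ?expr0 ?expr1; ring.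
Qed.

(** The form in which squares of differentials vanish. In characteristic 2 antisymmetry says nothing
    on the diagonal, hence the second hypothesis. *)
Lemma sum_antisym (V : zmodType) (P : 'I_m -> 'I_m -> V) :
  (forall u v, P u v = - P v u) -> (forall u, P u u = 0) ->
  \sum_u \sum_v P u v = 0.
Proof.
move=> anti diag.
have -> : \sum_u \sum_v P u v =
    \sum_(u < m) \sum_(v < m) (if (u < v)%N then P u v else 0) +
    \sum_(u < m) \sum_(v < m) (if (v < u)%N then P u v else 0).
  rewrite -big_split; apply: eq_bigr => u _; rewrite -big_split.
  apply: eq_bigr => v _; case: ltngtP => [|uv|uv] /=; rewrite ?addr0 ?add0r //.
  by rewrite (val_inj uv : u = v) diag.
rewrite [X in _ + X]exchange_big /= -big_split /= big1 // => u _.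
rewrite -big_split /= big1 // => v _.
by case: ifP => _; rewrite ?addr0 // anti addNr.
Qed.

Definition kbound s t : F := \sum_(v in s | s :\ v == t) sgn F v s.

Lemma sum_kbound s (f : {set 'I_m} -> F) (P : pred {set 'I_m}) :
  \sum_(t | P t) kbound s t * f t =
  \sum_(v in s) if P (s :\ v) then sgn F v s * f (s :\ v) else 0.
Proof.
under eq_bigr do rewrite /kbound mulr_suml.
rewrite (exchange_big_dep (fun v => v \in s)) /=; last by move=> t v _ /andP[].
apply: eq_bigr => v vs; case: ifP => Pv; last first.
  by apply: big1 => t /andP[Pt /andP[_ /eqP tE]]; rewrite -tE Pv in Pt.
rewrite (big_pred1 (s :\ v)) // => t; rewrite vs /= eq_sym.
by have [->|] := eqVneq t (s :\ v); rewrite ?Pv ?andbF.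
Qed.

Lemma kbound_neq0 s t : kbound s t != 0 -> exists2 v, v \in s & t = s :\ v.
Proof.
move=> k0; apply: contrapT => no; case/eqP: k0; apply: big1 => v /andP[vs /eqP tE].
by case: no; exists v.
Qed.

Lemma kboundD1 s v : v \in s -> kbound s (s :\ v) = sgn F v s.
Proof.
move=> vs; rewrite /kbound (big_pred1 v) // => u.
have [->|uv] := eqVneq u v; first by rewrite vs /= !eqxx.
rewrite /= (negPf uv); apply/negbTE/negP => /andP[us /eqP/setP/(_ u)].
by rewrite !finset.inE eqxx uv us.
Qed.

Lemma kbound_kbound s t : \sum_r kbound s r * kbound r t = 0.
Proof.
rewrite (@sum_kbound s (kbound^~ t) xpredT) big_mkcond /=.
pose P v u : F := if [&& v \in s, u \in s, u != v & s :\ v :\ u == t]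
  then sgn F v s * sgn F u (s :\ v) else 0.
rewrite (eq_bigr (fun v => \sum_u P v u)).
  apply: sum_antisym => [u v|u]; last by rewrite /P eqxx !andbF.
  rewrite /P; have -> : s :\ v :\ u = s :\ u :\ v.
    by apply/setP => w; rewrite !finset.inE; case: (w == u); case: (w == v).
  rewrite [v == u]eq_sym; case: (boolP (u \in s)) => us; case: (boolP (v \in s)) => vs /=;
    rewrite ?oppr0 //.
  have [|uv] := eqVneq u v; first by rewrite oppr0.
  by case: ifP => _; rewrite ?oppr0 //= sgn_swap // eq_sym.
move=> v _; case: ifP => vs; last by rewrite big1 // => u _; rewrite /P vs.
rewrite /kbound mulr_sumr big_mkcond /=; apply: eq_bigr => u _.
rewrite /P vs /= !finset.inE.
by case: (u != v); case: (u \in s).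
Qed.

(* Intersections of a down-closed and an up-closed family: the spans of these
   families are subquotients of the chain complex of the full simplex. *)
Definition convex L :=
  forall s r t, s \in L -> t \in L -> t \subset r -> r \subset s -> r \in L.

Lemma kbound_kbound_in L s t : convex L -> s \in L -> t \in L ->
  \sum_(r in L) kbound s r * kbound r t = 0.
Proof.
move=> cL sL tL; rewrite -[RHS](kbound_kbound s t) [LHS]big_mkcond.
apply: eq_bigr => r _; case: ifP => // /negbT rL; apply/esym/eqP.
rewrite mulf_eq0; apply: contraNT rL; rewrite negb_or.
move=> /andP[/kbound_neq0[v vs ->] /kbound_neq0[w _ tE]].
apply: cL sL tL _ _; last exact: finset.subD1set.
by rewrite tE; exact: finset.subD1set.
Qed.

Definition brank L := \rank (kmx L L kbound).

Lemma rank_boundary L k : \rank (@boundary F m L k) =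
  rk (krestrict (faces_card L k) (faces_card L k.-1) kbound).
Proof. by rewrite -rank_kmx. Qed.

Lemma in_faces_card L k s : (s \in faces_card L k) = (s \in L) && (#|s| == k).
Proof. by rewrite finset.in_set. Qed.

Lemma rank_boundary_oob L k : (m < k)%N -> \rank (@boundary F m L k) = 0%N.
Proof.
move=> mk; have : #|faces_card L k| = 0%N.
  apply/eqP; rewrite cards_eq0; apply/eqP/setP => s; rewrite in_faces_card finset.inE.
  apply/negbTE/negP => /andP[_ /eqP sk].
  by have := max_card (mem s); rewrite sk card_ord leqNgt mk.
by move=> c0; apply/eqP; rewrite -leqn0 -c0 rank_leq_row.
Qed.

Lemma rank_boundary0 L : \rank (@boundary F m L 0) = 0%N.
Proof.
apply/eqP; rewrite mxrank_eq0; apply/eqP/matrixP => a b; rewrite !mxE.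
apply: big1 => v /andP[va _]; exfalso.
have := enum_valP a; rewrite in_faces_card => /andP[_ /eqP/cards0_eq e].
by move: va; rewrite /face_of e finset.inE.
Qed.

Lemma brank_sum L : brank L = (\sum_(k < m.+1) \rank (@boundary F m L k))%N.
Proof.
have card_lt s : (#|s| < m.+1)%N by rewrite ltnS -[X in (_ <= X)%N](card_ord m) max_card.
(* Faces are labelled by size as rows and by size plus 1 as columns. The default of [inord] concerns
   only a column of size m, which is a facet of nothing. *)
rewrite /brank rank_kmx (rk_blocks (lab := fun s => Ordinal (card_lt s))
  (lab' := fun t => inord #|t|.+1)).
  apply: eq_bigr => k _; rewrite rank_boundary; apply: eq_rk => s t.
  rewrite /krestrict !in_faces_card -val_eqE /=.
  case: (boolP (s \in L)) => sL; case: (boolP (t \in L)) => tL //=;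
    rewrite ?andbF /=; try by case: ifP.
  have [sk|sk] //= := eqVneq #|s| k.
  case: eqP => // tk; apply/eqP; apply: contraT => /kbound_neq0[v vs tE].
  by case: tk; rewrite tE -sk (cardsD1 v s) vs.
move=> s t; rewrite /krestrict; case: ifP => _; last by rewrite eqxx.
move=> /kbound_neq0[v vs ->]; apply: val_inj; rewrite /= inordK.
  by rewrite (cardsD1 v s) vs.
by rewrite ltnS -[X in (_ <= X)%N](card_ord m) (leq_trans _ (max_card (mem s))) // (cardsD1 v s) vs.
Qed.

Lemma rank_boundaryS L k : convex L ->
  (\rank (@boundary F m L k) + \rank (@boundary F m L k.+1) <= #|faces_card L k|)%N.
Proof.
move=> cL; rewrite addnC; apply: mulmx0_rank_max.
rewrite (_ : @boundary F m L k.+1 = kmx (faces_card L k.+1) (faces_card L k) kbound) //.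
rewrite (_ : @boundary F m L k = kmx (faces_card L k) (faces_card L k.-1) kbound) //.
rewrite mul_kmx; apply/matrixP => i j; rewrite !mxE.
have := enum_valP i; have := enum_valP j; rewrite !in_faces_card.
move: (enum_val i) (enum_val j) => s t /andP[tL _] /andP[sL /eqP sk].
rewrite -[RHS](kbound_kbound_in cL sL tL) big_mkcond [RHS]big_mkcond /=.
apply: eq_bigr => r _; rewrite in_faces_card; case rL: (r \in L) => //=.
case: eqP => // rk; apply/esym/eqP; rewrite mulf_eq0 -[_ == _]negbK.
apply/orP; left; apply/negP => /kbound_neq0[v vs rE].
by case: rk; move: sk; rewrite rE (cardsD1 v s) vs => -[].
Qed.

(** Each boundary rank is lost twice, once from the chains to the cycles and once from the cycles to
    the homology. The additive form avoids truncated subtraction and shows the parity of the total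
    Betti number. *)
Lemma rhomology_rankE L : convex L ->
  (rhomology_rank F L + 2 * brank L = #|L|)%N.
Proof.
move=> cL.
have -> : #|L| = (\sum_(k < m.+1) #|faces_card L k|)%N.
  rewrite -sum1_card (partition_big (fun s => inord #|s| : 'I_m.+1) xpredT) //=.
  apply: eq_bigr => k _; rewrite -sum1_card; apply: eq_bigl => s.
  rewrite in_faces_card -val_eqE /= inordK //.
  by rewrite ltnS -[X in (_ <= X)%N](card_ord m) max_card.
have -> : (2 * brank L = \sum_(k < m.+1) \rank (@boundary F m L k) +
    \sum_(k < m.+1) \rank (@boundary F m L k.+1))%N.
  rewrite mul2n -addnn {1}brank_sum brank_sum; congr addn.
  rewrite big_ord_recl rank_boundary0 add0n [RHS]big_ord_recr /=.
  by rewrite rank_boundary_oob // addn0.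
rewrite /rhomology_rank -!big_split /=; apply: eq_bigr => k _.
rewrite /rhomology_dim mxrank_ker; rewrite -subnDA subnK //.
exact: rank_boundaryS.
Qed.

(* rank-nullity form of the long exact sequence of a block triangular
   differential *)
Lemma rank_block_nilpotent p q (P : 'M[F]_p) (X : 'M[F]_(p, q)) (Q : 'M[F]_q) :
  P *m P = 0 -> P *m X + X *m Q = 0 ->
  (\rank (block_mx P X 0 Q) + \rank P <= p + \rank Q)%N.
Proof.
(* [Z] works modulo the row space of [Q]. The product with it has the rank of [Y], which is bounded
   because [P] kills [Y] on the left, and the rank lost is at most that of the kernel of [Z], namely
   the rank of [Q]. *)
move=> PP PX; pose C := cokermx Q; pose Z := block_mx (1%:M : 'M[F]_p) 0 0 C.
pose Y := row_mx P (X *m C).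
have WZ : block_mx P X 0 Q *m Z = col_mx Y 0.
  rewrite mulmx_block !(mulmx1, mulmx0) !addr0 !add0r mulmx_coker.
  by rewrite block_mxEv row_mx0.
have PY : P *m Y = 0.
  rewrite mul_mx_row PP mulmxA (_ : P *m X = - (X *m Q)); last by apply/eqP; rewrite -addr_eq0 PX.
  by rewrite mulNmx -mulmxA mulmx_coker mulmx0 oppr0 row_mx0.
have rY := mulmx0_rank_max PY.
have rZ : \rank (kermx Z) = \rank Q.
  rewrite mxrank_ker rank_diag_block_mx mxrank1 mxrank_coker.
  have := rank_leq_col Q; lia.
have := mxrank_mul_ker (block_mx P X 0 Q) Z; rewrite WZ.
have : \rank (col_mx Y (0 : 'M[F]_(q, p + q))) = \rank Y.
  exact: rank_col_mx0.
have := mxrankS (capmxSr (block_mx P X 0 Q) (kermx Z)); rewrite rZ; lia.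
Qed.

(** [A] spans a subcomplex with quotient [B]; this is the portion H(B) -> H(A) -> H(L) of the long
    exact sequence. *)
Lemma rhomology_rank_sub L A B : convex L -> A :|: B = L -> [disjoint A & B] ->
  (forall s t, s \in A -> t \in L -> t \subset s -> t \in A) ->
  (rhomology_rank F A <= rhomology_rank F L + rhomology_rank F B)%N.
Proof.
move=> cL ABL dAB dA.
have AL s : s \in A -> s \in L by rewrite -ABL finset.in_setU => ->.
have BL s : s \in B -> s \in L by rewrite -ABL finset.in_setU => ->; rewrite orbT.
have cA : convex A by move=> s r t sA tA tr rs; apply: dA sA (cL _ _ _ (AL _ sA) (AL _ tA) tr rs) rs.
have cB : convex B.
  move=> s r t sB tB tr rs; have := cL _ _ _ (BL _ sB) (BL _ tB) tr rs.
  rewrite -ABL finset.in_setU => /orP[rA|//].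
  by have := dA _ _ rA (BL _ tB) tr; rewrite (disjointFl dAB tB).
have sumL (f : {set 'I_m} -> F) :
    \sum_(r in L) f r = \sum_(r in B) f r + \sum_(r in A) f r.
  rewrite -bigU /=; last by rewrite disjoint_sym.
  by apply: eq_bigl => r; rewrite -ABL finset.setUC finset.in_setU.
have k0 s t : s \in A -> t \in B -> kbound s t = 0.
  move=> sA tB; apply/eqP; apply: contraT => /kbound_neq0[v vs tE].
  have := dA s t sA (BL _ tB); rewrite tE (finset.subD1set s v) -tE => /(_ isT).
  by rewrite (disjointFl dAB tB).
pose P := kmx B B kbound; pose X := kmx B A kbound; pose Q := kmx A A kbound.
have PP : P *m P = 0.
  rewrite mul_kmx; apply/matrixP => i j; rewrite !mxE.
  by apply: kbound_kbound_in => //; exact: enum_valP.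
have PX : P *m X + X *m Q = 0.
  rewrite !mul_kmx; apply/matrixP => i j; rewrite !mxE -sumL.
  by apply: kbound_kbound_in => //; [apply: BL|apply: AL]; exact: enum_valP.
have := rank_block_nilpotent PP PX.
have <- : brank L = \rank (block_mx P X 0 Q).
  pose V := col_mx (kmx B L (@kdelta F _)) (kmx A L (@kdelta F _)).
  pose U := row_mx (kmx L B (@kdelta F _)) (kmx L A (@kdelta F _)).
  have UV : U *m V = 1%:M.
    rewrite mul_row_col !mul_kmx -kmx_delta; apply/matrixP => i j; rewrite !mxE -sumL.
    by rewrite sum_deltal enum_valP.
  have VDU : V *m kmx L L kbound *m U = block_mx P X 0 Q.
    have E (S S' : {set {set 'I_m}}) : {subset S <= L} -> {subset S' <= L} ->
        kmx S L (@kdelta F _) *m kmx L L kbound *m kmx L S' (@kdelta F _) = kmx S S' kbound.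
      move=> SL S'L; rewrite !mul_kmx; apply: eq_kmx => s t sS tS.
      rewrite (eq_bigr (fun r => kbound s r * kdelta F r t)) => [|r _]; last first.
        by rewrite sum_deltal SL.
      by rewrite sum_deltar S'L.
    rewrite mul_col_mx mul_col_row !E // [X in block_mx _ _ X _](_ : _ = 0) //.
    by apply/matrixP => i j; rewrite !mxE k0 ?enum_valP.
  apply: (rank_between (P := U) (Q := V) (P' := V) (Q' := U)) => //.
  by rewrite -VDU !mulmxA UV mul1mx -mulmxA UV mulmx1.
have := rhomology_rankE cL; have := rhomology_rankE cA; have := rhomology_rankE cB.
have : #|L| = (#|A| + #|B|)%N by rewrite -ABL cardsU disjoint_setI0 // cards0 subn0.
rewrite -[\rank P]/(brank B) -[\rank Q]/(brank A); lia.
Qed.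

End Boundary.

(** * Upper and lower bounds for total Betti numbers *)

Section HomologyBounds.
Variables (F : fieldType) (m : nat).
Implicit Types (s t r J M U : {set 'I_m}) (v w : 'I_m).
Implicit Types (L A B : {set {set 'I_m}}) (Gs : seq {set 'I_m}).

Definition avoiding M Gs U : {set {set 'I_m}} :=
  [set s : {set 'I_m} | [&& M \subset s, s \subset U & all (fun N : {set 'I_m} => ~~ (N \subset s)) Gs]].

Lemma in_avoiding M Gs U s : (s \in avoiding M Gs U) =
  [&& M \subset s, s \subset U & all (fun N : {set 'I_m} => ~~ (N \subset s)) Gs].
Proof. by rewrite finset.in_set. Qed.

Lemma avoiding_convex M Gs U : convex (avoiding M Gs U).
Proof.
move=> s r t; rewrite !in_avoiding => /and3P[_ sU /allP sG] /and3P[Mt _ _] tr rs.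
rewrite (fintype.subset_trans Mt tr) (fintype.subset_trans rs sU).
by apply/allP => N /sG; apply: contra => Nr; exact: fintype.subset_trans rs.
Qed.

Lemma down_closed_convex L : down_closed L -> convex L.
Proof. by move=> dL s r t sL _ _ rs; exact: dL sL rs. Qed.

(** Deleting [v] pairs the members with [v] and those without. Between the two halves the
    differential is a signed permutation matrix, so its rank is at least half of [#|L|]. *)
Lemma rhomology_rank_cone L v : convex L ->
  (forall s, (v |: s \in L) = (s :\ v \in L)) -> rhomology_rank F L = 0%N.
Proof.
move=> cL cone; have bE := rhomology_rankE F cL.
pose V := [set s : {set 'I_m} | v \in s]; pose B := L :&: V; pose A := L :\: V.
have LAB : (#|B| + #|A| = #|L|)%N by exact: cardsID.
have inB s : (s \in B) = (s \in L) && (v \in s) by rewrite !finset.inE.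
have inA s : (s \in A) = (s \in L) && (v \notin s) by rewrite !finset.inE andbC.
have BA s : s \in B -> s :\ v \in A.
  rewrite inB inA finset.setD11 andbT -cone => /andP[sL vs].
  by rewrite (_ : v |: s = s) //; apply/finset.setUidPr; rewrite finset.sub1set.
have AB s : s \in A -> v |: s \in B.
  rewrite inB inA finset.setU11 andbT cone => /andP[sL vs].
  by rewrite (_ : s :\ v = s) //; apply/finset.setDidPl; rewrite disjoint_sym disjoints1.
have cAB : (#|A| <= #|B|)%N.
  rewrite -(card_in_imset (f := fun s => v |: s) (D := A)); last first.
    move=> s t; rewrite !inA => /andP[_ vs] /andP[_ vt] E.
    by rewrite -(finset.setU1K vs) E finset.setU1K.
  by apply/subset_leq_card/fintype.subsetP => _ /imsetP[s /AB sB ->].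
have rB : (#|B| <= brank F L)%N.
  have KB : kmx B A (@kbound F m) *m
      kmx A B (fun t s => (s == v |: t)%:R * sgn F v s) = 1%:M.
    rewrite mul_kmx -kmx_delta; apply: eq_kmx => s s' sB s'B.
    have := sB; rewrite inB => /andP[_ vs]; have := s'B; rewrite inB => /andP[_ vs'].
    rewrite (bigD1 (s' :\ v)) ?BA //= finset.setD1K // eqxx mul1r.
    rewrite big1 => [|t /andP[tA ts]]; last first.
      case: eqP => [e|]; last by rewrite mul0r mulr0.
      by case/eqP: ts; rewrite e finset.setU1K //; move: tA; rewrite inA => /andP[].
    rewrite addr0 /kdelta; have [->|ss'] := eqVneq s s'.
      by rewrite kboundD1 // sgn_sq.
    apply/eqP; rewrite mulf_eq0; apply/orP; left; apply: contraT.
    move=> /kbound_neq0[u us E]; case/eqP: ss'.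
    have uv : u = v.
      apply/eqP; apply: contraT => uv; have : v \in s' :\ v.
        by rewrite E finset.in_setD1 vs eq_sym uv.
      by rewrite finset.setD11.
    by rewrite -(finset.setD1K vs) -(finset.setD1K vs') E uv.
  have KL : kmx B A (@kbound F m) =
      kmx B L (@kdelta F _) *m kmx L L (@kbound F m) *m kmx L A (@kdelta F _).
    rewrite !mul_kmx; apply: eq_kmx => s t; rewrite inA inB => /andP[sL _] /andP[tL _].
    rewrite (eq_bigr (fun r => kbound F s r * kdelta F r t)) => [|r _]; last first.
      by rewrite sum_deltal sL.
    by rewrite sum_deltar tL.
  rewrite -[#|B|](mxrank1 F) -KB; apply: leq_trans (mxrankM_maxl _ _) _.
  rewrite KL; apply: leq_trans (mxrankM_maxl _ _) _; exact: mxrankM_maxr.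
lia.
Qed.

(* For M = set0, the number of symbols of degree U in the Taylor resolution of
   the ideal generated by the monomials of Gs. *)
Fixpoint taylor M Gs U : nat :=
  if Gs is N :: Gs' then (taylor M Gs' U + taylor (M :|: N) Gs' U)%N
  else (M == U)%N.

(** Forbidding one more set [N] passes to a subcomplex whose quotient consists of the sets
    containing [N], so [rhomology_rank_sub] follows the recursion of [taylor]. The remaining
    interval from [M] to [U] is a cone, or empty, unless [M = U]. *)
Lemma rhomology_rank_taylor M Gs U :
  (rhomology_rank F (avoiding M Gs U) <= taylor M Gs U)%N.
Proof.
elim: Gs M => [|N Gs IH] M; last first.
  apply: leq_trans (leq_add (IH M) (IH (M :|: N))).
  have inN s : (s \in avoiding (M :|: N) Gs U) = (s \in avoiding M Gs U) && (N \subset s).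
    by rewrite !in_avoiding finset.subUset; case: (M \subset s); case: (N \subset s); rewrite ?andbF ?andbT.
  have inN' s : (s \in avoiding M (N :: Gs) U) = (s \in avoiding M Gs U) && ~~ (N \subset s).
    by rewrite !in_avoiding /=; case: (M \subset s); case: (N \subset s); rewrite ?andbF ?andbT.
  apply: rhomology_rank_sub; first exact: avoiding_convex.
  - apply/setP => s; rewrite finset.in_setU inN inN'.
    by case: (s \in _); case: (N \subset s).
  - rewrite -setI_eq0; apply/eqP/setP => s; rewrite finset.in_setI inN inN' finset.in_set0.
    by case: (N \subset s); rewrite !andbF.
  move=> s t; rewrite !inN' => /andP[_ Ns] -> ts /=.
  by apply: contra Ns => Nt; exact: fintype.subset_trans Nt ts.
have cX := @avoiding_convex M [::] U.
have [->|MU] /= := eqVneq M U.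
  have := rhomology_rankE F (@avoiding_convex U [::] U).
  have -> : avoiding U [::] U = [set U].
    by apply/setP => s; rewrite in_avoiding finset.inE andbT finset.eqEsubset andbC.
  by rewrite cards1 eqxx => E; rewrite -[X in (_ <= X)%N]E leq_addr.
have [MsU|MsU] := boolP (M \subset U); last first.
  have := rhomology_rankE F cX.
  have -> : avoiding M [::] U = finset.set0.
    apply/setP => s; rewrite in_avoiding finset.inE andbT; apply/negbTE.
    by apply: contra MsU => /andP[]; exact: fintype.subset_trans.
  by rewrite cards0 => /eqP; rewrite addn_eq0 => /andP[/eqP ->].
have /properP[_ [v vU vM]] : M \proper U by rewrite finset.properEneq MU.
rewrite (rhomology_rank_cone (v := v)) // => s.
rewrite !in_avoiding !andbT; congr (_ && _).
  rewrite finset.subsetD1 vM andbT -finset.subDset (_ : M :\: [set v] = M) //.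
  by apply/finset.setDidPl; rewrite disjoint_sym disjoints1.
by rewrite finset.subUset finset.sub1set vU /= finset.subDset (finset.setUidPr _) ?finset.sub1set.
Qed.

(** The number of proper subsets of a non-empty set is odd, and by [rhomology_rankE] the total Betti
    number has the same parity. *)
Lemma rhomology_rank_proper_neq0 M L : M != finset.set0 ->
  L = [set s : {set 'I_m} | s \proper M] -> rhomology_rank F L != 0%N.
Proof.
move=> M0 LE; have dL : down_closed L.
  by rewrite LE => s t; rewrite !finset.in_set => sM ts; exact: fintype.sub_proper_trans ts sM.
have := rhomology_rankE F (down_closed_convex dL).
have : #|L|.+1 = (2 ^ #|M|)%N.
  rewrite -card_powerset (cardsD1 M (powerset M)) powersetE fintype.subxx add1n; congr _.+1.
  apply: eq_card => s; rewrite LE finset.in_set finset.properEneq finset.in_setD1 powersetE.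
  by [].
rewrite -card_gt0 in M0; case: #|M| M0 => // n _; rewrite expnS; lia.
Qed.

(* Classes of increasing degree cannot all die: z_t = t - \sum +- c_(t - v) is
   a cycle of X t, so it bounds some c_t, up to t = sg, where the coefficient
   of sg is 1. *)
Lemma acyclic_zigzag (sg : {set 'I_m}) (X : {set 'I_m} -> {set {set 'I_m}}) :
  (forall t, down_closed (X t)) ->
  (forall t t', t \subset t' -> t' \subset sg -> X t \subset X t') ->
  (forall t, t \subset sg -> t \in X t) ->
  (forall t, t \subset sg -> rhomology_rank F (X t) = 0%N) ->
  (forall v, v \in sg -> sg \notin X (sg :\ v)) ->
  exists2 s, s \in X sg & sg \proper s.
Proof.
move=> dX mX tX acX sgX.
pose bd (c : {set 'I_m} -> F) t := \sum_s c s * kbound F s t.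
have exact_X t (z : {set 'I_m} -> F) : t \subset sg ->
    (forall s, s \notin X t -> z s = 0) -> (forall s, bd z s = 0) ->
    exists c, (forall s, s \notin X t -> c s = 0) /\ forall s, bd c s = z s.
  move=> tsg zX bz; pose D := kmx (X t) (X t) (@kbound F m).
  have cX := down_closed_convex (dX t).
  have DD : (D <= kermx D)%MS.
    apply/sub_kermxP; rewrite mul_kmx; apply/matrixP => i j; rewrite !mxE.
    by apply: kbound_kbound_in => //; exact: enum_valP.
  (* Acyclicity makes the rank of [D] half of [#|X t|], so image and kernel have equal dimension. *)
  have kD : (kermx D <= D)%MS.
    rewrite -(mxrank_leqif_sup DD) mxrank_ker.
    have := rhomology_rankE F cX; rewrite acX // /brank -/D; lia.
  have sumX (c : {set 'I_m} -> F) s : (forall s, s \notin X t -> c s = 0) ->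
      bd c s = \sum_(r in X t) c r * kbound F r s.
    move=> c0; rewrite [RHS]big_mkcond; apply: eq_bigr => r _.
    by case: ifP => // /negbT/c0 ->; rewrite mul0r.
  have /sub_kermxP : kvec (X t) z *m D = 0.
    rewrite mul_kvec; apply/rowP => j; rewrite !mxE -sumX //; exact: bz.
  move=> /submx_trans/(_ kD)/submxP[w]; have [c c0 ->] := kvec_surj w.
  rewrite mul_kvec => /eq_kvec zc; exists c; split=> // s; rewrite sumX //.
  have [sX|sX] := boolP (s \in X t); first by rewrite zc.
  rewrite zX // big1 // => r rX; apply/eqP; rewrite mulf_eq0; apply/orP; right.
  apply: contraT => /kbound_neq0[v vr sE]; case/negP: sX.
  by apply: dX rX _; rewrite sE finset.subD1set.
pose z (c : {set 'I_m} -> {set 'I_m} -> F) t s :=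
  kdelta F t s - \sum_(v in t) sgn F v t * c (t :\ v) s.
have bdz (c : {set 'I_m} -> {set 'I_m} -> F) t s :
    (forall v s, v \in t -> bd (c (t :\ v)) s = z c (t :\ v) s) -> bd (z c t) s = 0.
  move=> H; rewrite /bd /z; under eq_bigr do rewrite mulrBl.
  rewrite sumrB (eq_bigl (fun r => r \in finset.setT)) => [|r]; last by rewrite finset.in_setT.
  rewrite sum_deltal finset.in_setT.
  under eq_bigr do rewrite mulr_suml.
  rewrite exchange_big /=.
  rewrite (eq_bigr (fun v => sgn F v t * z c (t :\ v) s)); last first.
    by move=> v vt; rewrite -H // /bd mulr_sumr; apply: eq_bigr => r _; rewrite mulrA.
  rewrite /z; under eq_bigr do rewrite mulrBr; rewrite sumrB opprB.
  have -> : \sum_(v in t) sgn F v t * kdelta F (t :\ v) s = kbound F t s.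
    rewrite /kbound [RHS]big_mkcondr; apply: eq_bigr => v _; rewrite /kdelta.
    by case: eqP; rewrite ?mulr1 ?mulr0.
  rewrite addrCA subrr addr0.
  pose P v u : F := if [&& v \in t, u \in t & u != v]
    then sgn F v t * (sgn F u (t :\ v) * c (t :\ v :\ u) s) else 0.
  rewrite big_mkcond (eq_bigr (fun v => \sum_u P v u)).
    apply: sum_antisym => [u v|u]; last by rewrite /P eqxx !andbF.
    rewrite /P; have -> : t :\ v :\ u = t :\ u :\ v.
      by apply/setP => w; rewrite !finset.inE; case: (w == u); case: (w == v).
    rewrite [v == u]eq_sym; case: (boolP (u \in t)) => us; case: (boolP (v \in t)) => vs /=;
      rewrite ?oppr0 //.
    have [|uv] := eqVneq u v; first by rewrite oppr0.
    by rewrite /= !mulrA sgn_swap // ?mulNr // eq_sym.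
  move=> v _; case: ifP => vs; last by rewrite big1 // => u _; rewrite /P vs.
  rewrite mulr_sumr big_mkcond /=; apply: eq_bigr => u _.
  by rewrite /P vs /= !finset.inE; case: (u != v); case: (u \in t).
(* The chains are chosen for all [t] of one size at a time, since [z c t] involves only chains of
   smaller sets. *)
have fam n : exists c : {set 'I_m} -> {set 'I_m} -> F,
    forall t, t \subset sg -> (#|t| < n)%N ->
      (forall s, s \notin X t -> c t s = 0) /\ forall s, bd (c t) s = z c t s.
  elim: n => [|n [c cP]]; first by exists (fun _ _ => 0).
  have ex t : exists ct, t \subset sg -> #|t| = n ->
      (forall s, s \notin X t -> ct s = 0) /\ forall s, bd ct s = z c t s.
    have [tsg|tsg] := boolP (t \subset sg); last by exists (fun=> 0).
    have [tn|tn] := eqVneq #|t| n; last by exists (fun=> 0) => _ e; case/eqP: tn.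
    have cD v : v \in t -> (t :\ v \subset sg) /\ (#|t :\ v| < n)%N.
      move=> vt; split; first exact: fintype.subset_trans (finset.subD1set _ _) tsg.
      by rewrite -tn (cardsD1 v t) vt.
    have [|s|ct ctP] := @exact_X t (z c t) tsg.
    - move=> s sX; rewrite /z /kdelta big1 ?subr0.
        by case: eqP => // ts; rewrite -ts tX in sX.
      move=> v vt; have [tsg' tn'] := cD v vt; have [c0 _] := cP _ tsg' tn'.
      rewrite c0 ?mulr0 //; apply: contra sX.
      exact: (fintype.subsetP (mX _ _ (finset.subD1set _ _) tsg)).
    - by apply: bdz => v r vt; have [tsg' tn'] := cD v vt; have [_ ->] := cP _ tsg' tn'.
    by exists ct.
  have [c' c'P] := choice ex.
  pose c2 t := if (#|t| < n)%N then c t else c' t.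
  have zc t s : (#|t| <= n)%N -> z c2 t s = z c t s.
    move=> tn; rewrite /z; congr (_ - _); apply: eq_bigr => v vt.
    by rewrite /c2; have := cardsD1 v t; rewrite vt add1n => e; rewrite -e tn.
  exists c2 => t tsg; rewrite ltnS => tn.
  have [tn'|tn'] := ltnP #|t| n.
    have [c0 cb] := cP t tsg tn'; rewrite /c2 tn'; split=> // s.
    by rewrite zc.
  have tE : #|t| = n by apply/eqP; rewrite eqn_leq tn.
  have [c0 cb] := c'P t tsg tE; rewrite /c2 ltnNge tn'; split=> // s.
  by rewrite zc.
have [c cP] := fam #|sg|.+1.
have [csg0 csgb] := cP sg (fintype.subxx _) (ltnSn _).
apply: contrapT => no; have := csgb sg.
have -> : bd (c sg) sg = 0.
  apply: big1 => s _; apply/eqP; rewrite mulf_eq0 -[c sg s == 0]negbK -[kbound F s sg == 0]negbK.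
  rewrite -negb_and; apply/negP => /andP[cs /kbound_neq0[v vs sgE]].
  apply: no; exists s.
    by apply: contraT => /csg0 e; rewrite e eqxx in cs.
  by rewrite sgE finset.properD1.
rewrite /z /kdelta eqxx big1 ?subr0 => [/esym/eqP|v vsg]; first by rewrite oner_eq0.
have [||c0 _] := cP (sg :\ v).
- exact: finset.subD1set.
- by rewrite ltnS subset_leq_card // finset.subD1set.
by rewrite c0 ?mulr0 //; exact: sgX.
Qed.

End HomologyBounds.

(** * Tor and Hochster's formula *)

Section Comparison.
Variables (S : comNzRingType) (I : S -> Prop).
Hypothesis I0 : I 0.
Hypothesis IB : forall x y, I x -> I y -> I (x - y).
Hypothesis IM : forall a x, I x -> I (a * x).
Implicit Types P Q : free_resolution I.

Let ID x y : I x -> I y -> I (x + y).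
Proof. by move=> Ix Iy; rewrite -[y]opprK; apply: IB => //; rewrite -sub0r; exact: IB. Qed.

Let Isum (J : finType) (f : J -> S) : (forall j, I (f j)) -> I (\sum_j f j).
Proof. by move=> If; apply: (big_ind I). Qed.

Let dd P i : res_d P i.+1 *m res_d P i = 0.
Proof.
apply/row_matrixP => k; rewrite row_mul row0; apply/res_exactS.
by exists (delta_mx 0 k); rewrite rowE.
Qed.

Let aug_d P k : I ((row k (res_d P 0) *m res_aug P) 0 0).
Proof. by apply/res_exact0; exists (delta_mx 0 k); rewrite rowE. Qed.

Lemma lift_rows n p q (A : 'M[S]_(n, p)) (B : 'M[S]_(q, p)) :
  (forall k, exists w, row k A = w *m B) -> exists C, A = C *m B.
Proof.
move=> H; have [w wE] := choice H; exists (\matrix_k w k).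
by apply/row_matrixP => k; rewrite wE row_mul rowK.
Qed.

Let I_rowmul P Q (f : 'M[S]_(res_rank P 0, res_rank Q 0)) :
  (forall k, I ((row k f *m res_aug Q) 0 0 - res_aug P k 0)) ->
  forall u : 'rV_(res_rank P 0), I ((u *m f *m res_aug Q) 0 0 - (u *m res_aug P) 0 0).
Proof.
move=> H u; rewrite -mulmxA !mxE -sumrB; apply: Isum => k.
rewrite -mulrBr; apply: IM; have := H k.
by rewrite -row_mul mxE.
Qed.

Lemma chain_map_exists P Q :
  exists f : forall i, 'M[S]_(res_rank P i, res_rank Q i),
    (forall u : 'rV_(res_rank P 0), I ((u *m f 0%N *m res_aug Q) 0 0 - (u *m res_aug P) 0 0)) /\
    forall i, res_d P i *m f i = f i.+1 *m res_d Q i.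
Proof.
have [w wP] := choice (fun k => res_surj Q (res_aug P k 0)).
(* Each lift is an arbitrary solution if there is one; solvability in every degree follows by
   induction afterwards. *)
pose f := nat_rect (fun i => 'M[S]_(res_rank P i, res_rank Q i)) (\matrix_k w k)
  (fun i fi => xget 0 [set C | res_d P i *m fi = C *m res_d Q i]%classic).
have f0 (u : 'rV_(res_rank P 0)) : I ((u *m f 0%N *m res_aug Q) 0 0 - (u *m res_aug P) 0 0).
  by apply: I_rowmul => k; rewrite rowK; exact: wP.
have fS i : (exists C, res_d P i *m f i = C *m res_d Q i) ->
    res_d P i *m f i = f i.+1 *m res_d Q i.
  by move=> [C CE]; rewrite /f /=; case: xgetP => [? _ //|/(_ C)].
exists f; split=> //; elim=> [|i IH]; apply: fS; apply: lift_rows => k.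
  apply/res_exact0; rewrite row_mul.
  by have := ID (f0 (row k (res_d P 0))) (aug_d k); rewrite subrK.
apply/res_exactS; rewrite -row_mul -mulmxA -IH mulmxA dd mul0mx.
exact: row0.
Qed.

Lemma null_homotopy P (phi : forall i, 'M[S]_(res_rank P i)) :
  (forall u : 'rV_(res_rank P 0), I ((u *m phi 0%N *m res_aug P) 0 0)) ->
  (forall i, phi i.+1 *m res_d P i = res_d P i *m phi i) ->
  exists h : forall i, 'M[S]_(res_rank P i, res_rank P i.+1),
    phi 0%N = h 0%N *m res_d P 0 /\
    forall i, phi i.+1 = h i.+1 *m res_d P i.+1 + res_d P i *m h i.
Proof.
move=> phi0 phiS.
pose h := nat_rect (fun i => 'M[S]_(res_rank P i, res_rank P i.+1))
  (xget 0 [set C | phi 0%N = C *m res_d P 0]%classic)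
  (fun i hi => xget 0 [set C | phi i.+1 - res_d P i *m hi = C *m res_d P i.+1]%classic).
have h0 : phi 0%N = h 0%N *m res_d P 0.
  have [|C CE] := @lift_rows _ _ _ (phi 0%N) (res_d P 0).
    move=> k; apply/res_exact0; have := phi0 (delta_mx 0 k).
    by rewrite -rowE.
  by rewrite /h /=; case: xgetP => [? _ //|/(_ C)].
have hS i : (phi i.+1 - res_d P i *m h i) *m res_d P i = 0 ->
    phi i.+1 = h i.+1 *m res_d P i.+1 + res_d P i *m h i.
  move=> H; have [|C CE] := @lift_rows _ _ _ (phi i.+1 - res_d P i *m h i) (res_d P i.+1).
    by move=> k; apply/res_exactS; rewrite -row_mul H row0.
  have -> : h i.+1 *m res_d P i.+1 = phi i.+1 - res_d P i *m h i.
    by rewrite /h /=; case: xgetP => [? _ <- //|/(_ C)].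
  by rewrite subrK.
exists h; split=> //; elim=> [|i IH]; apply: hS; rewrite mulmxBl phiS -mulmxA.
  by rewrite h0 subrr.
by rewrite IH mulmxDr [res_d P i.+1 *m (res_d P i *m _)]mulmxA dd mul0mx addr0 subrr.
Qed.

End Comparison.

(** [f] induces an injection on homology, because [g] undoes it up to boundaries. *)
Lemma homology_retract (F : fieldType) p p0 p2 q q0 q2
    (dP1 : 'M[F]_(p, p0)) (dP2 : 'M[F]_(p2, p)) (dQ1 : 'M[F]_(q, q0))
    (dQ2 : 'M[F]_(q2, q)) (f : 'M[F]_(p, q)) (g : 'M[F]_(q, p)) :
  dQ2 *m dQ1 = 0 -> kermx dP1 *m f *m dQ1 = 0 -> (dQ2 *m g <= dP2)%MS ->
  (kermx dP1 *m (f *m g - 1%:M) <= dP2)%MS ->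
  (\rank (kermx dP1) - \rank dP2 <= \rank (kermx dQ1) - \rank dQ2)%N.
Proof.
move=> QQ fker gQ fg; set A := kermx dP1; pose C := cokermx dQ2.
have kerA : (A :&: kermx (f *m C) <= dP2)%MS.
  apply/rV_subP => v; rewrite sub_capmx => /andP[/submxP[a va] /sub_kermxP].
  rewrite mulmxA => /eqP; rewrite -submxE => vf.
  have -> : v = v *m f *m g - v *m (f *m g - 1%:M).
    by rewrite mulmxBr mulmx1 mulmxA opprB addrC subrK.
  apply: addmx_sub; last first.
    by rewrite (eqmx_opp _) va -mulmxA; apply: submx_trans (submxMl _ _) fg.
  by apply: submx_trans gQ; exact: submxMr.
have rA := mxrank_mul_ker A (f *m C).
have rQ := mxrank_mul_ker (kermx dQ1) C.
have r1 : (\rank (A *m (f *m C)) <= \rank (kermx dQ1 *m C))%N.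
  by apply: mxrankS; rewrite mulmxA; apply: submxMr; apply/sub_kermxP.
have r2 : (\rank dQ2 <= \rank (kermx dQ1 :&: kermx C)%MS)%N.
  apply: mxrankS; rewrite sub_capmx; apply/andP; split; apply/sub_kermxP => //.
  exact: mulmx_coker.
have r3 := mxrankS kerA.
move: rA rQ r1 r2 r3; move: (\rank _) (\rank _) (\rank _) (\rank _) (\rank _) (\rank _) (\rank _) (\rank _) => *; lia.
Qed.

Section TorInvariance.
Variables (F : fieldType) (m : nat).
Local Notation S := (mpoly.mpoly m F).
Variable I : S -> Prop.
Hypothesis I0 : I 0.
Hypothesis IB : forall x y, I x -> I y -> I (x - y).
Hypothesis IM : forall a x, I x -> I (a * x).

Definition tor_d (P : free_resolution I) i : 'M[F]_(res_rank P i.+1, res_rank P i) :=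
  map_mx (@eval0 F m) (res_d P i).

Lemma map_eval0_mul p q r (A : 'M[S]_(p, q)) (B : 'M[S]_(q, r)) :
  map_mx (@eval0 F m) (A *m B) = map_mx (@eval0 F m) A *m map_mx (@eval0 F m) B.
Proof. by rewrite (map_mxM (mpoly.meval (fun _ : 'I_m => (0 : F)))). Qed.

Lemma map_eval0_D p q (A B : 'M[S]_(p, q)) :
  map_mx (@eval0 F m) (A + B) = map_mx (@eval0 F m) A + map_mx (@eval0 F m) B.
Proof. by rewrite (map_mxD (mpoly.meval (fun _ : 'I_m => (0 : F)))). Qed.

(** The composite of chain maps to [Q] and back is homotopic to the identity, and stays so after
    setting the variables to 0. The equality that follows by symmetry is needed because [Dtilde_is]
    admits any resolution. *)
Lemma Tor_dim_le (P Q : free_resolution I) i : (Tor_dim P i <= Tor_dim Q i)%N.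
Proof.
have [f [f0 fS]] := chain_map_exists I0 IB IM P Q.
have [g [g0 gS]] := chain_map_exists I0 IB IM Q P.
pose phi i := f i *m g i - 1%:M.
have ID x y : I x -> I y -> I (x + y).
  by move=> Ix Iy; rewrite -[y]opprK; apply: IB => //; rewrite -sub0r; exact: IB.
have [||h [h0 hS]] := @null_homotopy _ _ P phi.
- move=> u; rewrite /phi mulmxBr mulmx1 mulmxBl mulmxA.
  have := ID _ _ (g0 (u *m f 0%N)) (f0 u).
  by rewrite addrA subrK !mxE.
- move=> j; rewrite /phi mulmxBl mul1mx mulmxBr mulmx1 mulmxA fS.
  by rewrite -!mulmxA gS.
have phiE j : map_mx (@eval0 F m) (f j) *m map_mx (@eval0 F m) (g j) - 1%:M =
    map_mx (@eval0 F m) (phi j).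
  rewrite -map_eval0_mul; apply/eqP; rewrite subr_eq.
  have := map_eval0_D (phi j) 1%:M; rewrite subrK => ->.
  by rewrite (map_mx1 (mpoly.meval (fun _ : 'I_m => (0 : F)))).
have dQ j : (tor_d Q j *m map_mx (@eval0 F m) (g j) <= tor_d P j)%MS.
  by rewrite -map_eval0_mul gS map_eval0_mul submxMl.
have QQ j : tor_d Q j.+1 *m tor_d Q j = 0.
  rewrite -map_eval0_mul (_ : res_d Q j.+1 *m res_d Q j = 0).
    by rewrite (map_mx0 (mpoly.meval (fun _ : 'I_m => (0 : F)))).
  apply/row_matrixP => k; rewrite row_mul row0; apply/res_exactS.
  by exists (delta_mx 0 k); rewrite rowE.
case: i => [|i] /=.
  (* In degree 0 everything is a cycle: the outgoing differentials are zero maps to spaces of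
     dimension 0. *)
  have := @homology_retract F _ 0 _ _ 0 _ 0 (tor_d P 0) 0 (tor_d Q 0)
    (map_mx (@eval0 F m) (f 0%N)) (map_mx (@eval0 F m) (g 0%N)).
  rewrite !mxrank_ker !mxrank0 !subn0 !mulmx0; apply=> //.
  by rewrite phiE h0 map_eval0_mul mulmxA submxMl.
apply: (@homology_retract F _ _ _ _ _ _ (tor_d P i) (tor_d P i.+1) (tor_d Q i)
  (tor_d Q i.+1) (map_mx (@eval0 F m) (f i.+1)) (map_mx (@eval0 F m) (g i.+1))) => //.
  by rewrite -mulmxA -map_eval0_mul -fS map_eval0_mul mulmxA mulmx_ker mul0mx.
rewrite phiE hS map_eval0_D mulmxDr !map_eval0_mul [X in _ + X]mulmxA.
by rewrite mulmx_ker mul0mx addr0 mulmxA submxMl.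
Qed.

Lemma Tor_dim_eq (P Q : free_resolution I) i : Tor_dim P i = Tor_dim Q i.
Proof. by apply/eqP; rewrite eqn_leq !Tor_dim_le. Qed.

End TorInvariance.

(** * An explicit free resolution of the Stanley-Reisner ring *)

Section MonomialDivision.
Variables (F : fieldType) (m : nat).
Local Notation S := (mpoly.mpoly m F).
Local Notation mon := (mpoly.multinom m).
Local Notation X_ := (@mpoly.mpolyX m F).
Local Notation coef := (@mpoly.mcoeff m F).
Local Notation "k ++ l" := (mpoly.mnm_add k l).
Local Notation "k -- l" := (mpoly.mnm_sub k l) (at level 50).
Local Notation U := (@mpoly.mnm1 m).
Implicit Types (p q : S) (k l u : mon) (i j t : 'I_m).

Lemma coefMX u k p :
  coef k (X_ u * p) = if mpoly.lem u k then coef (k -- u) p else 0.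
Proof.
case: ifP => [uk|/negP uk].
  by rewrite mulrC -[in LHS](mpoly.submK uk) mpoly.addmC mpoly.mcoeffMX.
rewrite {1}(mpoly.mpolyE p) mulr_sumr raddf_sum /=; apply: big1 => l _.
rewrite -scalerAr mpoly.mcoeffZ -mpoly.mpolyXD mpoly.mcoeffX.
case: eqP => [e|]; last by rewrite mulr0.
case: uk; rewrite -e; apply/mpoly.mnm_lepP => i.
by rewrite mpoly.mnmDE leq_addr.
Qed.

Definition var t : S := X_ (U t).

Lemma lemU t k : mpoly.lem (U t) k = (0 < k t)%N.
Proof.
apply/mpoly.mnm_lepP/idP => [/(_ t)|kt i]; rewrite mpoly.mnm1E ?eqxx //.
by case: eqP => // <-.
Qed.

Lemma coef_varM t k p :
  coef k (var t * p) = if (0 < k t)%N then coef (k -- U t) p else 0.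
Proof. by rewrite coefMX lemU. Qed.

Definition divx j p : S :=
  \sum_(k <- mpoly.msupp p | (0 < k j)%N) coef k p *: X_ (k -- U j).

Lemma coef_divx j k p : coef k (divx j p) = coef (k ++ U j) p.
Proof.
rewrite /divx raddf_sum /=.
have kU : (0 < (k ++ U j) j)%N by rewrite mpoly.mnmDE mpoly.mnm1E eqxx addn1.
have E l : (0 < l j)%N -> (l -- U j == k) = (l == k ++ U j).
  move=> lj; apply/eqP/eqP => [<-|->]; last by rewrite mpoly.addmK.
  by rewrite mpoly.submK // lemU.
rewrite (eq_bigr (fun l => coef l p * (l == k ++ U j)%:R)); last first.
  by move=> l lj; rewrite mpoly.mcoeffZ mpoly.mcoeffX E.
have [kp|kp] := boolP (k ++ U j \in mpoly.msupp p).
  rewrite big_mkcond (bigD1_seq _ kp (mpoly.msupp_uniq p)) /= kU eqxx mulr1.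
  rewrite big1 ?addr0 // => l /negPf lk.
  by case: ifP; rewrite // lk mulr0.
rewrite big_seq_cond big1 => [|l /andP[lp _]].
  by apply/esym/eqP; rewrite mpoly.mcoeff_eq0.
by case: eqP => [e|]; [rewrite -e lp in kp | rewrite mulr0].
Qed.

Lemma divxD j : {morph divx j : p q / p + q}.
Proof.
by move=> p q; apply/mpoly.mpolyP => k; rewrite !(coef_divx, mpoly.mcoeffD).
Qed.

Lemma divx0 j : divx j 0 = 0.
Proof. by apply/mpoly.mpolyP => k; rewrite coef_divx !mpoly.mcoeff0. Qed.

Lemma divxN j : {morph divx j : p / - p}.
Proof. by move=> p; apply/mpoly.mpolyP => k; rewrite !(coef_divx, mpoly.mcoeffN). Qed.

Lemma divx_sum j (I : Type) (r : seq I) (P : pred I) (f : I -> S) :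
  divx j (\sum_(i <- r | P i) f i) = \sum_(i <- r | P i) divx j (f i).
Proof. exact: (big_morph _ (divxD j) (divx0 j)). Qed.

Lemma divx_sgn j i (s : {set 'I_m}) p : divx j (sgn S i s * p) = sgn S i s * divx j p.
Proof.
rewrite /sgn -signr_odd; case: (odd _); first by rewrite expr1 !mulN1r divxN.
by rewrite expr0 !mul1r.
Qed.

Lemma divx_varM j t p : divx j (var t * p) = if t == j then p else var t * divx j p.
Proof.
apply/mpoly.mpolyP => k; rewrite coef_divx coef_varM mpoly.mnmDE mpoly.mnm1E.
have [->|tj] := eqVneq t j; first by rewrite addn1 /= mpoly.addmK.
rewrite coef_varM addn0; case: ifP => // kt.
rewrite coef_divx; congr (coef _ p); apply/mpoly.mnmP => i.
rewrite !(mpoly.mnmDE, mpoly.mnmBE, mpoly.mnm1E).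
have [<-|_] := eqVneq t i; last by rewrite !subn0.
by rewrite eq_sym (negPf tj) !addn0.
Qed.

Lemma coef_mod_var j k p :
  coef k (p - var j * divx j p) = if (0 < k j)%N then 0 else coef k p.
Proof.
rewrite mpoly.mcoeffB coef_varM; case: ifP => kj; last by rewrite subr0.
by rewrite coef_divx mpoly.submK ?subrr // lemU.
Qed.

Definition mnm_of_set (s : {set 'I_m}) : mon := \big[@mpoly.mnm_add m/@mpoly.mnm0 m]_(i in s) U i.

Lemma mnm_of_setE (s : {set 'I_m}) i : mnm_of_set s i = (i \in s).
Proof.
rewrite /mnm_of_set mpoly.mnm_sumE; case: (boolP (i \in s)) => si.
  rewrite (bigD1 i) //= mpoly.mnm1E eqxx big1 // => j /andP[_ /negPf ji].
  by rewrite mpoly.mnm1E ji.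
by apply: big1 => j sj; rewrite mpoly.mnm1E; case: eqP => // e; rewrite -e sj in si.
Qed.

Lemma face_monomialE (s : {set 'I_m}) : face_monomial F s = X_ (mnm_of_set s).
Proof. by rewrite /face_monomial -mpoly.mprodXE. Qed.

Lemma var_face_monomial t (s : {set 'I_m}) : t \notin s ->
  var t * face_monomial F s = face_monomial F (t |: s).
Proof. by move=> ts; rewrite /face_monomial big_setU1. Qed.

Definition mnm_supp k : {set 'I_m} := [set i | (0 < k i)%N].

Lemma coef_face_monomialM (s : {set 'I_m}) k p : coef k (face_monomial F s * p) =
  if s \subset mnm_supp k then coef (k -- mnm_of_set s) p else 0.
Proof.
rewrite face_monomialE coefMX; congr (if _ then _ else _).
apply/mpoly.mnm_lepP/fintype.subsetP => [H i si|H i].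
  by have := H i; rewrite mnm_of_setE si finset.in_set.
by rewrite mnm_of_setE; case: (boolP (i \in s)) => // /H; rewrite finset.in_set.
Qed.

End MonomialDivision.

Section ResolutionOperators.
Variables (F : fieldType) (m : nat) (K : scomplex m).
Local Notation S := (mpoly.mpoly m F).
Local Notation coef := (@mpoly.mcoeff m F).
Local Notation xv := (@var F m).
Implicit Types (s T : {set 'I_m}) (i j t u : 'I_m).
Implicit Types (f g : {set 'I_m} -> {set 'I_m} -> S).

Lemma sgnU1 (R : pzRingType) u t T : t \notin T ->
  sgn R u (t |: T) = (-1) ^+ (t < u)%N * sgn R u T.
Proof.
move=> tT; have := sgnD1 R u (finset.setU11 t T); rewrite finset.setU1K // => ->.
by rewrite mulrA -expr2 sqrr_sign mul1r.
Qed.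

Lemma ord_ltnNge t u : t != u -> (u < t)%N = ~~ (t < u)%N.
Proof. by move=> tu; rewrite ltnNge leq_eqVlt (negPf (_ : t != u :> nat)). Qed.

Lemma sgnU_swap (R : comPzRingType) t u T : t != u -> t \notin T -> u \notin T ->
  sgn R t T * sgn R u (t |: T) = - (sgn R u T * sgn R t (u |: T)).
Proof.
move=> tu tT uT; rewrite !sgnU1 // (ord_ltnNge tu).
by case: (t < u)%N => /=; rewrite ?expr0 ?expr1; ring.
Qed.

(* The generator of degree s :|: T given by (s, T) is the cube of the sets
   between s and s :|: T, modulo the cubes whose bottom s is a non-face. *)
Definition cell s T := (s \in faces K) && [disjoint s & T].

Lemma cell_move s T t : cell s T -> t \in s -> cell (s :\ t) (t |: T).
Proof.
move=> /andP[sK sT] ts; rewrite /cell (face_sub sK) ?finset.subD1set //=.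
rewrite -setI_eq0; apply/eqP/setP => i; rewrite !finset.inE.
have [|_] := eqVneq i t => //=.
by case: (boolP (i \in s)) => // /(disjointFr sT).
Qed.

Lemma cell_add s T t : cell s T -> t \notin s -> cell s (t |: T).
Proof.
move=> /andP[sK sT] ts; rewrite /cell sK /=.
rewrite -setI_eq0; apply/eqP/setP => i; rewrite !finset.inE.
have [->|_] := eqVneq i t; first by rewrite (negPf ts).
by case: (boolP (i \in s)) => // /(disjointFr sT).
Qed.

Lemma cell_del s T t : cell s T -> cell s (T :\ t).
Proof.
move=> /andP[sK sT]; rewrite /cell sK /=.
by apply: disjointWr sT; exact: finset.subD1set.
Qed.

(** The differential, written on coefficients: (s, T) goes to the signed sum over t in T of x_t (s,
    T - t) - (s + t, T - t). Before non-faces are discarded this is the tensor product over the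
    variables of a redundant resolution of F[x]: generators e_0 and e_1, sent to 1 and x, and an
    edge with boundary x e_0 - e_1. *)
Definition dop f s T : S := if cell s T then
  \sum_(t | t \notin T) sgn S t T *
     (if t \in s then - f (s :\ t) (t |: T) else xv t * f s (t |: T)) else 0.

Definition hop j f s T : S :=
  if cell s T && (j \in T) then sgn S j T * divx j (f s (T :\ j)) else 0.

(** Normal form in direction [j]: a multiple of the variable [j] at a bottom without [j] is divided
    by it and moved to the bottom with [j], and vanishes if that is a non-face. *)
Definition pop j f s T : S := if cell s T then
  if j \in T then 0 else
  if j \in s then f s T + divx j (f (s :\ j) T) else f s T - xv j * divx j (f s T)
  else 0.

Definition supported f := forall s T, ~~ cell s T -> f s T = 0.

Lemma dop_dop f s T : dop (dop f) s T = 0.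
Proof.
rewrite {1}/dop; case: ifP => // c.
pose v i s' T' := if i \in s then - f (s' :\ i) T' else xv i * f s' T'.
pose P t u : S := if [&& t \notin T, u \notin T & t != u] then
  sgn S t T * (sgn S u (t |: T) *
    (if t \in s then if u \in s then f (s :\ t :\ u) (u |: (t |: T))
                     else - (xv u * f (s :\ t) (u |: (t |: T)))
     else if u \in s then - (xv t * f (s :\ u) (u |: (t |: T)))
          else xv t * xv u * f s (u |: (t |: T)))) else 0.
rewrite big_mkcond (eq_bigr (fun t => \sum_u P t u)) /=.
  apply: sum_antisym => [t u|t]; last by rewrite /P eqxx !andbF.
  rewrite /P [u == t]eq_sym; case: (boolP (t \in T)) => tT; case: (boolP (u \in T)) => uT /=;
    rewrite ?oppr0 //.
  have [|tu] := eqVneq t u; first by rewrite oppr0.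
  rewrite !mulrA sgnU_swap // mulNr; congr (- (_ * _)).
  have -> : t |: (u |: T) = u |: (t |: T).
    by apply/setP => i; rewrite !finset.inE orbCA.
  have -> : s :\ u :\ t = s :\ t :\ u.
    by apply/setP => i; rewrite !finset.inE andbCA.
  by case: (t \in s); case: (u \in s) => //=; rewrite [xv t * _]mulrC.
move=> t _; case: ifP => tT; last by rewrite big1 // => u _; rewrite /P tT.
have E s' : cell s' (t |: T) -> dop f s' (t |: T) = \sum_(u | (u \notin T) && (t != u))
    sgn S u (t |: T) * (if u \in s' then - f (s' :\ u) (u |: (t |: T))
                        else xv u * f s' (u |: (t |: T))).
  move=> cs'; rewrite /dop cs'; apply: eq_bigl => u.
  by rewrite finset.in_setU1 negb_or eq_sym andbC.
have [ts|ts] := boolP (t \in s).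
  rewrite E ?cell_move // -sumrN mulr_sumr big_mkcond; apply: eq_bigr => u _.
  rewrite /P tT ts /=; case: ifP => // /andP[_ tu].
  rewrite -mulrN; congr (_ * (_ * _)).
  by rewrite finset.in_setD1 eq_sym tu /=; case: (u \in s); rewrite ?opprK.
rewrite E ?cell_add // !mulr_sumr big_mkcond; apply: eq_bigr => u _.
rewrite /P tT (negPf ts) /=; case: ifP => // /andP[_ tu].
rewrite [xv t * (_ * _)]mulrCA; congr (_ * (_ * _)).
by case: (u \in s); rewrite ?mulrN // mulrA.
Qed.

(* In each coordinate j the cells are those of an edge from 0 to 1; [hop j]
   pushes the monomials divisible by 'X_j along it. *)
Lemma dop_hop j f s T : supported f ->
  dop (hop j f) s T + hop j (dop f) s T = f s T - pop j f s T.
Proof.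
move=> fsup; case: (boolP (cell s T)) => c; last first.
  by rewrite /dop /hop /pop (negPf c) /= fsup // subr0 addr0.
have sT := c; case/andP: sT => _ sT.
have hmove t : t \in s -> hop j f (s :\ t) (t |: T) =
    if j \in t |: T then sgn S j (t |: T) * divx j (f (s :\ t) ((t |: T) :\ j)) else 0.
  by move=> ts; rewrite /hop cell_move.
have hadd t : t \notin s -> hop j f s (t |: T) =
    if j \in t |: T then sgn S j (t |: T) * divx j (f s ((t |: T) :\ j)) else 0.
  by move=> ts; rewrite /hop cell_add.
rewrite [dop (hop j f) s T]/dop [hop j (dop f) s T]/hop /pop c /=.
case: (boolP (j \in T)) => jT; last first.
  rewrite addr0 (bigD1 j) //= big1 ?addr0; last first.
    move=> t /andP[tT tj]; case: ifP => ts; rewrite ?hmove ?hadd ?ts //.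
      by rewrite finset.in_setU1 eq_sym (negPf tj) (negPf jT) oppr0 mulr0.
    by rewrite finset.in_setU1 eq_sym (negPf tj) (negPf jT) !mulr0.
  have sj : sgn S j (j |: T) = sgn S j T by rewrite sgnU1 // ltnn mul1r.
  case: ifP => js; rewrite ?hmove ?hadd ?js // finset.setU11 sj finset.setU1K //.
    by rewrite mulrN mulrA sgn_sq mul1r opprD addrA subrr add0r.
  by rewrite mulrCA [X in _ * X]mulrA sgn_sq mul1r opprB addrC subrK.
have js : j \notin s by rewrite (disjointFl sT).
rewrite subr0 [dop f s _]/dop cell_del // divx_sum mulr_sumr.
rewrite [X in _ + X](bigD1 j) ?finset.setD11 //=.
rewrite divx_sgn (negPf js) finset.setD1K // divx_varM eqxx sgn_self //.
rewrite mulrA sgn_sq mul1r addrCA -[RHS]addr0; congr (_ + _).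
rewrite [X in _ + X](eq_bigl (fun t => t \notin T)); last first.
  move=> t; rewrite finset.in_setD1 negb_and negbK.
  by have [->|_] := eqVneq t j; rewrite ?jT ?andbT.
rewrite -big_split big1 //= => t tT.
have tj : t != j by apply: contraNneq tT => ->.
have TE : (t |: T) :\ j = t |: T :\ j.
  by apply/setP => i; rewrite !finset.inE; have [->|_] := eqVneq i j; rewrite //= eq_sym (negPf tj).
have jtT : j \in t |: T by rewrite finset.in_setU1 jT orbT.
have sg : sgn S t T * sgn S j (t |: T) = - (sgn S j T * sgn S t (T :\ j)).
  rewrite sgnU1 // (sgnD1 S t jT) (ord_ltnNge tj).
  by case: (t < j)%N => /=; rewrite ?expr0 ?expr1; ring.
rewrite divx_sgn; case: ifP => ts.
  rewrite hmove // jtT TE divxN !mulrN !mulrA sg mulNr opprK.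
  by rewrite subrr.
rewrite hadd ?ts // jtT TE divx_varM (negPf tj).
have key (a b c' d x y : S) : a * b = - (c' * d) ->
    a * (x * (b * y)) + c' * (d * (x * y)) = 0.
  move=> e; have -> : a * (x * (b * y)) = a * b * (x * y) by ring.
  by rewrite e; ring.
exact: key.
Qed.

End ResolutionOperators.

Section Resolution.
Variables (F : fieldType) (m : nat) (K : scomplex m).
Local Notation S := (mpoly.mpoly m F).
Local Notation coef := (@mpoly.mcoeff m F).
Local Notation xv := (@var F m).
Local Notation fm := (@face_monomial F m).
Local Notation X := ({set 'I_m} * {set 'I_m})%type.
Implicit Types (s T : {set 'I_m}) (i j t u : 'I_m).
Implicit Types (f g : {set 'I_m} -> {set 'I_m} -> S).

Lemma SR_ideal0 : SR_ideal (F := F) K 0.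
Proof. by exists (fun=> 0); rewrite big1 // => s _; rewrite mul0r. Qed.

Lemma SR_idealB p q : SR_ideal (F := F) K p -> SR_ideal K q -> SR_ideal K (p - q).
Proof.
move=> [a ->] [b ->]; exists (fun s => a s - b s).
by rewrite -sumrB; apply: eq_bigr => s _; rewrite mulrBl.
Qed.

Lemma SR_idealM p q : SR_ideal (F := F) K q -> SR_ideal K (p * q).
Proof.
move=> [a ->]; exists (fun s => p * a s).
by rewrite mulr_sumr; apply: eq_bigr => s _; rewrite mulrA.
Qed.

Lemma SR_ideal_sum (I : Type) (r : seq I) (P : pred I) (p : I -> S) :
  (forall a, P a -> SR_ideal K (p a)) -> SR_ideal K (\sum_(a <- r | P a) p a).
Proof.
move=> Hp; apply: (big_ind (SR_ideal (F := F) K)) => //; first exact: SR_ideal0.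
move=> a b Ia Ib; rewrite -[b]opprK; apply: SR_idealB => //.
by rewrite -sub0r; apply: SR_idealB => //; exact: SR_ideal0.
Qed.

Lemma SR_ideal_nonface s : s \notin faces K -> SR_ideal K (fm s).
Proof.
move=> sK; exists (fun s' => (s' == s)%:R); rewrite (bigD1 s) //= eqxx mul1r big1 ?addr0 //.
by move=> s' /andP[_ /negPf ->]; rewrite mul0r.
Qed.

Lemma coef_SR_ideal k p : SR_ideal K p -> mnm_supp k \in faces K -> coef k p = 0.
Proof.
move=> [q ->] kK; rewrite raddf_sum /=; apply: big1 => s sK.
rewrite mulrC coef_face_monomialM; case: ifP => // sk.
by rewrite (face_sub kK sk) in sK.
Qed.

Definition graded n f := forall s T, ~~ (cell K s T && (#|T| == n)) -> f s T = 0.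

Lemma graded_supported n f : graded n f -> supported K f.
Proof. by move=> gf s T c; apply: gf; rewrite negb_and c. Qed.

Lemma graded_hop n j f : graded n f -> graded n.+1 (hop K j f).
Proof.
move=> gf s T; rewrite /hop; case: ifP => // /andP[c jT]; rewrite c /= => Tn.
rewrite gf ?divx0 ?mulr0 // negb_and; apply/orP; right.
by apply: contra Tn; rewrite (cardsD1 j T) jT.
Qed.

Lemma graded_pop n j f : graded n f -> graded n (pop K j f).
Proof.
move=> gf s T; rewrite /pop; case: ifP => //= c Tn.
have f0 s' : f s' T = 0 by apply: gf; rewrite negb_and Tn orbT.
by case: ifP => // _; case: ifP => _; rewrite !f0 divx0 ?addr0 ?mulr0 ?subr0.
Qed.

Lemma dopD f g s T : dop K (fun s T => f s T + g s T) s T = dop K f s T + dop K g s T.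
Proof.
rewrite /dop; case: ifP => _; last by rewrite addr0.
rewrite -big_split; apply: eq_bigr => t _ /=; rewrite -mulrDr; congr (_ * _).
by case: ifP => _; rewrite ?opprD ?mulrDr.
Qed.

Lemma eq_dop f g s T : (forall s T, f s T = g s T) -> dop K f s T = dop K g s T.
Proof.
move=> fg; rewrite /dop; case: ifP => // _; apply: eq_bigr => t _.
by rewrite !fg.
Qed.

(** By [dop_hop], on a cycle [pop] differs from the identity by a boundary, so the result is again a
    cycle. *)
Lemma pop_reduction n js f : graded n f -> (forall s T, dop K f s T = 0) ->
  exists g, [/\ graded n.+1 g, graded n (foldl (fun f j => pop K j f) f js)
    & forall s T, f s T = dop K g s T + foldl (fun f j => pop K j f) f js s T].
Proof.
elim: js f => [|j js IH] f gf df.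
  exists (fun _ _ => 0); split=> // s T; rewrite /dop; case: ifP => _; last by rewrite add0r.
  by rewrite big1 ?add0r // => t _; rewrite oppr0 mulr0 if_same mulr0.
have hE s T : f s T = dop K (hop K j f) s T + pop K j f s T.
  have := dop_hop j s T (graded_supported gf).
  rewrite {2}/hop df divx0 mulr0 if_same addr0 => ->.
  by rewrite subrK.
have [|s T|g [gg gp fE]] := IH (pop K j f); first exact: graded_pop.
  by have := df s T; rewrite (eq_dop _ _ hE) dopD dop_dop add0r.
exists (fun s T => hop K j f s T + g s T); split=> // [s T c|s T].
  by rewrite (graded_hop j gf) // gg // addr0.
by rewrite dopD hE {1}fE addrA.
Qed.

Definition reduced j f := (forall s T, j \in T -> f s T = 0) /\
  (forall s T (k : mpoly.multinom m), j \notin s -> (0 < k j)%N -> coef k (f s T) = 0).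

Lemma reduced_pop j f : reduced j (pop K j f).
Proof.
split=> [s T jT|s T k js kj]; rewrite /pop ?jT; first by case: ifP.
case: ifP => _; last by rewrite mpoly.mcoeff0.
case: ifP => _; first by rewrite mpoly.mcoeff0.
by rewrite (negPf js) coef_mod_var kj.
Qed.

Lemma reduced_pop_other i j f : reduced i f -> reduced i (pop K j f).
Proof.
move=> [f0 fk]; split=> [s T iT|s T k is_ ki]; rewrite /pop; case: ifP => // _;
  try (by rewrite mpoly.mcoeff0); case: ifP => // _; try (by rewrite mpoly.mcoeff0).
  by case: ifP => _; rewrite !f0 // divx0 ?addr0 // mulr0 subr0.
case: ifP => _; last by rewrite coef_mod_var fk // if_same.
rewrite mpoly.mcoeffD fk // coef_divx fk ?addr0 //.
  by rewrite finset.in_setD1 negb_and is_ orbT.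
by rewrite mpoly.mnmDE addn_gt0 ki.
Qed.

Lemma reduced_foldl j js f : j \in js -> reduced j (foldl (fun f j => pop K j f) f js).
Proof.
have H ks h : reduced j h -> reduced j (foldl (fun f j => pop K j f) h ks).
  by elim: ks h => //= k ks IH h rh; apply/IH/reduced_pop_other.
elim: js f => //= k js IH f; rewrite inE => /orP[/eqP <-|/IH //].
by apply/H/reduced_pop.
Qed.

Lemma exact_graded n f : graded n.+1 f -> (forall s T, dop K f s T = 0) ->
  exists2 g, graded n.+2 g & forall s T, f s T = dop K g s T.
Proof.
move=> gf df; have [g [gg gp fE]] := pop_reduction (enum 'I_m) gf df.
exists g => // s T; rewrite fE.
set h := foldl _ _ _ in gp fE *; suff -> : h s T = 0 by rewrite addr0.
have [/gp //|/negPn/andP[_ /eqP Tn]] := boolP (~~ (cell K s T && (#|T| == n.+1))).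
have [j jT] : exists j, j \in T by apply/finset.set0Pn; rewrite -card_gt0 Tn.
by have [h0 _] := reduced_foldl f (mem_enum 'I_m j); exact: h0.
Qed.

Definition augment f : S := \sum_(s in faces K) f s finset.set0 * fm s.

(** For each [t] the contributions at [s] and at [t |: s] cancel when the latter is a face; what
    remains are multiples of monomials of non-faces. *)
Lemma augment_dop g : SR_ideal K (augment (dop K g)).
Proof.
have sgn0 t : sgn S t finset.set0 = 1.
  by rewrite /sgn (_ : [set w in _ | _] = finset.set0) ?cards0 //; apply/setP => w; rewrite !finset.inE.
have cell0 s : s \in faces K -> cell K s finset.set0.
  by move=> sK; rewrite /cell sK -setI_eq0 finset.setI0 eqxx.
have -> : augment (dop K g) = \sum_t
    (\sum_(s in faces K | t \notin s) g s (t |: finset.set0) * fm (t |: s) -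
     \sum_(s in faces K | t \in s) g (s :\ t) (t |: finset.set0) * fm s).
  rewrite /augment (eq_bigr (fun s => \sum_t
    (if t \in s then - (g (s :\ t) (t |: finset.set0) * fm s)
     else g s (t |: finset.set0) * fm (t |: s)))); last first.
    move=> s sK; rewrite /dop cell0 // mulr_suml.
    apply: eq_big => [t|t _]; first by rewrite finset.in_set0.
    rewrite sgn0 mul1r; case: (boolP (t \in s)) => ts; first by rewrite mulNr.
    by rewrite -var_face_monomial //; ring.
  rewrite exchange_big /=; apply: eq_bigr => t _.
  rewrite (bigID (fun s : {set 'I_m} => t \in s)) /= addrC; congr (_ + _).
    by apply: eq_bigr => s /andP[_ /negPf ->].
  by rewrite -sumrN; apply: eq_bigr => s /andP[_ ->].
apply: SR_ideal_sum => t _.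
have -> : \sum_(s in faces K | t \in s) g (s :\ t) (t |: finset.set0) * fm s =
    \sum_(s in faces K | (t \notin s) && (t |: s \in faces K))
       g s (t |: finset.set0) * fm (t |: s).
  rewrite (reindex_onto (fun s => t |: s) (fun s => s :\ t)) /=; last first.
    by move=> s /andP[_ ts]; rewrite finset.setD1K.
  apply: eq_big => [s|s /andP[_ /eqP ->] //].
  rewrite finset.setU11 andbT; have [ts|ts] := boolP (t \in s).
    rewrite andbF; apply/negbTE/negP => /andP[_ /eqP/setP/(_ t)].
    by rewrite finset.setD11 ts.
  rewrite finset.setU1K // eqxx andbT andTb; case tsK: (_ |: _ \in _); last by rewrite andbF.
  by rewrite (face_sub tsK) // finset.subsetUr.
rewrite [X in X - _](bigID (fun s => t |: s \in faces K)) /= addrAC.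
rewrite [X in X - _](eq_bigl (fun s => (s \in faces K) && ((t \notin s) && (t |: s \in faces K)))).
  rewrite subrr add0r; apply: SR_ideal_sum => s /andP[_ tsK].
  by apply: SR_idealM; exact: SR_ideal_nonface.
by move=> s; rewrite andbA.
Qed.

Lemma exact_augment f : graded 0 f -> SR_ideal K (augment f) ->
  exists2 g, graded 1 g & forall s T, f s T = dop K g s T.
Proof.
move=> gf fI; have df s T : dop K f s T = 0.
  rewrite /dop; case: ifP => // _; apply: big1 => t tT.
  have f0 s' : f s' (t |: T) = 0.
    apply: gf; rewrite negb_and; apply/orP; right.
    by rewrite cardsU1 tT.
  by rewrite !f0 oppr0 mulr0 if_same mulr0.
have [g [gg gp fE]] := pop_reduction (enum 'I_m) gf df.
exists g => // s T; rewrite fE.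
set h := foldl _ _ _ in gp fE *; suff -> : h s T = 0 by rewrite addr0.
have red j : reduced j h by apply: reduced_foldl; rewrite mem_enum.
have [/gp //|/negPn/andP[/andP[sK _] /eqP/cards0_eq ->]] := boolP (~~ (cell K s T && (#|T| == 0%N))).
have hI : SR_ideal K (augment h).
  have -> : augment h = augment f - augment (dop K g).
    rewrite /augment -sumrB; apply: eq_bigr => s' _; rewrite -mulrBl.
    by rewrite fE addrC addKr.
  by apply: SR_idealB => //; exact: augment_dop.
apply/mpoly.mpolyP => k; rewrite mpoly.mcoeff0.
have [ks|/fintype.subsetPn[j]] := boolP (mnm_supp k \subset s); last first.
  rewrite finset.in_set => kj js; have [_ hk] := red j; exact: hk.
(* For [k] supported in [s], the coefficient of this monomial in [augment h] is that of [k] in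
   [h s]. Another contributing [s'] would be a proper subset of [s], but then the monomial of [h s']
   would involve a variable outside [s'], which [reduced] forbids. *)
have := coef_SR_ideal (k := mpoly.mnm_add k (mnm_of_set s)) hI.
have kE : mnm_supp (mpoly.mnm_add k (mnm_of_set s)) = s.
  apply/setP => i; rewrite finset.in_set mpoly.mnmDE mnm_of_setE addn_gt0.
  have [//|/negPf is_] := boolP (i \in s); first by rewrite orbT.
  by apply/negbTE; apply: contraFN is_; rewrite orbF => ki; apply: (fintype.subsetP ks); rewrite finset.in_set.
rewrite kE => /(_ sK); rewrite raddf_sum /= (bigD1 s) //= big1 ?addr0.
  by rewrite mulrC coef_face_monomialM kE fintype.subxx mpoly.addmK.
move=> s' /andP[s'K s's]; rewrite mulrC coef_face_monomialM kE; case: ifP => // s's_sub.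
have /properP[_ [j js js']] : s' \proper s by rewrite finset.properEneq s's.
have [_ hk] := red j; apply: hk => //.
by rewrite mpoly.mnmBE mpoly.mnmDE !mnm_of_setE js (negPf js') subn0 addn1.
Qed.

End Resolution.

(** * Hochster's formula for the total dimension *)

Section Hochster.
Variables (F : fieldType) (m : nat) (K : scomplex m).
Local Notation S := (mpoly.mpoly m F).
Local Notation xv := (@var F m).
Local Notation fm := (@face_monomial F m).
Local Notation X := ({set 'I_m} * {set 'I_m})%type.
Implicit Types (s T J : {set 'I_m}) (i j t : 'I_m) (x y : X).

Definition res_basis n : {set X} := [set x | cell K x.1 x.2 && (#|x.2| == n)].

Lemma in_res_basis n x : (x \in res_basis n) = cell K x.1 x.2 && (#|x.2| == n).
Proof. by rewrite finset.in_set. Qed.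

Definition kres x y : S := \sum_(t | t \notin y.2) sgn S t y.2 *
  (if t \in y.1 then - kdelta S x (y.1 :\ t, t |: y.2)
   else xv t * kdelta S x (y.1, t |: y.2)).

Lemma sum_kres n (f : X -> S) y : (forall x, x \notin res_basis n -> f x = 0) ->
  cell K y.1 y.2 ->
  \sum_(x in res_basis n) f x * kres x y = dop K (fun s T => f (s, T)) y.1 y.2.
Proof.
move=> f0 cy; rewrite /dop cy /kres; under eq_bigr do rewrite mulr_sumr.
rewrite exchange_big /=; apply: eq_bigr => t _.
have E z : \sum_(x in res_basis n) f x * kdelta S x z = f z.
  by rewrite sum_deltar; case: ifP => // /negbT /f0 ->.
case: ifP => _; rewrite -E -?mulrN ?mulr_sumr -?sumrN ?mulr_sumr; apply: eq_bigr => x _; ring.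
Qed.

Let rdiff n : 'M[S]_(#|res_basis n.+1|, #|res_basis n|) :=
  kmx (res_basis n.+1) (res_basis n) kres.
Let raug : 'cV[S]_#|res_basis 0| := \col_a fm (enum_val a).1.

Let kvec_aug (f : X -> S) : (kvec (res_basis 0) f *m raug) 0 0 =
  augment K (fun s T => f (s, T)).
Proof.
have -> : (kvec (res_basis 0) f *m raug) 0 0 =
    \sum_(x in res_basis 0) f x * fm x.1.
  by rewrite mxE [RHS]big_enum_val; apply: eq_bigr => i _; rewrite !mxE.
rewrite /augment.
rewrite (reindex_onto (fun s => (s, finset.set0)) (fun x => x.1)) /=.
  apply: eq_bigl => s; rewrite in_res_basis /= cards0 eqxx /cell -setI_eq0.
  by rewrite finset.setI0 eqxx !andbT.
by move=> [s T]; rewrite in_res_basis /= => /andP[_ /eqP/cards0_eq ->].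
Qed.

Let graded_of n (f : X -> S) : (forall x, x \notin res_basis n -> f x = 0) ->
  graded K n (fun s T => f (s, T)).
Proof. by move=> f0 s T c; apply: f0; rewrite in_res_basis. Qed.

Let kvec_diff n (f : X -> S) : (forall x, x \notin res_basis n.+1 -> f x = 0) ->
  kvec (res_basis n.+1) f *m rdiff n =
  kvec (res_basis n) (fun y => dop K (fun s T => f (s, T)) y.1 y.2).
Proof.
move=> f0; rewrite mul_kvec; apply/eq_kvec => y.
by rewrite in_res_basis => /andP[cy _]; exact: sum_kres.
Qed.

Let from_graded n g : graded K n.+1 g ->
  exists w, kvec (res_basis n) (fun x : X => dop K g x.1 x.2) = w *m rdiff n.
Proof.
move=> gg; exists (kvec (res_basis n.+1) (fun x : X => g x.1 x.2)).
rewrite kvec_diff => [|x]; last by rewrite in_res_basis => /gg.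
by apply/eq_kvec => x _; apply: eq_dop.
Qed.

Let face_res_surj (p : S) : exists u : 'rV_#|res_basis 0|, SR_ideal K ((u *m raug) 0 0 - p).
Proof.
exists (kvec (res_basis 0) (fun x => (x == (finset.set0, finset.set0))%:R * p)).
rewrite kvec_aug /augment (bigD1 finset.set0) ?face_set0 //= eqxx mul1r.
rewrite big1 => [|s /andP[_ s0]].
  rewrite addr0 /face_monomial big_set0 mulr1 subrr; exact: SR_ideal0.
by rewrite xpair_eqE (negPf s0) !mul0r.
Qed.

Let face_res_exact0 (u : 'rV_#|res_basis 0|) : SR_ideal K ((u *m raug) 0 0) <-> exists w, u = w *m rdiff 0.
Proof.
split=> [|[w ->]].
  have [f f0 ->] := kvec_surj u; rewrite kvec_aug => fI.
  have [g gg fE] := exact_augment (graded_of f0) fI.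
  have [w wE] := from_graded gg; exists w; rewrite -wE.
  by apply/eq_kvec => -[s T] _; exact: fE.
have [g g0 ->] := kvec_surj w; rewrite kvec_diff // kvec_aug.
have -> : augment K (fun s T => dop K (fun s T => g (s, T)) s T) =
  augment K (dop K (fun s T => g (s, T))) by [].
exact: augment_dop.
Qed.

Let face_res_exactS n (u : 'rV[S]_#|res_basis n.+1|) :
  u *m rdiff n = 0 <-> exists w, u = w *m rdiff n.+1.
Proof.
have kvec0 : kvec (res_basis n) (fun=> 0 : S) = 0 by apply/rowP => j; rewrite !mxE.
split=> [|[w ->]].
  have [f f0 ->] := kvec_surj u; rewrite kvec_diff // -kvec0 => /eq_kvec df.
  have gf := graded_of f0.
  have [s T|g gg fE] := exact_graded gf.
    have [c|c] := boolP (cell K s T); last by rewrite /dop (negPf c).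
    have [Tn|Tn] := eqVneq #|T| n.
      by have := df (s, T); rewrite in_res_basis c Tn eqxx; apply.
    rewrite /dop c big1 // => t tT.
    have f0' s' : f (s', t |: T) = 0.
      apply: f0; rewrite in_res_basis negb_and; apply/orP; right.
      by rewrite cardsU1 tT add1n eqSS.
    by rewrite !f0' oppr0 mulr0 if_same mulr0.
  have [w wE] := from_graded gg; exists w; rewrite -wE.
  by apply/eq_kvec => -[s T] _; exact: fE.
have [g g0 ->] := kvec_surj w; rewrite kvec_diff // kvec_diff => [|[s T]].
  rewrite -kvec0; apply/eq_kvec => -[s T] _; exact: dop_dop.
rewrite in_res_basis /= negb_and => /orP[c|Tn]; first by rewrite /dop (negPf c).
rewrite /dop; case: ifP => // c; apply: big1 => t tT.
have g0' s' : g (s', t |: T) = 0.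
  apply: g0; rewrite in_res_basis negb_and; apply/orP; right.
  by rewrite cardsU1 tT add1n eqSS.
by rewrite !g0' oppr0 mulr0 if_same mulr0.
Qed.

Definition face_resolution : free_resolution (SR_ideal (F := F) K) :=
  FreeResolution face_res_surj face_res_exact0 face_res_exactS.

Definition kres0 x y : F := \sum_(t | (t \notin y.2) && (t \in y.1))
  - (sgn F t y.2 * kdelta F x (y.1 :\ t, t |: y.2)).

Lemma tor_d_face_resolution n :
  tor_d face_resolution n = kmx (res_basis n.+1) (res_basis n) kres0.
Proof.
apply/matrixP => a b; rewrite !mxE /kres /kres0 /eval0 raddf_sum /=.
rewrite big_mkcondr; apply: eq_bigr => t _; rewrite rmorphM /=.
have -> : mpoly.meval (fun=> 0) (sgn S t (enum_val b).2) = sgn F t (enum_val b).2.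
  by rewrite /sgn rmorphXn rmorphN rmorph1.
case: ifP => _; last by rewrite rmorphM /= mpoly.mevalXU mul0r mulr0.
by rewrite rmorphN rmorph_nat mulrN.
Qed.

Lemma kres0_neq0 x y : kres0 x y != 0 ->
  exists t, [/\ t \notin y.2, t \in y.1 & x = (y.1 :\ t, t |: y.2)].
Proof.
move=> k0; apply: contrapT => no; case/eqP: k0; apply: big1 => t /andP[t2 t1].
rewrite /kdelta; case: eqP => [xE|]; last by rewrite mulr0 oppr0.
by case: no; exists t.
Qed.

Let cells : {set X} := [set x | cell K x.1 x.2].

Lemma card_lt_ord s : (#|s| < m.+1)%N.
Proof. by rewrite ltnS -[X in (_ <= X)%N](card_ord m) max_card. Qed.

Lemma rank_tor_sum :
  (\sum_(n < m.+1) \rank (tor_d face_resolution n) = rk (krestrict cells cells kres0))%N.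
Proof.
rewrite (rk_blocks (lab := fun x => inord #|x.2|.-1 : 'I_m.+1)
  (lab' := fun y => Ordinal (card_lt_ord y.2))).
  apply: eq_bigr => n _; rewrite tor_d_face_resolution rank_kmx; apply: eq_rk => x y.
  rewrite /krestrict !in_res_basis !finset.in_set.
  case cx: (cell _ x.1 x.2); case cy: (cell _ y.1 y.2); rewrite /= ?andbF ?if_same //.
  have [k0|/kres0_neq0[t [t2 t1 ->]]] := eqVneq (kres0 x y) 0.
    by rewrite k0 !if_same.
  rewrite -val_eqE /= inordK cardsU1 t2 add1n ?eqSS; last exact: card_lt_ord.
  by rewrite andbb.
move=> x y; rewrite /krestrict; case: ifP => _; last by rewrite eqxx.
move=> /kres0_neq0[t [t2 t1 ->]]; apply: val_inj.
by rewrite /= inordK cardsU1 t2 // card_lt_ord.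
Qed.

Let tot x := x.1 :|: x.2.

Let cell_tot x J : cell K x.1 x.2 -> tot x = J -> x = (x.1, J :\: x.1).
Proof.
case: x => s T /andP[_ sT] /= <-; congr (_, _); rewrite /tot /=.
rewrite finset.setDUl finset.setDv finset.set0U; apply/esym/finset.setDidPl.
by rewrite disjoint_sym.
Qed.

Let cell_compl s J : s \in full_sub K J ->
  cell K s (J :\: s) /\ tot (s, J :\: s) = J.
Proof.
rewrite in_full_sub => /andP[sK sJ]; split.
  by rewrite /cell sK -setI_eq0 finset.setIDA finset.setIC -finset.setIDA finset.setDv finset.setI0 /=.
by rewrite /tot /= finset.setDE finset.setUIr finset.setUCr finset.setIT; apply/finset.setUidPr.
Qed.

Let kres0_tot x y : kres0 x y != 0 -> tot x = tot y.
Proof.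
move=> /kres0_neq0[t [_ t1 ->]]; rewrite /tot /=.
by rewrite finset.setUA [_ :|: [set t]]finset.setUC finset.setD1K.
Qed.

Lemma sgn_setD t s J : s \subset J -> sgn F t (J :\: s) = sgn F t J * sgn F t s.
Proof.
move=> sJ.
have -> : sgn F t J = sgn F t s * sgn F t (J :\: s).
  rewrite /sgn -exprD; congr (_ ^+ _); rewrite -[LHS](cardsID s); congr (_ + _)%N.
    apply: eq_card => w; rewrite !finset.inE; case ws: (w \in s); rewrite ?andbF ?andbT //=.
    by rewrite (fintype.subsetP sJ).
  by apply: eq_card => w; rewrite !finset.inE andbA.
by rewrite mulrAC sgn_sq mul1r.
Qed.

(** In multidegree [J] a cell is determined by its bottom [s], and with the variables set to 0 only
    the moves adding a vertex to [s] survive: the transposed boundary of the full subcomplex. The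
    factors [a] absorb the discrepancy of signs given by [sgn_setD]. *)
Lemma rk_kres0_block J :
  rk (fun x y => if tot x == J then krestrict cells cells kres0 x y else 0) =
  brank F (full_sub K J).
Proof.
rewrite /brank rank_kmx -[RHS]rk_tr.
pose a s := \prod_(v in s) sgn F v J.
have a0 s : a s != 0 by rewrite prodf_seq_neq0; apply/allP => v _; apply/implyP => _; exact: sgn_neq0.
apply: (rk_inj (f := fun s => (s, J :\: s)) (a := fun s => - a s) (b := a)) => //.
- by move=> s s' [].
- by move=> s; rewrite oppr_eq0.
- move=> s s'; rewrite /krestrict /=.
  have [sJ|sJ] := boolP (s \in full_sub K J); last first.
    rewrite andbF mulr0 mul0r; case: ifP => [/eqP tE|//]; case: ifP => //.
    rewrite !finset.in_set => /andP[/andP[sK _] _]; case/negP: sJ.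
    by rewrite in_full_sub sK -tE finset.subsetUl.
  have [c ->] := cell_compl sJ; rewrite eqxx.
  have [s'J|s'J] := boolP (s' \in full_sub K J); last first.
    rewrite mulr0 mul0r; case: ifP => //; rewrite !finset.in_set => /andP[_ /andP[s'K _]].
    apply/eqP; apply: contraT => /kres0_tot; have [_ ->] := cell_compl sJ => tE.
    by case/negP: s'J; rewrite in_full_sub s'K tE finset.subsetUl.
  have [c' _] := cell_compl s'J; rewrite !finset.in_set c c' /=.
  have s'sub : s' \subset J by move: s'J; rewrite in_full_sub => /andP[].
  rewrite /kres0 /kbound mulr_sumr mulr_suml big_mkcond [RHS]big_mkcond /=.
  apply: eq_bigr => t _; rewrite finset.in_setD.
  case: (boolP (t \in s')) => ts' /=; last by rewrite andbF.
  rewrite /kdelta xpair_eqE eq_sym; case: eqP => [<-|_]; last by rewrite mulr0 oppr0.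
  have -> : (J :\: (s' :\ t) == t |: J :\: s').
    apply/eqP/setP => w; rewrite !finset.inE; have [->|_] //= := eqVneq w t.
    by rewrite (fintype.subsetP s'sub).
  rewrite mulr1 sgn_setD // mulNr mulNr; congr (- _).
  rewrite {2}/a (bigD1 t) //= -/(a _).
  have -> : \prod_(i in s' | i != t) sgn F i J = a (s' :\ t).
    by apply: eq_bigl => w; rewrite finset.in_setD1 andbC.
  have a2 : a (s' :\ t) * a (s' :\ t) = 1.
    by rewrite -big_split /= big1 // => v _; exact: sgn_sq.
  by rewrite -[LHS]mul1r -a2; ring.
move=> x y; case: ifP => [/eqP xJ|]; last by rewrite eqxx.
rewrite /krestrict; case: ifP => [|]; last by rewrite eqxx.
rewrite !finset.in_set => /andP[cx cy] /kres0_tot xy.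
by exists x.1, y.1; split; apply: cell_tot => //; rewrite -xy.
Qed.

Lemma rk_kres0 : rk (krestrict cells cells kres0) = (\sum_J brank F (full_sub K J))%N.
Proof.
rewrite (rk_blocks (lab := tot) (lab' := tot)) => [|x y].
  by apply: eq_bigr => J _; exact: rk_kres0_block.
by rewrite /krestrict; case: ifP => _; [exact: kres0_tot | rewrite eqxx].
Qed.

Lemma card_cells : #|cells| = (\sum_J #|full_sub K J|)%N.
Proof.
rewrite -sum1_card (partition_big tot xpredT) //=; apply: eq_bigr => J _.
rewrite sum1_card -(card_imset (f := fun s => (s, J :\: s))); last by move=> s s' [].
apply: eq_card => x; rewrite unfold_in /=; apply/andP/imsetP => [[]|[s sJ ->]].
  rewrite finset.in_set => cx /eqP xJ; exists x.1; last exact: cell_tot.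
  by rewrite in_full_sub; case/andP: cx => -> _; rewrite -xJ finset.subsetUl.
by have [c ->] := cell_compl sJ; rewrite finset.in_set c.
Qed.

Lemma sum_res_basis : (\sum_(n < m.+1) #|res_basis n| = #|cells|)%N.
Proof.
rewrite -[RHS]sum1_card (partition_big (fun x => Ordinal (card_lt_ord x.2)) xpredT) //=.
apply: eq_bigr => n _; rewrite -sum1_card; apply: eq_bigl => x.
by rewrite in_res_basis finset.in_set -val_eqE.
Qed.

Lemma res_basis_oob n : (m < n)%N -> #|res_basis n| = 0%N.
Proof.
move=> mn; apply/eqP; rewrite cards_eq0; apply/eqP/setP => x; rewrite in_res_basis finset.in_set0.
apply/negbTE/negP => /andP[_ /eqP e]; have := card_lt_ord x.2.
by rewrite e ltnS leqNgt mn.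
Qed.

Lemma full_sub_down_closed J : down_closed (full_sub K J).
Proof.
move=> s s'; rewrite !in_full_sub => /andP[sK sJ] s's.
by rewrite (face_sub sK s's) (fintype.subset_trans s's sJ).
Qed.

Lemma Tor_dim_oob n : (m < n)%N -> Tor_dim face_resolution n = 0%N.
Proof.
move=> mn; apply/eqP; rewrite -leqn0; apply: leq_trans (leq_subr _ _) _.
case: n mn => // n mn; apply: leq_trans (rank_leq_row _) _.
by rewrite /= res_basis_oob.
Qed.

(** Degrees need not be matched: either side plus twice the same total rank of differentials is the
    number of cells. *)
Lemma hochster_sum : (\sum_(n < m.+1) Tor_dim face_resolution n =
  \sum_J rhomology_rank F (full_sub K J))%N.
Proof.
pose r n := \rank (tor_d face_resolution n).
have rm : r m = 0%N.
  by apply/eqP; rewrite -leqn0; apply: leq_trans (rank_leq_row _) _; rewrite /= res_basis_oob.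
have TE n : (Tor_dim face_resolution n + (r n + (if n is k.+1 then r k else 0)) = #|res_basis n|)%N.
  case: n => [|n].
    by rewrite addn0; apply: subnK; exact: rank_leq_col.
  have -> : Tor_dim face_resolution n.+1 =
    (\rank (kermx (tor_d face_resolution n)) - r n.+1)%N by [].
  rewrite mxrank_ker -subnDA [(r n.+1 + _)%N]addnC; apply: subnK.
  rewrite addnC; apply: mulmx0_rank_max.
  rewrite -map_eval0_mul (_ : res_d _ n.+1 *m res_d _ n = 0).
    by rewrite (map_mx0 (mpoly.meval (fun _ : 'I_m => (0 : F)))).
  apply/row_matrixP => k; rewrite row_mul row0; apply/face_res_exactS.
  by exists (delta_mx 0 k); rewrite rowE.
have sumT : (\sum_(n < m.+1) Tor_dim face_resolution n + 2 * \sum_(n < m.+1) r n = #|cells|)%N.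
  rewrite -sum_res_basis mul2n -addnn [X in (_ + (_ + X))%N]big_ord_recr /= rm addn0.
  under [RHS]eq_bigr do rewrite -TE.
  rewrite big_split big_split /=; congr (_ + (_ + _))%N.
  by rewrite [RHS]big_ord_recl add0n.
have sumb : (\sum_J rhomology_rank F (full_sub K J) + 2 * \sum_(n < m.+1) r n = #|cells|)%N.
  rewrite rank_tor_sum rk_kres0 card_cells big_distrr -big_split /=.
  apply: eq_bigr => J _; apply: rhomology_rankE.
  exact/down_closed_convex/full_sub_down_closed.
by apply/eqP; rewrite -(eqn_add2r (2 * \sum_(n < m.+1) r n)) sumT sumb.
Qed.

Lemma hochster D :
  Dtilde_is F K D <-> (\sum_J rhomology_rank F (full_sub K J))%N = D.
Proof.
rewrite -hochster_sum; split=> [[P [N [PN <-]]]|DE]; last first.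
  by exists face_resolution, m.+1; split=> // i; exact: Tor_dim_oob.
have E n : Tor_dim P n = Tor_dim face_resolution n.
  by apply: Tor_dim_eq; [exact: SR_ideal0 | exact: SR_idealB | exact: SR_idealM].
have W a b (f : nat -> nat) : (forall k, (a <= k)%N -> f k = 0%N) ->
    (\sum_(i < a) f i = \sum_(i < a + b) f i)%N.
  move=> f0; rewrite big_split_ord /= [X in (_ + X)%N]big1 ?addn0 // => i _.
  by apply: f0; rewrite leq_addr.
rewrite (W N m.+1 (Tor_dim P)) // (W m.+1 N (Tor_dim face_resolution)); last exact: Tor_dim_oob.
by rewrite addnC; apply: eq_bigr.
Qed.

End Hochster.

(** * Equivalence of the three conditions *)

Section TautComplexes.
Variables (m : nat) (K : scomplex m).
Implicit Types (J M s t : {set 'I_m}) (v w : 'I_m).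

Lemma full_sub_nonface M : M \notin faces K ->
  (forall t, t \proper M -> t \in faces K) ->
  full_sub K M = [set s : {set 'I_m} | s \proper M].
Proof.
move=> MK H; apply/setP => s; rewrite in_full_sub finset.in_set finset.properEneq.
have [->|sM] := eqVneq s M; first by rewrite (negPf MK).
by case sub: (s \subset M); rewrite ?andbF // andbT H // finset.properEneq sM.
Qed.

Lemma nonface_neq0 M : M \notin faces K -> M != finset.set0.
Proof. by apply: contraNneq => ->; exact: face_set0. Qed.

Variable sg : {set 'I_m}.
Hypothesis sg_facet : facet K sg.

Let sgK : sg \in faces K := maxsetp sg_facet.
Let sg_max t : t \in faces K -> sg \subset t -> t = sg.
Proof. by move=> tK st; exact: (maxsetsup sg_facet). Qed.

Section Homology.
Variable F : fieldType.

Let N : pred {set 'I_m} := [pred J | rhomology_rank F (full_sub K J) != 0%N].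

Let N0 : N finset.set0.
Proof.
have := rhomology_rankE F (down_closed_convex (@full_sub_down_closed _ K finset.set0)).
have -> : #|full_sub K finset.set0| = 1%N.
  rewrite -(cards1 (finset.set0 : {set 'I_m})); congr #|pred_of_set _|.
  apply/setP => s; rewrite in_full_sub finset.in_set1 finset.subset0 andbC.
  by case: eqP => // ->; rewrite face_set0.
move=> bE; apply/eqP => b0; move: bE; rewrite b0 add0n mul2n => /(congr1 odd).
by rewrite odd_double.
Qed.

Let N_nonface M : M \notin faces K ->
  (forall t, t \proper M -> t \in faces K) -> N M.
Proof.
move=> MK H; apply: (@rhomology_rank_proper_neq0 F m M); first exact: nonface_neq0.
exact: full_sub_nonface.
Qed.

Let N_join J w0 t0 : [disjoint J & sg] -> w0 \in J ->
  t0 \subset sg -> w0 |: t0 \in faces K ->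
  exists t, [/\ t \subset sg, ~~ (t \subset t0) & N (J :|: t)].
Proof.
move=> Jsg w0J t0sg w0t0; apply: contrapT => no.
have w0sg : w0 \notin sg by rewrite (disjointFr Jsg).
(* Below [t0] the full subcomplex is replaced by a simplex with vertex [w0], acyclic for free, so
   the failure of acyclicity must occur at some [t] not inside [t0]. *)
pose X t := if t \subset t0 then powerset (w0 |: t) else full_sub K (J :|: t).
have [t|t t' tt' t's|t ts|t ts|v vs|s sX sgs] := @acyclic_zigzag F m sg X.
- rewrite /X; case: ifP => _; [exact: down_closed_powerset|exact: full_sub_down_closed].
- rewrite /X; case: (boolP (t' \subset t0)) => t't0.
    rewrite (fintype.subset_trans tt' t't0); apply/fintype.subsetP => s.
    by rewrite !powersetE => st; apply: fintype.subset_trans st _; exact: finset.setUS.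
  case: ifP => tt0; last by apply: full_subS; exact: finset.setUS.
  apply/fintype.subsetP => s; rewrite powersetE in_full_sub => st.
  apply/andP; split.
    by apply: face_sub w0t0 _; apply: fintype.subset_trans st _; exact: finset.setUS.
  apply: fintype.subset_trans st _; rewrite finset.subUset finset.sub1set finset.in_setU w0J /=.
  exact: fintype.subset_trans tt' (finset.subsetUr _ _).
- rewrite /X; case: ifP => _; first by rewrite powersetE finset.subsetUr.
  by rewrite in_full_sub (face_sub sgK) // finset.subsetUr.
- rewrite /X; case: (boolP (t \subset t0)) => tt0.
    apply: (@rhomology_rank_cone _ _ _ w0).
      by apply: down_closed_convex; exact: down_closed_powerset.
    by move=> s; rewrite !powersetE finset.subUset finset.sub1set finset.setU11 /= finset.subDset finset.setUA finset.setUid -finset.subDset finset.subDset.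
  apply/eqP; apply: contraT => Nt; case: no; exists t; split=> //.
- rewrite /X; case: ifP => _.
    rewrite powersetE; apply/fintype.subsetPn; exists v => //.
    by rewrite finset.in_setU1 finset.setD11 orbF; apply: contraNneq w0sg => <-.
  rewrite in_full_sub negb_and; apply/orP; right; apply/fintype.subsetPn; exists v => //.
  by rewrite finset.in_setU finset.setD11 orbF (disjointFl Jsg).
have sK : s \in faces K.
  move: sX; rewrite /X; case: ifP => [st0|_]; last by rewrite in_full_sub => /andP[].
  rewrite powersetE => ss; apply: face_sub w0t0 _.
  by apply: fintype.subset_trans ss _; exact: finset.setUS.
by have := sg_max sK (fintype.proper_sub sgs) => sE; rewrite sE fintype.properxx in sgs.
Qed.

Lemma taut_structure_homology :
  (#|[set J | rhomology_rank F (full_sub K J) != 0%N]| <= 2 ^ (m - #|sg|))%N ->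
  exists T, taut_structure K sg T.
Proof. exact: (taut_structure_exists sg_facet N0 N_nonface N_join). Qed.

Lemma card_homology_ge :
  (2 ^ (m - #|sg|) <= #|[set J | rhomology_rank F (full_sub K J) != 0%N]|)%N.
Proof. exact: (card_N_ge N0 N_join). Qed.

End Homology.

Section Topology.
Variable R : realType.

Let N : pred {set 'I_m} := [pred J | ~~ `[< htpy_point R (full_sub K J) >]].

Let not_contractible_N J :
  ~ contractible R (realization (full_sub K J) : set 'rV[R]_m) -> N J.
Proof.
by move=> nc; apply/negP => /asboolP/htpy_point_contractible.
Qed.

Let N0 : N finset.set0.
Proof.
apply: not_contractible_N => -[p [H [_ _ /realizationE[ps +] _ _]]].
rewrite in_full_sub finset.subset0 => /andP[_ /eqP p0].
by have := supp_neq0 ps; rewrite p0 eqxx.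
Qed.

Let N_nonface M : M \notin faces K ->
  (forall t, t \proper M -> t \in faces K) -> N M.
Proof.
move=> MK H; apply: not_contractible_N; rewrite full_sub_nonface //.
exact/proper_family_not_contractible/nonface_neq0.
Qed.

Let N_join J w0 t0 : [disjoint J & sg] -> w0 \in J ->
  t0 \subset sg -> w0 |: t0 \in faces K ->
  exists t, [/\ t \subset sg, ~~ (t \subset t0) & N (J :|: t)].
Proof.
move=> Jsg w0J t0sg w0t0.
have [t [ts tt0 nc]] := exists_not_contractible R sgK sg_max Jsg w0J t0sg w0t0.
by exists t; split=> //; exact: not_contractible_N.
Qed.

Lemma taut_structure_topology :
  (#|[set J | ~~ `[< htpy_point R (full_sub K J) >]]| <= 2 ^ (m - #|sg|))%N ->
  exists T, taut_structure K sg T.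
Proof. exact: (taut_structure_exists sg_facet N0 N_nonface N_join). Qed.

End Topology.

Section Structure.
Variable T : 'I_m -> {set 'I_m}.
Hypothesis TS : taut_structure K sg T.

Lemma taylor_eq0 v M (Gs : seq {set 'I_m}) (U : {set 'I_m}) : v \in U -> v \notin M ->
  (forall N, N \in Gs -> v \notin N) -> taylor M Gs U = 0%N.
Proof.
move=> vU; elim: Gs M => [|N Gs IH] M vM vG /=.
  by apply/eqP; rewrite eqb0; apply: contraNneq vM => ->.
have vG' N' : N' \in Gs -> v \notin N' by move=> H; apply: vG; rewrite inE H orbT.
by rewrite !IH // finset.in_setU negb_or vM vG // mem_head.
Qed.

(** Each generator [w |: T w] owns the vertex [w], found in no other generator, so a symbol of
    degree [U] has to use all of them. *)
Lemma taylor_le1 (ws : seq 'I_m) M (U : {set 'I_m}) : uniq ws -> {subset ws <= U} ->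
  (forall w, w \in ws -> w \notin M) -> (forall w, w \in ws -> w \notin sg) ->
  (taylor M [seq w |: T w | w <- ws] U <= 1)%N.
Proof.
elim: ws M => [|w ws IH] M /=; first by case: (M == U).
move=> /andP[wws uws] wU wM wsg.
have sub v : v \in ws -> v \in w :: ws by move=> H; rewrite inE H orbT.
have Tout v u : v \in w :: ws -> u \in w :: ws -> u \notin T v.
  move=> /wsg vsg /wsg usg; apply: contra usg; apply: fintype.subsetP.
  by have [Tsg _] := TS; exact: Tsg.
rewrite (@taylor_eq0 w) ?add0n ?wU ?wM ?mem_head //; last first.
  move=> N /mapP[v vws ->]; rewrite finset.in_setU1 negb_or Tout ?mem_head ?sub // andbT.
  by apply: contraNneq wws => ->.
apply: IH => // [v /sub/wU //|v vws|v /sub/wsg //].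
rewrite finset.in_setU negb_or wM ?sub //= finset.in_setU1 negb_or Tout ?mem_head ?sub // andbT.
by apply: contraNneq wws => <-.
Qed.

Lemma full_sub_avoiding J : full_sub K J =
  avoiding finset.set0 [seq w |: T w | w <- enum (J :\: sg)] J.
Proof.
have [_ TK] := TS.
apply/setP => s; rewrite in_full_sub in_avoiding finset.sub0set /= andbC.
case: (boolP (s \subset J)) => //= sJ; apply/idP/allP => [/TK H N /mapP[w + ->]|H].
  rewrite mem_enum finset.in_setD finset.subUset finset.sub1set negb_and => /andP[wsg _].
  by case: (boolP (w \in s)) => // ws; exact: H.
apply/TK => w ws wsg; have := H (w |: T w); rewrite finset.subUset finset.sub1set ws /=; apply.
by apply/mapP; exists w => //; rewrite mem_enum finset.in_setD wsg (fintype.subsetP sJ).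
Qed.

Lemma rhomology_rank_le1 (F : fieldType) J : (rhomology_rank F (full_sub K J) <= 1)%N.
Proof.
rewrite full_sub_avoiding; apply: leq_trans (rhomology_rank_taylor _ _ _ _) _.
apply: taylor_le1; first exact: enum_uniq.
- by move=> w; rewrite mem_enum finset.in_setD => /andP[].
- by move=> w _; rewrite finset.in_set0.
by move=> w; rewrite mem_enum finset.in_setD => /andP[].
Qed.

Lemma rhomology_rank_not_full (F : fieldType) J : ~~ taut_full sg T J ->
  rhomology_rank F (full_sub K J) = 0%N.
Proof.
case/(not_full_cone TS) => v [vJ cone].
have dL := @full_sub_down_closed _ K J.
apply: (@rhomology_rank_cone _ _ _ v); first exact: down_closed_convex.
move=> s; apply/idP/idP => H.
  by apply: dL H _; exact: fintype.subset_trans (finset.subD1set _ _) (finset.subsetUr _ _).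
have := cone _ H; suff -> : v |: s :\ v = v |: s by [].
by apply/setP => w; rewrite !finset.inE; case: (w == v).
Qed.

(** No cycle is exhibited for a full [J]: the other sets are acyclic, and [card_homology_ge] demands
    as many non-acyclic sets as there are full ones. *)
Lemma homology_full (F : fieldType) :
  [set J | rhomology_rank F (full_sub K J) == 1%N] = [set J | taut_full sg T J].
Proof.
have -> : [set J | rhomology_rank F (full_sub K J) == 1%N] =
    [set J | rhomology_rank F (full_sub K J) != 0%N].
  apply/setP => J; rewrite !finset.in_set.
  by case: (rhomology_rank _ _) (rhomology_rank_le1 F J) => [|[]].
apply/eqP; rewrite eqEcard (card_taut_full TS) card_homology_ge andbT.
apply/fintype.subsetP => J; rewrite !finset.in_set; apply: contraR => nf.
by rewrite rhomology_rank_not_full.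
Qed.

Lemma not_full_htpy_point (R : realType) J : ~~ taut_full sg T J ->
  htpy_point R (full_sub K J).
Proof.
case/(not_full_cone TS) => v [vJ cone].
apply: (@cone_htpy_point R m _ (@full_sub_down_closed _ K J) v) => //.
by rewrite in_full_sub face_set0 finset.sub0set.
Qed.

Lemma full_htpy_sphere (R : realType) J : taut_full sg T J ->
  htpy_sphere R (full_sub K J).
Proof.
move=> /eqP JT; have [_ TK] := TS; exists #|J :&: sg|.
apply: (@family_htpy_sphere R m (J :&: sg) (J :\: sg) T).
- by rewrite -setI_eq0; apply/eqP/setP => i; rewrite !finset.inE; case: (i \in sg); rewrite ?andbF.
- by move=> w wJ; rewrite JT; exact: finset.bigcup_sup.
- by move=> v; rewrite JT => /finset.bigcupP[w wJ vw]; exists w.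
move=> s; rewrite in_full_sub finset.setID; split=> [/andP[sK sJ]|[sJ H]].
  split=> // w; rewrite finset.in_setD => /andP[wsg _] ws; exact: (TK s).1.
rewrite sJ andbT; apply/TK => w ws wsg; apply: H => //.
by rewrite finset.in_setD wsg (fintype.subsetP sJ).
Qed.

Lemma htpy_sphere_not_point (R : realType) (L : {set {set 'I_m}}) :
  htpy_sphere R L -> ~ htpy_point R L.
Proof.
move=> [n Ls] Lp; apply: (@sphere_not_htpy_point R n).
exact: homotopy_equiv_trans (homotopy_equiv_sym Ls) Lp.
Qed.

Lemma sphere_full (R : realType) :
  [set J | `[< htpy_sphere R (full_sub K J) >]] = [set J | taut_full sg T J].
Proof.
apply/setP => J; rewrite !finset.in_set; apply/asboolP/idP => [sJ|].
  by apply: contraT => /not_full_htpy_point/(htpy_sphere_not_point sJ).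
exact: full_htpy_sphere.
Qed.

End Structure.
End TautComplexes.

Theorem corollary1p11 (R : realType) (F : fieldType) (m : nat) (K : scomplex m) :
  (weakly_taut F K <->
     ((forall J : {set 'I_m},
         htpy_point R (full_sub K J) \/ htpy_sphere R (full_sub K J)) /\
      #|[set J : {set 'I_m} | `[< htpy_sphere R (full_sub K J) >]]%SET|
        = taut_number K)) /\
  (weakly_taut F K <->
     ((forall J : {set 'I_m},
         rhomology_rank F (full_sub K J) = 0%N \/
         rhomology_rank F (full_sub K J) = 1%N) /\
      #|[set J : {set 'I_m} | rhomology_rank F (full_sub K J) == 1%N]%SET|
        = taut_number K)).
Proof.
have [sg sg_facet tE] := mdim_facet K.
have rank01 (J : {set 'I_m}) : (rhomology_rank F (full_sub K J) <= 1)%N ->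
    rhomology_rank F (full_sub K J) = 0%N \/ rhomology_rank F (full_sub K J) = 1%N.
  by case: (rhomology_rank _ _) => [|[|]] //; [left|right].
have sum_rank :
    (forall J, rhomology_rank F (full_sub K J) <= 1)%N ->
    (\sum_J rhomology_rank F (full_sub K J))%N =
    #|[set J : {set 'I_m} | rhomology_rank F (full_sub K J) == 1%N]%SET|.
  move=> le1; rewrite -sum1_card [RHS]big_mkcond; apply: eq_bigr => J _.
  by rewrite finset.in_set; have := le1 J; case: (rhomology_rank _ _) => [|[|]].
have c_a : (forall J, rhomology_rank F (full_sub K J) <= 1)%N ->
    #|[set J : {set 'I_m} | rhomology_rank F (full_sub K J) == 1%N]%SET|
      = taut_number K -> weakly_taut F K.
  by move=> le1 cE; apply/hochster; rewrite sum_rank.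
have a_structure : weakly_taut F K -> exists T, taut_structure K sg T.
  move=> /hochster sumE; apply: (taut_structure_homology sg_facet (F := F)).
  (* Each non-acyclic [J] contributes at least 1 to the total Betti number. *)
  rewrite -tE -sumE -sum1_card big_mkcond; apply: leq_sum => J _.
  by rewrite finset.in_set; case: (rhomology_rank _ _).
have structure_c T : taut_structure K sg T ->
    (forall J, rhomology_rank F (full_sub K J) <= 1)%N /\
    #|[set J : {set 'I_m} | rhomology_rank F (full_sub K J) == 1%N]%SET| = taut_number K.
  move=> TS; split; first exact: rhomology_rank_le1 TS F.
  by rewrite (homology_full sg_facet TS) (card_taut_full TS).
split; split.
- move=> /a_structure[T TS]; rewrite (sphere_full TS) (card_taut_full TS); split=> // J.
  have [full|nfull] := boolP (taut_full sg T J).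
    by right; exact: full_htpy_sphere TS R J full.
  by left; exact: not_full_htpy_point TS R J nfull.
- move=> [point_or_sphere cE].
  have [|T TS] := @taut_structure_topology _ _ _ sg_facet R.
    (* By hypothesis a full subcomplex that is not a homotopy point is a sphere, so the number of
       spheres bounds the number of non-points. *)
    rewrite -tE -cE; apply/subset_leq_card/fintype.subsetP => J; rewrite !finset.in_set.
    move=> /negP np; apply/asboolP; have [p|//] := point_or_sphere J.
    by case: np; apply/asboolP.
  by have [le1 card1] := structure_c T TS; exact: c_a.
- move=> /a_structure[T /structure_c[le1 card1]]; split=> // J.
  exact: rank01.
move=> [rank01' card1]; apply: c_a => // J.
by have [->|->] := rank01' J.
Qed.
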